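(* Let $1\le p<\infty$, let $v$ be a strictly positive weight on $\mathbb T^n$, and let $0<T<\frac12$. Then $v\in D_p^{T}$ (the weight class defined in the context) if and only if for every $f\in L^p_v(\mathbb T^n)$ the function $u(x,t)=\phi_t*f(x)$ is a solution of the heat equation $\frac{\partial u}{\partial t}(x,t)=\Delta_x u(x,t)$ on $\mathbb T^n$ for $t\in(0,T]$, and $$\lim_{t\to0^+}u(x,t)=f(x)\quad\text{for almost every }x\in\mathbb T^n.$$
   Context: $\mathbb T^n=\mathbb R^n/\mathbb Z^n$ is identified with $Q_n=[-\frac12,\frac12)^n$ with Lebesgue measure; functions on $\mathbb T^n$ are identified with functions on $\mathbb R^n$ that are $1$-periodic in each coordinate. A weight is a measurable function with values in $(0,\infty)$. For $t>0$ the heat kernel on $\mathbb T^n$ is $$\phi_t(x)=(4\pi t)^{-n/2}\sum_{k\in\mathbb Z^n}e^{-\frac{|x+k|^2}{4t}},$$ and $\phi_t*f(x)=\int_{\mathbb T^n}\phi_t(x-y)f(y)\,dy$ is convolution on $\mathbb T^n$. For $1\le p<\infty$, $L^p_v(\mathbb T^n)$ is the space of measurable $f:\mathbb T^n\to\mathbb C$ with $\|f\|_{L^p_v(\mathbb T^n)}=\|fv^{1/p}\|_{L^p(\mathbb T^n)}<\infty$. Let $\frac1p+\frac1{p'}=1$ (so $p'=\infty$ if $p=1$). The class $D_p^{T}$ (the superscript $T$ stands for ''torus'' and is unrelated to the time $T$) consists of the weights $v$ on $\mathbb T^n$ for which there exists $t_0>0$ such that $v^{-1/p}\phi_{t_0}\in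 L^{p'}(\mathbb T^n)$. That $u=\phi_t*f$ is a solution for $t\in(0,T]$ means that the convolution integral converges absolutely and $u$ satisfies the differential equation for these $t$. *)

(* Defs.v *)
From HB Require Import structures.
From mathcomp Require Import all_boot all_order all_algebra.
From mathcomp Require Import complex.
From mathcomp Require Import all_classical all_reals all_analysis.

Set Implicit Arguments.
Unset Strict Implicit.
Unset Printing Implicit Defensive.
Import Order.TTheory GRing.Theory Num.Theory.
Import numFieldNormedType.Exports.
Import ComplexField.Normc.

Local Open Scope classical_set_scope.
Local Open Scope ring_scope.
Local Open Scope complex_scope.

Section tuple_measure.
Context {R : realType}.
Implicit Type n : nat.

Definition tcons n (z : measurableTypeR R * n.-tuple R) : n.+1.-tuple R :=
  [tuple of z.1 :: z.2].

Lemma measurable_tcons n : measurable_fun setT (@tcons n).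
Proof. exact: measurable_cons. Qed.

Definition tsplit n (x : n.+1.-tuple R) : measurableTypeR R * n.-tuple R :=
  (thead x, [tuple of behead x]).

Lemma tconsK n : cancel (@tcons n) (@tsplit n).
Proof.
move=> [a t]; rewrite /tsplit /tcons /=; congr (_, _).
exact/val_inj.
Qed.

Lemma tsplitK n : cancel (@tsplit n) (@tcons n).
Proof. by move=> x; rewrite [RHS]tuple_eta. Qed.

Lemma measurable_tsplit n : measurable_fun setT (@tsplit n).
Proof.
apply/measurable_fun_pairP; split; first exact: measurable_tnth.
exact: measurable_behead.
Qed.

Definition tensor n (m : {sigma_finite_measure set (n.-tuple R) -> \bar R}) :
    set (n.+1.-tuple R) -> \bar R :=
  pushforward (@lebesgue_measure R \x m)%E (@tcons n).

Section tensor_measure.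
Context n (m : {sigma_finite_measure set (n.-tuple R) -> \bar R}).

Let tensor0 : tensor m set0 = 0%E.
Proof. by rewrite /tensor /pushforward preimage_set0 measure0. Qed.

Let tensor_ge0 A : (0 <= tensor m A)%E.
Proof. by rewrite /tensor /pushforward measure_ge0. Qed.

Let tensor_sigma_additive : semi_sigma_additive (tensor m).
Proof.
move=> F mF tF mUF; rewrite /tensor /pushforward preimage_bigcup.
apply: measure_semi_sigma_additive.
- by move=> i; rewrite -[X in measurable X]setTI; exact: measurable_tcons.
- apply/trivIsetP => /= i j _ _ ij; rewrite -preimage_setI.
  by move/trivIsetP : tF => /(_ _ _ _ _ ij) ->//; rewrite preimage_set0.
- rewrite -preimage_bigcup -[X in measurable X]setTI.
  exact: measurable_tcons.
Qed.

HB.instance Definition _ := isMeasure.Build _ _ _ (tensor m)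
  tensor0 tensor_ge0 tensor_sigma_additive.

Let tensor_sigma_finite : sigma_finite setT (tensor m).
Proof.
have /sigma_finiteP[F [TF ndF Foo]] := sigma_finiteT (@lebesgue_measure R).
have /sigma_finiteP[G [TG ndG Goo]] := sigma_finiteT m.
exists (fun k => @tsplit n @^-1` (F k `*` G k)).
  rewrite -preimage_bigcup [X in _ @^-1` X](_ : _ = setT) ?preimage_setT//.
  rewrite -setXTT TF TG predeqE => -[x y]; split.
    by move=> [k _ []/= ? ?]; split; exists k.
  move=> [/= [k _ Fkx] [l _ Gly]]; exists (maxn k l) => //; split.
  - by move: x Fkx; exact/subsetPset/ndF/leq_maxl.
  - by move: y Gly; exact/subsetPset/ndG/leq_maxr.
move=> k; have [mFk Fk] := Foo k; have [mGk Gk] := Goo k.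
have mFG : measurable (F k `*` G k) by exact: measurableX.
split; first by rewrite -[X in measurable X]setTI; exact: measurable_tsplit.
rewrite /= /tensor /pushforward -comp_preimage.
rewrite (_ : _ \o _ = id) ?preimage_id; last first.
  by apply/funext => z /=; rewrite tconsK.
by rewrite product_measure1E// lte_mul_pinfty// ge0_fin_numE.
Qed.

HB.instance Definition _ := Measure_isSigmaFinite.Build _ _ _ (tensor m)
  tensor_sigma_finite.

End tensor_measure.

(* Lebesgue measure on the Borel sets of R^n, as an n-fold product *)
Fixpoint borel_lebesgue n : {sigma_finite_measure set (n.-tuple R) -> \bar R} :=
  match n with
  | 0 => \d_ [tuple]
  | n'.+1 => tensor (borel_lebesgue n')
  end.

Lemma borel_lebesgue_box n (A : 'I_n -> set R) :
  (forall i, measurable (A i)) ->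
  borel_lebesgue n [set x | forall i, A i (tnth x i)] =
  (\prod_(i < n) lebesgue_measure (A i))%E.
Proof.
elim: n A => [|n IH] A mA /=.
  by rewrite big_ord0 diracE mem_set // => -[].
rewrite /tensor /pushforward big_ord_recl -IH; last by move=> i; exact: mA.
rewrite -product_measure1E; first last.
- rewrite (_ : [set x | _] = \bigcap_(i in [set: 'I_n])
      (fun x : n.-tuple R => tnth x i) @^-1` A (lift ord0 i)).
    apply: fin_bigcap_measurable => // i _.
    by rewrite -[X in measurable X]setTI; exact: measurable_tnth.
  by apply/seteqP; split => x /= H i; [move=> _; exact: H|exact: (H i)].
- exact: mA.
congr (_ _); apply/seteqP; split => -[a t] /=.
- move=> H; split; first exact: (H ord0).
  by move=> i /=; have := H (lift ord0 i); rewrite tnthS.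
- move=> [Ha Ht] i; case: (unliftP ord0 i) => [j ->|->] //.
  by rewrite tnthS; exact: Ht.
Qed.

End tuple_measure.

Section torus.
Context {R : realType}.

(* R^n with the sigma-algebra of Lebesgue measurable sets, which are the
   Caratheodory measurable sets of the outer measure of borel_lebesgue *)
Definition Rn n : measurableType _ :=
  caratheodory_type (@borel_lebesgue R n)^*%mu.

Definition lebesgue n : {measure set (Rn n) -> \bar R} :=
  @completed_measure_extension _ _ _ (@borel_lebesgue R n).

Lemma lebesgueE n (A : set (n.-tuple R)) :
  measurable A -> lebesgue n A = borel_lebesgue n A.
Proof. by move=> mA; exact: measurable_mu_extE. Qed.

Definition Qcube n : set (Rn n) :=
  [set x | forall i : 'I_n, - 2^-1 <= tnth x i < 2^-1].
Arguments Qcube : clear implicits.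

Lemma measurable_Qcube n : measurable (Qcube n).
Proof.
apply: sub_caratheodory; apply: sub_sigma_algebra.
rewrite (_ : Qcube n = \bigcap_(i in [set: 'I_n])
    (fun x : n.-tuple R => tnth x i) @^-1` `[- 2^-1, 2^-1[).
  apply: fin_bigcap_measurable => // i _.
  by rewrite -[X in measurable X]setTI; exact: measurable_tnth.
by apply/seteqP; split => x /= H i; [move=> _|]; have := H i;
  rewrite ?in_itv //=; apply.
Qed.

(* A function on the torus is represented by its periodic lift to R^n, and
   integrated over the fundamental domain Qcube n. *)
Definition torus n : {measure set (Rn n) -> \bar R} :=
  mrestr (lebesgue n) (@measurable_Qcube n).

Definition set_coord n (x : Rn n) (i : 'I_n) (s : R) : Rn n :=
  [tuple if j == i then s else tnth x j | j < n].

Definition torus_periodic n (A : Type) (f : Rn n -> A) :=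
  forall x i, f (set_coord x i (tnth x i + 1)) = f x.

Definition cmeasurable n (f : Rn n -> R[i]) :=
  measurable_fun setT (fun x => complex.Re (f x)) /\
  measurable_fun setT (fun x => complex.Im (f x)).

Definition weight n (v : Rn n -> R) :=
  [/\ measurable_fun setT v, torus_periodic v & forall x, 0 < v x].

Definition translate n (x : Rn n) (k : n.-tuple int) : Rn n :=
  [tuple tnth x i + (tnth k i)%:~R | i < n].

Definition Rn_sub n (x y : Rn n) : Rn n := [tuple tnth x i - tnth y i | i < n].

Definition sqnorm n (x : Rn n) : R := \sum_(i < n) tnth x i ^+ 2.

Definition heat_kernel n (t : R) (x : Rn n) : R :=
  (4 * pi * t) `^ (- (n%:R / 2)) *
  fine (\esum_(k in [set: n.-tuple int])
          (expR (- (sqnorm (translate x k) / (4 * t))))%:E).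

Definition Lpv n (p : R) (v : Rn n -> R) (f : Rn n -> R[i]) :=
  [/\ cmeasurable f, torus_periodic f &
   (Lnorm (torus n) p%:E (fun x => (normc (f x) * v x `^ p^-1)%:E) < +oo)%E].

Definition DpT n (p : R) (v : Rn n -> R) :=
  exists2 t0 : R, 0 < t0 &
  (Lnorm (torus n) (hoelder_conjugate p%:E)
     (fun x => (v x `^ (- p^-1) * heat_kernel t0 x)%:E) < +oo)%E.

Definition heat_conv n (f : Rn n -> R[i]) (x : Rn n) (t : R) : R[i] :=
  (\int[torus n]_y (heat_kernel t (Rn_sub x y) * complex.Re (f y))) +i*
  (\int[torus n]_y (heat_kernel t (Rn_sub x y) * complex.Im (f y))).

Definition heat_conv_abs_cvg n (f : Rn n -> R[i]) (x : Rn n) (t : R) : Prop :=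
  (torus n).-integrable setT
    (fun y => (heat_kernel t (Rn_sub x y) * normc (f y))%:E).

(* R[i] is not a normed module over R in the libraries: derivatives of
   functions R -> R[i] are taken componentwise. *)
Definition cderivable (g : R -> R[i]) (s : R) :=
  derivable (fun r => complex.Re (g r)) s 1 /\
  derivable (fun r => complex.Im (g r)) s 1.

Definition cderive (g : R -> R[i]) (s : R) : R[i] :=
  (derive1 (fun r => complex.Re (g r)) s) +i*
  (derive1 (fun r => complex.Im (g r)) s).

Definition pderivable n (i : 'I_n) (w : Rn n -> R[i]) (x : Rn n) :=
  cderivable (fun s => w (set_coord x i s)) (tnth x i).

Definition pderive n (i : 'I_n) (w : Rn n -> R[i]) (x : Rn n) : R[i] :=
  cderive (fun s => w (set_coord x i s)) (tnth x i).

Definition laplacian n (w : Rn n -> R[i]) (x : Rn n) : R[i] :=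
  \sum_(i < n) pderive i (pderive i w) x.

(* The first partial derivatives must exist everywhere for the second ones to
   make sense at x; all points are then required at once, since a solution
   satisfies the equation at every x. *)
Definition heat_equation_at n (u : Rn n -> R -> R[i]) (x : Rn n) (t : R) :=
  [/\ cderivable (u x) t,
      forall i y, pderivable i (u ^~ t) y,
      forall i y, pderivable i (pderive i (u ^~ t)) y &
      cderive (u x) t = laplacian (u ^~ t) x].

Definition heat_conv_solution n (f : Rn n -> R[i]) (T : R) :=
  forall (x : Rn n) t, 0 < t <= T ->
    heat_conv_abs_cvg f x t /\ heat_equation_at (heat_conv f) x t.

Definition ae_initial_limit n (f : Rn n -> R[i]) :=
  {ae torus n, forall x, normc (heat_conv f x t - f x) @[t --> 0^'+] --> 0}.

End torus.

Arguments Rn : clear implicits.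
Arguments Qcube {R} n _.

(* Main.v *)
Require Import Defs.
From HB Require Import structures.
From mathcomp Require Import all_boot all_order all_algebra.
From mathcomp Require Import complex.
From mathcomp Require Import all_classical all_reals all_analysis.
From mathcomp Require Import measurable_realfun ess_sup_inf.
From mathcomp Require Import ring lra zify.

Set Implicit Arguments.
Unset Strict Implicit.
Unset Printing Implicit Defensive.
Import Order.TTheory GRing.Theory Num.Theory.
Import numFieldNormedType.Exports.
Import ComplexField.Normc.

Local Open Scope classical_set_scope.
Local Open Scope ring_scope.

(** A heat semigroup on a probability space whose kernel [K] satisfies
    [K t <= C * K (2 t)] obeys the Hopf-Dunford-Schwartz maximal inequality in
    Garsia's form: the doubling lets times in a dyadic block be dominated by
    powers of one operator. Almost everywhere convergence of [K t * f] as [t]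
    tends to 0 follows for every integrable [f >= 0] once the oscillation
    [int int K t x y |f x - f y|] tends to 0, and by a monotone class argument
    this only has to be checked for half-spaces, where it is the concentration
    of the one-dimensional kernel. The kernel of the torus is a product of
    one-dimensional theta functions, with the gaussian bounds inherited from
    its terms, so that [phi_t * f] can be differentiated under the integral for
    every integrable [f].

    The kernel is bounded above and bounded away from 0, so [v] is in [D_p^T]
    exactly when [v^(-1/p)] is in [L^p'], and every solution forces [f] to be
    integrable. Hoelder's inequality gives one direction. For the other, if
    [v^(-1/p)] is not in [L^p'], normalized truncations [G_k] with
    [int G_k^p <= 1] and [int G_k v^(-1/p) >= 4^k] add up to a function
    [F (v)] of [L^p_v] that is not integrable; being a function of [v] it is
    periodic. *)

(** * The maximal inequality for diffusion semigroups *)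

Section diffusion.
Context d (X : measurableType d) (R : realType) (mu : probability X R).
Local Open Scope ereal_scope.

(** The classical proof joins a covering lemma to a dense class of continuous functions; neither
    appears here, which is why any probability space will do. The dense class is replaced by the
    smoothings of [f] itself: as t tends to 0, K (t + d) * f tends to K d * f by continuity in time,
    while K t * f - K (t + d) * f is dominated by K t applied to h = |f - K d * f|, whose integral
    is at most the oscillation of [f] at time d. The maximal inequality is applied to this h only.
    In its constant 4 C^2, one C compares a time with the grid time just above it, the other
    compares that grid time with the later ones of its block, and the 4 beats the factor 2 lost by
    summing from time 0 to the end of the block. The measure [torus] lives on a Caratheodory
    sigma-algebra, whereas Tonelli is applied to product sigma-algebras; so the semigroup is built
    on Borel tuples and functions are carried over by Borel modification. *)

Definition nnmeas (h : X -> \bar R) : Prop :=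
  measurable_fun [set: X] h /\ (forall x, 0 <= h x).

(** Symmetry and mass one together make the operators preserve integrals; boundedness keeps the
    image of an integrable function finite. Doubling is asked at all intermediate times so that a
    whole block of times can be compared with its first one. *)
Record diffusion (K : R -> X -> X -> R) (C : R) : Prop := Diffusion {
  diffusion_const : (0 < C)%R ;
  diffusion_meas : forall t, (0 < t)%R ->
    measurable_fun setT (fun z : X * X => K t z.1 z.2) ;
  diffusion_ge0 : forall t x y, (0 < t)%R -> (0 <= K t x y)%R ;
  diffusion_sym : forall t x y, (0 < t)%R -> K t x y = K t y x ;
  diffusion_mass : forall t x, (0 < t)%R -> \int[mu]_y (K t x y)%:E = 1 ;
  diffusion_semigroup : forall s t x z, (0 < s)%R -> (0 < t)%R ->
    \int[mu]_y ((K s x y)%:E * (K t y z)%:E) = (K (s + t)%R x z)%:E ;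
  diffusion_doubling : forall s t x y, (0 < t)%R -> (t <= s <= 2 * t)%R ->
    (K t x y <= C * K s x y)%R ;
  diffusion_bounded : forall t, (0 < t)%R ->
    exists M : R, forall x y, (K t x y <= M)%R
}.

Variables (K : R -> X -> X -> R) (C : R).
Hypothesis HK : diffusion K C.

Definition dif t (h : X -> \bar R) x := \int[mu]_y ((K t x y)%:E * h y).

Let mK2 (t : R) : (0 < t)%R -> measurable_fun setT (fun z : X * X => (K t z.1 z.2)%:E).
Proof. by move=> t0; apply/measurable_EFinP; exact: diffusion_meas HK _ t0. Qed.

Let mK (t : R) x : (0 < t)%R -> measurable_fun setT (fun y => (K t x y)%:E).
Proof.
move=> t0; exact: (measurable_fun_pair2 (f := fun z => (K t z.1 z.2)%:E) x (mK2 t0)).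
Qed.

Let K0 (t : R) x y : (0 < t)%R -> 0 <= (K t x y)%:E.
Proof. by move=> t0; rewrite lee_fin (diffusion_ge0 HK). Qed.

Lemma dif_meas_integrand (t : R) h x : (0 < t)%R -> nnmeas h ->
  measurable_fun setT (fun y => (K t x y)%:E * h y).
Proof. by move=> t0 [mh _]; apply: emeasurable_funM => //; exact: mK. Qed.

Lemma dif_ge0_integrand t h x y : (0 < t)%R -> nnmeas h -> 0 <= (K t x y)%:E * h y.
Proof. by move=> t0 [_ h0]; rewrite mule_ge0// K0. Qed.

Let mKh2 (t : R) h : (0 < t)%R -> nnmeas h ->
  measurable_fun setT (fun z : X * X => (K t z.1 z.2)%:E * h z.2).
Proof.
move=> t0 [mh _]; apply: emeasurable_funM; first exact: mK2.
exact: (measurableT_comp mh).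
Qed.

Lemma nnmeas_dif (t : R) h : (0 < t)%R -> nnmeas h -> nnmeas (dif t h).
Proof.
move=> t0 nh; split; last first.
  by move=> x; apply: integral_ge0 => y _; exact: dif_ge0_integrand.
apply: (measurable_fun_fubini_tonelli_F (m2 := mu)
  (fun z : X * X => (K t z.1 z.2)%:E * h z.2)) => //; first exact: mKh2.
by move=> z; exact: dif_ge0_integrand.
Qed.

Lemma le_dif (t : R) h1 h2 x : (0 < t)%R -> nnmeas h1 -> nnmeas h2 ->
  (forall y, h1 y <= h2 y) -> dif t h1 x <= dif t h2 x.
Proof.
move=> t0 n1 n2 h12; apply: ge0_le_integral => //.
- by move=> y _; exact: dif_ge0_integrand.
- exact: dif_meas_integrand.
- exact: dif_meas_integrand.
- by move=> y _; rewrite lee_wpmul2l ?K0.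
Qed.

Lemma difD (t : R) h1 h2 x : (0 < t)%R -> nnmeas h1 -> nnmeas h2 ->
  dif t (h1 \+ h2) x = dif t h1 x + dif t h2 x.
Proof.
move=> t0 n1 n2; rewrite /dif -ge0_integralD//.
- apply: eq_integral => y _ /=; rewrite ge0_muleDr//; [exact: n1.2|exact: n2.2].
- by move=> y _; exact: dif_ge0_integrand.
- exact: dif_meas_integrand.
- by move=> y _; exact: dif_ge0_integrand.
- exact: dif_meas_integrand.
Qed.

Lemma dif_cst (t : R) x (c : R) : (0 < t)%R -> (0 <= c)%R -> dif t (cst c%:E) x = c%:E.
Proof.
move=> t0 c0; rewrite /dif.
under eq_integral do rewrite muleC.
rewrite ge0_integralZl_EFin//=.
- by rewrite (diffusion_mass HK)// mule1.
- by move=> y _; exact: K0.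
- exact: mK.
Qed.

Lemma integral_dif (t : R) h : (0 < t)%R -> nnmeas h ->
  \int[mu]_x dif t h x = \int[mu]_x h x.
Proof.
move=> t0 nh.
rewrite (fubini_tonelli (m1 := mu) (m2 := mu)
  (fun z : X * X => (K t z.1 z.2)%:E * h z.2))//=.
- apply: eq_integral => y _.
  under eq_integral do rewrite muleC (diffusion_sym HK _ _ t0).
  rewrite ge0_integralZl//; [|exact: mK|by move=> *; exact: K0|exact: nh.2].
  by rewrite (diffusion_mass HK)// mule1.
- exact: mKh2.
- by move=> z; exact: dif_ge0_integrand.
Qed.

Lemma dif_dif (s t : R) h x : (0 < s)%R -> (0 < t)%R -> nnmeas h ->
  dif s (dif t h) x = dif (s + t)%R h x.
Proof.
move=> s0 t0 nh; rewrite /dif.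
transitivity (\int[mu]_y \int[mu]_z ((K s x y)%:E * ((K t y z)%:E * h z))).
  apply: eq_integral => y _; rewrite ge0_integralZl//.
  - exact: dif_meas_integrand.
  - by move=> z _; exact: dif_ge0_integrand.
  - exact: K0.
rewrite (fubini_tonelli (m1 := mu) (m2 := mu)
  (fun w : X * X => (K s x w.1)%:E * ((K t w.1 w.2)%:E * h w.2)))//=.
- apply: eq_integral => z _.
  under eq_integral do rewrite muleA muleC.
  rewrite ge0_integralZl//.
  + by rewrite (diffusion_semigroup HK)// muleC.
  + apply: emeasurable_funM; first exact: mK.
    exact: (measurable_fun_pair1 (f := fun w => (K t w.1 w.2)%:E) z (mK2 t0)).
  + by move=> y _; rewrite mule_ge0// K0.
  + exact: nh.2.
- apply: emeasurable_funM; last exact: mKh2.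
  exact: (measurableT_comp (mK x s0)).
- by move=> z; rewrite mule_ge0// ?K0// dif_ge0_integrand.
Qed.

Lemma dif_doubling (s t : R) h x : (0 < t)%R -> (t <= s <= 2 * t)%R -> nnmeas h ->
  dif t h x <= C%:E * dif s h x.
Proof.
move=> t0 ts nh; have C0 := ltW (diffusion_const HK); have s0 : (0 < s)%R by case/andP: ts => + _; exact: lt_le_trans.
rewrite /dif -ge0_integralZl_EFin//; last 2 first.
- by move=> y _; exact: dif_ge0_integrand.
- exact: dif_meas_integrand.
apply: ge0_le_integral => //.
- by move=> y _; exact: dif_ge0_integrand.
- exact: dif_meas_integrand.
- by apply: measurable_funeM; exact: dif_meas_integrand.
- move=> y _; rewrite muleA lee_wpmul2r//; first exact: nh.2.
  by rewrite -EFinM lee_fin (diffusion_doubling HK).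
Qed.


Lemma nnmeas_cst (c : R) : (0 <= c)%R -> nnmeas (cst c%:E).
Proof. by move=> c0; split. Qed.

Lemma nnmeasD h1 h2 : nnmeas h1 -> nnmeas h2 -> nnmeas (h1 \+ h2).
Proof.
by move=> [m1 p1] [m2 p2]; split; [exact: emeasurable_funD|move=> x; exact: adde_ge0].
Qed.

Lemma nnmeas_sum n (h : 'I_n -> X -> \bar R) : (forall i, nnmeas (h i)) ->
  nnmeas (fun x => \sum_(i < n) h i x).
Proof.
move=> nh; split; last by move=> x; apply: sume_ge0 => i _; exact: (nh i).2.
by apply: emeasurable_sum => i; exact: (nh i).1.
Qed.

Lemma dif_sum (t : R) n (h : nat -> X -> \bar R) x : (0 < t)%R -> (forall i, nnmeas (h i)) ->
  dif t (fun y => \sum_(i < n) h i y) x = \sum_(i < n) dif t (h i) x.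
Proof.
move=> t0 nh; elim: n => [|n IH].
  under [in LHS]eq_fun do rewrite big_ord0.
  by rewrite big_ord0 (dif_cst x t0 (lexx 0%R)).
under [in LHS]eq_fun do rewrite big_ord_recr.
rewrite big_ord_recr/= -IH -difD//.
by apply: nnmeas_sum => i; exact: nh.
Qed.

Section maximal.
Variables (e lam : R) (h : X -> \bar R).
Hypotheses (e0 : (0 < e)%R) (lam0 : (0 < lam)%R) (nh : nnmeas h).

(** The maximum of 0 and the partial sums of (dif e)^j (h - lam) satisfies this recursion as an
    inequality. Turning the recursion into a definition gives a function that dominates that maximum
    and is nonnegative by construction. *)
Fixpoint garsia N : X -> \bar R := match N with
  | 0 => cst 0
  | N'.+1 => fun x => maxe 0 (h x + dif e (garsia N') x - lam%:E)
  end.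

Lemma garsiaS N x :
  garsia N.+1 x = maxe 0 (h x + dif e (garsia N) x - lam%:E).
Proof. by []. Qed.

Lemma nnmeas_garsia N : nnmeas (garsia N).
Proof.
elim: N => [|N IH]; first exact: nnmeas_cst.
split; last by move=> x /=; rewrite le_max lexx.
apply: measurable_maxe => //; apply: emeasurable_funB => //.
by have [] := nnmeasD nh (nnmeas_dif e0 IH).
Qed.

Lemma le_garsiaS N x : garsia N x <= garsia N.+1 x.
Proof.
elim: N x => [|N IH] x; first exact: (nnmeas_garsia 1).2.
rewrite !garsiaS ge_max !le_max lexx; apply/orP; right.
rewrite leeD2r// leeD2l// le_dif//; [exact: nnmeas_garsia|exact: (nnmeas_garsia N.+1)].
Qed.

(** Finiteness is what allows the integral of [garsia N] to be cancelled in the maximal estimate; it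
    passes along the recursion because [dif e] preserves integrals. *)
Lemma garsia_lt_pinfty N : \int[mu]_x h x < +oo -> \int[mu]_x garsia N x < +oo.
Proof.
move=> hoo; elim: N => [|N IH]; first by rewrite integral0.
apply: (@le_lt_trans _ _ (\int[mu]_x (h x + dif e (garsia N) x))).
  apply: ge0_le_integral => //.
  - by move=> x _; exact: (nnmeas_garsia N.+1).2.
  - exact: (nnmeas_garsia N.+1).1.
  - exact: (nnmeasD nh (nnmeas_dif e0 (nnmeas_garsia N))).1.
  - move=> x _; have := (nnmeasD nh (nnmeas_dif e0 (nnmeas_garsia N))).2 x.
    rewrite garsiaS ge_max => ->; rewrite leeBlDr// leeDl// lee_fin; exact: ltW.
have nd := nnmeas_dif e0 (nnmeas_garsia N).
rewrite ge0_integralD//; [|by move=> x _; exact: nh.2|exact: nh.1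
  |by move=> x _; exact: nd.2|exact: nd.1].
by rewrite integral_dif//; [exact: lte_add_pinfty|exact: nnmeas_garsia].
Qed.

(* On [garsia N > 0] the recursion reads [garsia N + lam = h + dif e (garsia N.-1)];
   integrating over the whole space, the two copies of [garsia N] cancel because
   [dif e] preserves the integral. *)
Lemma garsia_maximal N : \int[mu]_x h x < +oo ->
  lam%:E * mu [set x | 0 < garsia N x] <= \int[mu]_x h x.
Proof.
move=> hoo; set E := [set x | _].
have [mg g0] := nnmeas_garsia N.
have mE : measurable E.
  by rewrite /E -[X in measurable X]setTI; exact: emeasurable_fun_o_infty.
have nd := nnmeas_dif e0 (nnmeas_garsia N).
have key x : garsia N x + lam%:E * (\1_E x)%:E <= h x + dif e (garsia N) x.
  rewrite indicE; have [/set_mem xE|xE] := boolP (x \in E); last first.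
    rewrite mule0 adde0 (le_trans _ ((nnmeasD nh nd).2 x))//.
    by rewrite leNgt; apply/negP => ?; move/negP: xE; apply; exact: mem_set.
  rewrite mule1; move: xE; rewrite /E /=.
  case: {mg g0 mE nd E} N => [|N]; first by rewrite ltxx.
  rewrite garsiaS lt_max ltxx => H; rewrite max_r//; last exact: ltW.
  rewrite subeK// leeD2l// le_dif//; [exact: nnmeas_garsia|exact: (nnmeas_garsia N.+1)|].
  by move=> y; exact: le_garsiaS.
have : \int[mu]_x (garsia N x + lam%:E * (\1_E x)%:E) <=
       \int[mu]_x (h x + dif e (garsia N) x).
  apply: ge0_le_integral => //.
  - move=> x _; rewrite adde_ge0// mule_ge0// lee_fin// ltW//.
  - apply: emeasurable_funD => //; apply: measurable_funeM.
    exact/measurable_EFinP/measurable_indic.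
  - exact: (nnmeasD nh nd).1.
rewrite ge0_integralD//; last 2 first.
- by move=> x _; rewrite mule_ge0// lee_fin// ltW.
- by apply: measurable_funeM; exact/measurable_EFinP/measurable_indic.
rewrite ge0_integralD//; last 4 first.
- by move=> x _; exact: nh.2.
- exact: nh.1.
- by move=> x _; exact: nd.2.
- exact: nd.1.
rewrite integral_dif//.
rewrite ge0_integralZl_EFin//; last 2 first.
- exact/measurable_EFinP/measurable_indic.
- exact: ltW.
rewrite integral_indic// setIT addeC leeD2rE//.
by rewrite ge0_fin_numE ?garsia_lt_pinfty// integral_ge0.
Qed.

(** Applying [dif e] to the bound for [k] moves every time up by [e] and fixes the constant; the
    recursion then adds [h] and pays one more [lam]. *)
Lemma garsia_ge N k x : (k < N)%N ->
  h x + \sum_(j < k) dif (j.+1%:R * e) h x <= garsia N x + (k.+1%:R * lam)%:E.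
Proof.
elim: N k x => // N IH [|k] x kN.
  rewrite big_ord0 adde0 mul1r garsiaS -leeBlDr// le_max leeB ?orbT//.
  by rewrite leeDl// (nnmeas_dif e0 (nnmeas_garsia N)).2.
have pos (j : nat) : (0 < j.+1%:R * e)%R by rewrite mulr_gt0.
have nj j : nnmeas (dif (j.+1%:R * e) h) by exact: nnmeas_dif.
have := @le_dif e _ _ x e0 _ _ (fun y => IH k y kN).
rewrite difD//; last exact: nnmeas_sum.
rewrite difD//; [|exact: nnmeas_garsia|by apply: nnmeas_cst; rewrite mulr_ge0// ltW].
rewrite dif_cst//; last by rewrite mulr_ge0// ltW.
rewrite (@dif_sum e k (fun j => dif (j.+1%:R * e) h) x)//.
rewrite (_ : dif e h x + _ = \sum_(j < k.+1) dif (j.+1%:R * e) h x); last first.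
  rewrite big_ord_recl/= mul1r. congr +%E.
  apply: eq_bigr => -[j ?] _ /=.
  by rewrite dif_dif// -[X in (X + _)%R]mul1r -mulrDl nat1r.
move=> /(_ _ _) H.
apply: (@le_trans _ _ (h x + (dif e (garsia N) x + (k.+1%:R * lam)%:E))).
  rewrite leeD2l//; apply: H; first by apply: nnmeasD => //; exact: nnmeas_sum.
  apply: nnmeasD; first exact: nnmeas_garsia.
  by apply: nnmeas_cst; rewrite mulr_ge0// ltW.
have -> : (k.+2%:R * lam)%:E = lam%:E + (k.+1%:R * lam)%:E.
  by rewrite -EFinD -[k.+2%:R]nat1r mulrDl mul1r.
rewrite (addeA (h x)) (addeA (garsia N.+1 x)); apply: leeD => //.
have : h x + dif e (garsia N) x - lam%:E <= garsia N.+1 x.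
  by rewrite garsiaS le_max lexx orbT.
by rewrite leeBlDr.
Qed.

End maximal.

(** By doubling, a value above [4 * C * lam] at time (m+1)e forces values of at least [4 * lam] at
    the m+1 times from (m+1)e to (2m+1)e. They add up to 4(m+1)lam, more than the cost 2(m+1)lam of
    the 2m+2 terms of the partial sum, so [garsia] is positive. *)
Lemma dif_gt_garsia (e lam : R) h m N x : (0 < e)%R -> (0 < lam)%R -> nnmeas h ->
  (m + m.+1 < N)%N -> (4 * C * lam)%:E < dif (m.+1%:R * e) h x ->
  0 < garsia e lam h N x.
Proof.
move=> e0 lam0 nh mN hx; rewrite ltNge; apply/negP => g0.
have C0 := diffusion_const HK.
have pos (j : nat) : (0 < j.+1%:R * e)%R by rewrite mulr_gt0.
have := garsia_ge e0 lam0 nh x mN; apply/negP; rewrite -ltNge.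
apply: (@le_lt_trans _ _ ((m + m.+1).+1%:R * lam)%:E); first by rewrite geeDr.
apply: (@lt_le_trans _ _ (\sum_(i < m.+1) (4 * lam)%:E)).
  rewrite sumEFin sumr_const card_ord lte_fin -[ltRHS]mulr_natl.
  have -> : ((m + m.+1).+1%:R = m.+1%:R *+ 2 :> R)%R.
    by rewrite -addSn natrD mulr2n.
  by have := mulr_gt0 (ltr0Sn R m) lam0; nra.
apply: (@le_trans _ _ (\sum_(i < m.+1) dif ((m + i).+1%:R * e) h x)); last first.
  rewrite big_split_ord/= addeA leeDr// adde_ge0 ?nh.2//.
  by apply: sume_ge0 => i _; exact: (nnmeas_dif (pos _) nh).2.
apply: lee_sum => i _.
have : (4 * C * lam)%:E < C%:E * dif ((m + i).+1%:R * e) h x.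
  apply: lt_le_trans hx _; apply: dif_doubling => //.
  rewrite ler_pM2r// ler_nat ltnS leq_addr/= mulrA ler_pM2r// -natrM ler_nat.
  by have := ltn_ord i; lia.
have := (nnmeas_dif (pos (m + i)%N) nh).2 x.
case: (dif _ _ _) => [r|_ _|//]; last by rewrite leey.
rewrite -EFinM lte_fin => _; rewrite -mulrA mulrCA ltr_pM2l// => ?.
by rewrite lee_fin ltW.
Qed.

(** The estimate on each dyadic grid does not depend on its step, so it survives the increasing
    union over all grids. Providing a measurable superset [W] avoids the supremum over uncountably
    many times. *)
Lemma maximal_inequality (lam : R) h : (0 < lam)%R -> nnmeas h ->
    \int[mu]_x h x < +oo ->
  exists W, [/\ measurable W, lam%:E * mu W <= \int[mu]_x h x &
    forall t x, (0 < t <= 1)%R -> (4 * C ^+ 2 * lam)%:E < dif t h x -> W x].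
Proof.
move=> lam0 nh hoo; have C0 := diffusion_const HK.
pose e k : R := (2 ^- k)%R.
have e0 k : (0 < e k)%R by rewrite /e invr_gt0 exprn_gt0.
(* The grid of step 2^-k up to time 2: twice the range of [t], since [t] is going to be rounded
   up. *)
pose V k := \bigcup_(m in `I_(2 ^ k.+1))
  [set x | (4 * C * lam)%:E < dif (m.+1%:R * e k) h x].
have pos k (j : nat) : (0 < j.+1%:R * e k)%R by rewrite mulr_gt0.
have mV k : measurable (V k).
  apply: bigcup_measurable => m _; rewrite -[X in measurable X]setTI.
  by apply: emeasurable_fun_o_infty => //; exact: (nnmeas_dif (pos k m) nh).1.
have ndV : nondecreasing_seq V.
  apply/nondecreasing_seqP => k; apply/subsetPset => x [m /= mk hx].
  exists (m.*2.+1) => /=; first by rewrite expnS; lia.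
  rewrite (_ : m.*2.+2%:R * e k.+1 = m.+1%:R * e k)%R//.
  rewrite /e exprS invfM mulrA. congr *%R.
  by rewrite -doubleS -muln2 natrM mulfK.
have VE k : lam%:E * mu (V k) <= \int[mu]_x h x.
  (* Large enough to exceed m + m.+1 for every m < 2^(k+1). *)
  pose N := (2 ^ k.+3)%N.
  apply: le_trans (garsia_maximal (e0 k) lam0 nh N hoo).
  rewrite lee_wpmul2l ?lee_fin ?(ltW lam0)// le_measure ?inE//.
    rewrite -[X in measurable X]setTI.
    by apply: emeasurable_fun_o_infty => //; exact: (nnmeas_garsia _ (e0 k) nh N).1.
  move=> x [m /= mk hx]; rewrite /mkset. apply: dif_gt_garsia hx => //.
  by move: mk; rewrite /N !expnS; lia.
exists (\bigcup_k V k); split.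
- exact: bigcup_measurable.
- have cV : (lam%:E * mu (V k)) @[k --> \oo] --> lam%:E * mu (\bigcup_k V k).
    apply: cvgeZl => //; apply: nondecreasing_cvg_mu => //.
    exact: bigcup_measurable.
  rewrite -(cvg_lim _ cV)//; apply: lime_le; first by apply/cvg_ex; exists (lam%:E * mu (\bigcup_k V k)).
  exact: nearW.
- move=> t x /andP[t0 t1] hx.
  have [k tk] : exists k, (e k <= t)%R.
    exists (Num.truncn t^-1).+1; rewrite /e -[leRHS]invrK lef_pV2 ?posrE ?invr_gt0 ?exprn_gt0//.
    apply: le_trans (_ : (Num.truncn t^-1).+1%:R <= _)%R; first exact/ltW/truncnS_gt.
    by rewrite -natrX ler_nat ltnW// ltn_expl.
  pose m := Num.truncn (t / e k).
  have m1 : (m%:R <= t / e k < m.+1%:R)%R.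
    by apply: truncn_itv; rewrite divr_ge0// ltW.
  exists k => //; exists m => /=.
    rewrite -(ltr_nat R); case/andP: m1 => /le_lt_trans-> //.
    rewrite natrX /e invrK exprS ltr_pM2r ?exprn_gt0//.
    by apply: le_lt_trans t1 _; rewrite ltr1n.
  (* Rounding up to the grid at most doubles [t] because [e k <= t]; this is the second use of
     doubling. *)
  have ht : (t <= m.+1%:R * e k <= 2 * t)%R.
    case/andP: m1; rewrite ler_pdivlMr// ltr_pdivrMr// => m1 m2.
    by rewrite (ltW m2)/= -natr1 mulrDl mul1r; lra.
  have := lt_le_trans hx (dif_doubling x t0 ht nh).
  have := (nnmeas_dif (pos k m) nh).2 x.
  case: (dif _ _ _) => [r|_ _|//]; last by rewrite ltry.
  rewrite -EFinM !lte_fin expr2 => _ H.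
  by rewrite -(ltr_pM2l C0); apply: le_lt_trans H; rewrite le_eqVlt; apply/orP; left; apply/eqP; ring.
Qed.

(** * Mean oscillation at a given time *)

Definition oscillation t (g : X -> R) :=
  \int[mu]_x dif t (fun y => (`|g x - g y|%R)%:E) x.

Lemma oscillationE t g :
  oscillation t g = \int[mu]_x dif t (fun y => (`|g x - g y|%R)%:E) x.
Proof. by []. Qed.

Opaque oscillation.

Lemma nnmeas_incr (g : X -> R) x : measurable_fun setT g ->
  nnmeas (fun y => (`|g x - g y|%R)%:E).
Proof.
move=> mg; split; last by move=> y; rewrite lee_fin.
apply/measurable_EFinP; apply: measurableT_comp => //.
by apply: measurable_funB => //; exact: measurable_cst.
Qed.

Lemma nnmeas_osc (t : R) (g : X -> R) : (0 < t)%R -> measurable_fun setT g ->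
  nnmeas (fun x => dif t (fun y => (`|g x - g y|%R)%:E) x).
Proof.
move=> t0 mg; split; last by move=> x; exact: (nnmeas_dif t0 (nnmeas_incr x mg)).2.
apply: (measurable_fun_fubini_tonelli_F (m2 := mu)
  (fun z : X * X => (K t z.1 z.2)%:E * (`|g z.1 - g z.2|%R)%:E)) => //; last first.
  by move=> z; rewrite mule_ge0// ?K0// lee_fin.
apply: emeasurable_funM; first exact: mK2.
apply/measurable_EFinP; apply: measurableT_comp => //.
by apply: measurable_funB; exact: (measurableT_comp mg).
Qed.

(** Only increments enter the oscillation, so this single comparison serves sums, unions and
    complements. *)
Lemma oscillation_le2 (t : R) (g g1 g2 : X -> R) : (0 < t)%R ->
  measurable_fun setT g -> measurable_fun setT g1 -> measurable_fun setT g2 ->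
  (forall x y, `|g x - g y| <= `|g1 x - g1 y| + `|g2 x - g2 y|)%R ->
  oscillation t g <= oscillation t g1 + oscillation t g2.
Proof.
move=> t0 mg mg1 mg2 H; rewrite !oscillationE -ge0_integralD//; last 4 first.
- by move=> x _; exact: (nnmeas_osc t0 mg1).2.
- exact: (nnmeas_osc t0 mg1).1.
- by move=> x _; exact: (nnmeas_osc t0 mg2).2.
- exact: (nnmeas_osc t0 mg2).1.
apply: ge0_le_integral => //.
- by move=> x _; exact: (nnmeas_osc t0 mg).2.
- exact: (nnmeas_osc t0 mg).1.
- exact: (nnmeasD (nnmeas_osc t0 mg1) (nnmeas_osc t0 mg2)).1.
move=> x _; rewrite -difD//; [|exact: nnmeas_incr|exact: nnmeas_incr].
apply: le_dif => //; first exact: nnmeas_incr.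
  by apply: nnmeasD; exact: nnmeas_incr.
by move=> y /=; rewrite -EFinD lee_fin.
Qed.

Let nnmeas_dist (f g : X -> R) : measurable_fun setT f -> measurable_fun setT g ->
  nnmeas (fun x => (`|f x - g x|%R)%:E).
Proof.
move=> mf mg; split; last by move=> y; rewrite lee_fin.
by apply/measurable_EFinP; apply: measurableT_comp => //; exact: measurable_funB.
Qed.

(** |f x - f y| is at most |g x - g y| plus the distance |f - g| at x and at y. The term at x
    integrates by mass one, the term at y because [dif t] preserves integrals: hence the factor
    2. *)
Lemma oscillation_approx (t : R) (f g : X -> R) : (0 < t)%R ->
  measurable_fun setT f -> measurable_fun setT g ->
  oscillation t f <= oscillation t g + 2%:E * \int[mu]_x (`|f x - g x|%R)%:E.
Proof.
move=> t0 mf mg.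
have nD := nnmeas_dist mf mg; have nP := nnmeas_dif t0 nD.
have -> : 2%:E * \int[mu]_x (`|f x - g x|%R)%:E =
    \int[mu]_x (`|f x - g x|%R)%:E + \int[mu]_x dif t (fun x => (`|f x - g x|%R)%:E) x.
  rewrite integral_dif//.
  rewrite (_ : 2%:E = 1%:E + 1%:E); last by rewrite -EFinD.
  by rewrite ge0_muleDl// mul1e.
rewrite -[X in _ + X]ge0_integralD//; [|exact: nD.1|by move=> x _; exact: nP.2|exact: nP.1].
rewrite !oscillationE -ge0_integralD//; last 4 first.
- by move=> x _; exact: (nnmeas_osc t0 mg).2.
- exact: (nnmeas_osc t0 mg).1.
- by move=> x _; exact: (nnmeasD nD nP).2.
- exact: (nnmeasD nD nP).1.
apply: ge0_le_integral => //.
- by move=> x _; exact: (nnmeas_osc t0 mf).2.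
- exact: (nnmeas_osc t0 mf).1.
- exact: (nnmeasD (nnmeas_osc t0 mg) (nnmeasD nD nP)).1.
move=> x _; rewrite -(dif_cst x t0 (normr_ge0 (f x - g x)%R)).
have nc : nnmeas (cst (`|f x - g x|%R)%:E) by apply: nnmeas_cst.
rewrite -difD// -difD//; [|exact: nnmeas_incr|exact: nnmeasD].
apply: le_dif => //; first exact: nnmeas_incr.
  by apply: nnmeasD; [exact: nnmeas_incr|exact: nnmeasD].
move=> y /=; rewrite -!EFinD lee_fin.
rewrite (_ : f x - f y = (g x - g y) + ((f x - g x) + (g y - f y)))%R; last by ring.
apply: le_trans (ler_normD _ _) _; rewrite lerD2l.
by apply: le_trans (ler_normD _ _) _; rewrite lerD2l distrC.
Qed.

(** * Functions whose oscillation vanishes along a sequence of times *)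

Section small.
Import HBNNSimple.
Variable dl : nat -> R.
Hypothesis dl0 : forall j, (0 < dl j)%R.

(** A sequence of times is enough: these times serve only to choose a smoothing of [f], while the
    limit in t is taken by the maximal inequality. *)
Definition osc_cvg0 (g : X -> R) := measurable_fun setT g /\
  forall e : R, (0 < e)%R -> \forall j \near \oo, oscillation (dl j) g <= e%:E.

Lemma osc_cvg0_le2 (g g1 g2 : X -> R) : measurable_fun setT g ->
  (forall x y, `|g x - g y| <= `|g1 x - g1 y| + `|g2 x - g2 y|)%R ->
  osc_cvg0 g1 -> osc_cvg0 g2 -> osc_cvg0 g.
Proof.
move=> mg H [mg1 h1] [mg2 h2]; split; first exact: mg.
move=> e e0.
have e20 : (0 < e / 2)%R by rewrite divr_gt0.
have -> : e%:E = (e / 2)%:E + (e / 2)%:E by rewrite -EFinD -splitr.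
apply: filterS2 (h1 _ e20) (h2 _ e20) => j H1 H2.
exact: le_trans (oscillation_le2 (dl0 j) mg mg1 mg2 H) (leeD H1 H2).
Qed.

Lemma osc_cvg0_cst (c : R) : osc_cvg0 (cst c).
Proof.
split; first exact: measurable_cst.
move=> e e0.
apply: nearW => j; rewrite !oscillationE /=.
under eq_integral do rewrite subrr normr0 (dif_cst _ (dl0 j) (lexx 0%R)).
by rewrite integral0 lee_fin ltW.
Qed.

Lemma osc_cvg0D (g1 g2 : X -> R) : osc_cvg0 g1 -> osc_cvg0 g2 -> osc_cvg0 (g1 \+ g2)%R.
Proof.
move=> s1 s2; apply: (osc_cvg0_le2 _ _ s1 s2).
  by apply: measurable_funD; [exact: s1.1|exact: s2.1].
move=> x y /=; rewrite (_ : _ - _ = (g1 x - g1 y) + (g2 x - g2 y))%R; last by ring.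
exact: ler_normD.
Qed.

Lemma osc_cvg0Z (c : R) (g : X -> R) : osc_cvg0 g -> osc_cvg0 (fun x => c * g x)%R.
Proof.
move=> [mg h]; have mcg : measurable_fun setT (fun x => c * g x)%R.
  by apply: measurable_funM.
split; first exact: mcg.
move=> e e0.
have c0 : (0 < `|c| + 1)%R by rewrite ltr_wpDl.
have ec : (0 < e / (`|c| + 1))%R by rewrite divr_gt0.
apply: filterS (h _ ec) => j oj.
apply: (@le_trans _ _ (`|c|%:E * oscillation (dl j) g)).
  rewrite !oscillationE -ge0_integralZl_EFin//; last 2 first.
  - by move=> x _; exact: (nnmeas_osc (dl0 j) mg).2.
  - exact: (nnmeas_osc (dl0 j) mg).1.
  rewrite le_eqVlt; apply/orP; left; apply/eqP; apply: eq_integral => x _.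
  rewrite /dif -ge0_integralZl_EFin//; last 2 first.
  - by move=> y _; exact: (dif_ge0_integrand x y (dl0 j) (nnmeas_incr x mg)).
  - exact: (dif_meas_integrand x (dl0 j) (nnmeas_incr x mg)).
  by apply: eq_integral => y _; rewrite -mulrBr normrM EFinM muleCA.
apply: (@le_trans _ _ (`|c|%:E * (e / (`|c| + 1))%:E)).
  by rewrite lee_wpmul2l// lee_fin.
rewrite -EFinM lee_fin mulrCA ger_pMr// ler_pdivrMr// mul1r.
by rewrite lerDl.
Qed.

Lemma osc_cvg0_approx (f : X -> R) : measurable_fun setT f ->
  (forall e : R, (0 < e)%R -> exists g, osc_cvg0 g /\
    \int[mu]_x (`|f x - g x|%R)%:E <= e%:E) -> osc_cvg0 f.
Proof.
move=> mf H; split; first exact: mf.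
move=> e e0.
(* A quarter, because [oscillation_approx] doubles the distance. *)
have e40 : (0 < e / 4)%R by rewrite divr_gt0.
have [g [[mg sg] fg]] := H _ e40.
have e20 : (0 < e / 2)%R by rewrite divr_gt0.
have -> : e%:E = (e / 2)%:E + (e / 2)%:E by rewrite -EFinD -splitr.
apply: filterS (sg _ e20) => j Hj.
apply: le_trans (oscillation_approx (dl0 j) mf mg) (leeD Hj _).
apply: (@le_trans _ _ (2%:E * (e / 4)%:E)); first by rewrite lee_wpmul2l// lee_fin.
by rewrite -EFinM lee_fin; lra.
Qed.

(** The increment of the indicator of a union is at most the sum of the two increments, disjoint or
    not, which gives finite unions; these converge in L^1 to the whole union since the measure is
    finite. *)
Lemma osc_cvg0_bigcup (F : nat -> set X) : (forall k, measurable (F k)) ->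
  (forall k, osc_cvg0 \1_(F k)) -> osc_cvg0 \1_(\bigcup_k F k).
Proof.
move=> mF sF; set U := \bigcup_k F k.
have mU : measurable U by exact: bigcup_measurable.
pose V n := \big[setU/set0]_(k < n) F k.
have mV n : measurable (V n) by apply: bigsetU_measurable.
have sV n : osc_cvg0 \1_(V n).
  rewrite /V; elim: n => [|n IH].
    by rewrite big_ord0 indic0; exact: (osc_cvg0_cst 0%R).
  rewrite big_ord_recr/=; apply: osc_cvg0_le2 IH (sF n).
    by apply: measurable_indic; apply: measurableU; [exact: (mV n)|exact: mF].
  move=> x y; rewrite !indicE !in_setU.
  do !case: (_ \in _) => /=; rewrite ?subrr ?subr0 ?sub0r ?normrN ?normr0 ?normr1 ?addr0 ?add0r ?lerDl ?ler01//.
have UV : mu (U `\` V n) @[n --> \oo] --> 0.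
  rewrite (_ : 0 = mu (\bigcap_n (U `\` V n))).
    apply: nonincreasing_cvg_mu.
    - by rewrite ltey_eq fin_num_measure//; exact: measurableD.
    - by move=> n; exact: measurableD.
    - by apply: bigcap_measurable => // n _; exact: measurableD.
    - move=> k l kl; apply/subsetPset; apply: setDS; exact: subset_bigsetU.
  rewrite (_ : \bigcap_n _ = set0) ?measure0//; apply/seteqP; split => // x H.
  have [k _ Fkx] := (H 0%N I).1.
  have [_] := H k.+1 I; apply; rewrite /V -bigcup_mkord; exists k => /=; [exact: ltnSn|exact: Fkx].
apply: osc_cvg0_approx; first exact: measurable_indic.
move=> e e0.
have [n Vn] : exists n, mu (U `\` V n) <= e%:E.
  move/fine_cvgP : UV => [fU /cvgrPdist_le /(_ e e0) [n _ Hn]].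
  exists n; have := Hn n (leqnn n); rewrite sub0r normrN => H.
  rewrite -[X in X <= _]fineK; last by rewrite fin_num_measure//; exact: measurableD.
  by rewrite lee_fin (le_trans (ler_norm _)).
exists \1_(V n); split => //.
rewrite (eq_integral (fun x => (\1_(U `\` V n) x)%:E)).
  by rewrite integral_indic// ?setIT//; exact: measurableD.
move=> x _; rewrite !indicE in_setD.
have [xV|xV] := boolP (x \in V n) => /=; last first.
  by rewrite andbT subr0 ger0_norm.
have -> : x \in U.
  by apply/mem_set; move/set_mem: xV; rewrite /V -bigcup_mkord => -[k _ ?]; exists k.
by rewrite subrr normr0.
Qed.

(** Dominated convergence: by mass one, the inner integrals are bounded by the constant [M]. *)
Lemma osc_cvg0_pointwise (g : X -> R) (M : R) : measurable_fun setT g ->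
  (forall x y, `|g x - g y| <= M)%R ->
  {ae mu, forall x, dif (dl j) (fun y => (`|g x - g y|%R)%:E) x @[j --> \oo] --> 0} ->
  osc_cvg0 g.
Proof.
move=> mg gM H; split; first exact: mg.
move=> e e0.
have M0 (x : X) : (0 <= M)%R by exact: (le_trans (normr_ge0 (g x - g x)%R) (gM x x)).
have iM : mu.-integrable setT (cst M%:E : X -> \bar R).
  by apply: finite_measure_integrable_cst.
pose F j x := dif (dl j) (fun y => (`|g x - g y|%R)%:E) x.
have mF j : measurable_fun setT (F j) by exact: (nnmeas_osc (dl0 j) mg).1.
have cF : {ae mu, forall x, setT x -> F ^~ x @ \oo --> cst 0 x}.
  by apply: filterS H => x Hx _.
have bF : {ae mu, forall x n, setT x -> `|F n x| <= cst M%:E x}.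
  apply: nearW => x j _.
  rewrite gee0_abs; last exact: (nnmeas_dif (dl0 j) (nnmeas_incr x mg)).2.
  rewrite /= -(dif_cst x (dl0 j) (M0 x)).
  apply: le_dif; [exact: dl0|exact: nnmeas_incr|exact/nnmeas_cst/(M0 x)|].
  by move=> y; rewrite lee_fin.
have m0 : measurable_fun setT (cst 0 : X -> \bar R) by exact: measurable_cst.
have [_ _] := dominated_convergence measurableT mF m0 cF iM bF.
rewrite integral0 => /fine_cvgP[Hf /cvgrPdist_le /(_ e e0)].
apply: filterS2 Hf => j Hf Hj; rewrite oscillationE.
by rewrite -[leLHS]fineK// lee_fin; apply: le_trans (ler_norm _) _; rewrite -normrN -sub0r.
Qed.

(** Sets with vanishing oscillation are closed under complements and countable unions, hence form a
    sigma-algebra; it is enough that it contains generators. *)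
Lemma osc_cvg0_sigma (G : set (set X)) :
  (forall A, measurable A -> <<s G >> A) ->
  (forall A, G A -> measurable A /\ osc_cvg0 \1_A) ->
  forall A, measurable A -> osc_cvg0 \1_A.
Proof.
move=> mG sG A /mG GA.
suff /(_ A GA)[] : <<s G >> `<=` [set B | measurable B /\ osc_cvg0 \1_B] by [].
apply: smallest_sub; last exact: sG.
split.
- by split => //; rewrite indic0; exact: (osc_cvg0_cst 0%R).
- move=> B [mB sB]; rewrite setTD; split; first exact: measurableC.
  apply: osc_cvg0_le2 sB (osc_cvg0_cst 0%R).
    by apply: measurable_indic; exact: measurableC.
  move=> x y; rewrite !indicE !in_setC subrr normr0 addr0.
  by case: (_ \in _); case: (_ \in _); rewrite /= ?subrr ?subr0 ?sub0r ?normrN.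
- move=> F sF; split; first by apply: bigcup_measurable => k _; exact: (sF k).1.
  by apply: osc_cvg0_bigcup => k; [exact: (sF k).1|exact: (sF k).2].
Qed.

Hypothesis small_meas : forall A, measurable A -> osc_cvg0 \1_A.

Lemma osc_cvg0_nnsfun (g : {nnsfun X >-> R}) : osc_cvg0 g.
Proof.
have [s gs] : exists s : seq R,
    (g : X -> R) = (fun x => \sum_(y <- s) (y * \1_(g @^-1` [set y]) x))%R.
  exists (finmap.enum_fset (fset_set (range g))).
  by apply/funext => x; rewrite fimfunE fsbig_finite.
rewrite gs; elim: {gs} s => [|y s IH].
  under eq_fun do rewrite big_nil; exact: osc_cvg0_cst.
under eq_fun do rewrite big_cons.
apply: osc_cvg0D; last exact: IH.
by apply: osc_cvg0Z; apply: small_meas.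
Qed.

Lemma osc_cvg0_integrable (f : X -> R) : measurable_fun setT f ->
  (forall x, 0 <= f x)%R -> \int[mu]_x (f x)%:E < +oo -> osc_cvg0 f.
Proof.
move=> mf f0 foo; have mEf : measurable_fun setT (EFin \o f) by exact/measurable_EFinP.
pose g := nnsfun_approx measurableT mEf.
have cg0 x : (g n x)%:E @[n --> \oo] --> (f x)%:E.
  exact: (@cvg_nnsfun_approx _ _ _ _ measurableT _ mEf (fun x _ => f0 x) x I).
have ndg x : {homo (fun n => (g n x)%:E) : m n / (m <= n)%N >-> m <= n}.
  by move=> m n mn; rewrite lee_fin; exact/lefP/nd_nnsfun_approx.
have gf n x : (g n x <= f x)%R.
  rewrite -lee_fin -(cvg_lim _ (cg0 x))//; apply: lime_ge.
    by apply/cvg_ex; exists (f x)%:E; exact: cg0.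
  by exists n => // m /= nm; exact: ndg.
have mEg n : measurable_fun setT (fun x => (g n x)%:E) by exact/measurable_EFinP.
have cg : \int[mu]_x (g n x)%:E @[n --> \oo] --> \int[mu]_x (f x)%:E.
  rewrite (eq_integral (fun x => limn (fun n => (g n x)%:E))).
    by apply: cvg_monotone_convergence => //; move=> n x _; rewrite lee_fin.
  by move=> x _; rewrite (cvg_lim _ (cg0 x)).
(* Since [g n <= f], the L^1 distance is a difference of integrals, so monotone convergence makes it
   small. *)
have fg n : \int[mu]_x (`|f x - g n x|%R)%:E + \int[mu]_x (g n x)%:E =
    \int[mu]_x (f x)%:E.
  have [mD D0] := nnmeas_dist mf (measurable_funPT (g n)).
  rewrite -ge0_integralD//.
    by apply: eq_integral => x _; rewrite -EFinD ger0_norm ?subr_ge0// subrK.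
  by move=> x _; rewrite lee_fin.
apply: osc_cvg0_approx => // e e0.
have fooR : \int[mu]_x (f x)%:E \is a fin_num.
  by rewrite ge0_fin_numE// integral_ge0// => x _; rewrite lee_fin.
move: cg; rewrite -{1}(fineK fooR) => /fine_cvgP [[N1 _ fin] /cvgrPdist_le /(_ e e0) [N2 _ H]].
exists (g (maxn N1 N2)); split; first exact: osc_cvg0_nnsfun.
have {}fin := fin (maxn N1 N2) (leq_maxl _ _).
have {}H := H (maxn N1 N2) (leq_maxr _ _).
move: H; rewrite -(fg (maxn N1 N2)).
set I1 := \int[mu]_x (`|_|%R)%:E; set I2 := \int[mu]_x _.
have I1fin : I1 \is a fin_num.
  move: fooR; rewrite -(fg (maxn N1 N2)) fin_numD => /andP[] //.
rewrite fineD// addrK => H.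
by rewrite -(fineK I1fin) lee_fin (le_trans (ler_norm _)).
Qed.

End small.

(** * Almost everywhere convergence as the time tends to 0 *)

Definition rdif t (f : X -> R) x : R := fine (dif t (EFin \o f) x).

Section ae.
Variable dl : nat -> R.
Hypothesis dl0 : forall j, (0 < dl j)%R.
Variable f : X -> R.
Hypotheses (mf : measurable_fun setT f) (f0 : forall x, (0 <= f x)%R).
Hypothesis foo : \int[mu]_x (f x)%:E < +oo.
Hypothesis sf : osc_cvg0 dl f.

Let nf : nnmeas (EFin \o f).
Proof. by split => [|x]; [exact/measurable_EFinP|rewrite lee_fin]. Qed.

Lemma rdifE (t : R) x : (0 < t)%R -> (rdif t f x)%:E = dif t (EFin \o f) x.
Proof.
move=> t0; rewrite /rdif fineK// ge0_fin_numE; last exact: (nnmeas_dif t0 nf).2.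
have [M HM] := diffusion_bounded HK t0.
have M0 : (0 <= M)%R by apply: le_trans (HM x x); exact: (diffusion_ge0 HK).
apply: (@le_lt_trans _ _ (M%:E * \int[mu]_y (f y)%:E)); last first.
  by rewrite lte_mul_pinfty// ?lee_fin ?M0// fin_numE.
rewrite -ge0_integralZl_EFin//; last exact: nf.1.
apply: ge0_le_integral => //.
- by move=> y _; exact: dif_ge0_integrand.
- exact: dif_meas_integrand.
- by apply: measurable_funeM; exact: nf.1.
- by move=> y _; rewrite lee_wpmul2r// lee_fin.
by move=> y _; rewrite lee_fin.
Qed.

Lemma rdif_ge0 (t : R) x : (0 < t)%R -> (0 <= rdif t f x)%R.
Proof. by move=> t0; rewrite -lee_fin rdifE//; exact: (nnmeas_dif t0 nf).2. Qed.

Lemma measurable_rdif (t : R) : (0 < t)%R -> measurable_fun setT (rdif t f).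
Proof.
move=> t0; apply/measurable_EFinP; apply: eq_measurable_fun (nnmeas_dif t0 nf).1.
by move=> x _ /=; rewrite rdifE.
Qed.

Let h j x : R := `|f x - rdif (dl j) f x|%R.

Let nh j : nnmeas (EFin \o h j).
Proof. exact: nnmeas_dist (measurable_rdif (dl0 j)). Qed.

Let le_h j x : (h j x)%:E <= dif (dl j) (fun y => (`|f x - f y|%R)%:E) x.
Proof.
have nI := nnmeas_incr x mf.
have nfx : nnmeas (cst (f x)%:E) by exact: nnmeas_cst.
have H1 : (f x)%:E <= dif (dl j) (fun y => (`|f x - f y|%R)%:E) x + (rdif (dl j) f x)%:E.
  rewrite rdifE// -(dif_cst x (dl0 j) (f0 x)) -difD//.
  apply: le_dif => //; first exact: nnmeasD.
  by move=> y /=; rewrite -EFinD lee_fin -lerBlDr ler_norm.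
have H2 : (rdif (dl j) f x)%:E <= dif (dl j) (fun y => (`|f x - f y|%R)%:E) x + (f x)%:E.
  rewrite rdifE// -[X in _ + X](dif_cst x (dl0 j) (f0 x)) -difD//.
  apply: le_dif => //; first exact: nnmeasD.
  by move=> y /=; rewrite -EFinD lee_fin distrC -lerBlDr ler_norm.
move: H1 H2 ((nnmeas_dif (dl0 j) nI).2 x); case: (dif _ _ _) => [r| |//] H1 H2 _; last by rewrite leey.
move: H1 H2; rewrite -!EFinD !lee_fin => H1 H2; rewrite /h ler_norml; apply/andP; split; lra.
Qed.

Let le_int_h j : \int[mu]_x (h j x)%:E <= oscillation (dl j) f.
Proof.
rewrite oscillationE; apply: ge0_le_integral.
- exact: measurableT.
- by move=> x _; exact: (nh j).2.
- exact: (nh j).1.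
- exact: (nnmeas_osc (dl0 j) mf).1.
- by move=> x _; exact: le_h.
Qed.

(** By the semigroup law the difference is [dif t] applied to f - rdif (dl j) f, whose absolute
    value is [h j]. *)
Let rdif_split j (t : R) x : (0 < t)%R ->
  (`|rdif t f x - rdif (t + dl j) f x|)%:E <= dif t (EFin \o h j) x.
Proof.
move=> t0; have td0 : (0 < t + dl j)%R by rewrite addr_gt0.
have nr : nnmeas (EFin \o rdif (dl j) f).
  by split=> [|y]; [exact/measurable_EFinP/measurable_rdif|rewrite lee_fin rdif_ge0].
have E : (rdif (t + dl j) f x)%:E = dif t (EFin \o rdif (dl j) f) x.
  rewrite rdifE// -dif_dif//; congr dif.
  by apply/funext => y /=; rewrite rdifE.
have H1 : (rdif t f x)%:E <= dif t (EFin \o h j) x + (rdif (t + dl j) f x)%:E.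
  rewrite E rdifE// -difD//; apply: le_dif => //; first exact: nnmeasD.
  by move=> y /=; rewrite -EFinD lee_fin -lerBlDr ler_norm.
have H2 : (rdif (t + dl j) f x)%:E <= dif t (EFin \o h j) x + (rdif t f x)%:E.
  rewrite E rdifE// -difD//; apply: le_dif => //; first exact: nnmeasD.
  by move=> y /=; rewrite -EFinD lee_fin /h distrC -lerBlDr ler_norm.
move: H1 H2 ((nnmeas_dif t0 (nh j)).2 x); case: (dif _ _ _) => [r| |//] H1 H2 _; last by rewrite leey.
move: H1 H2; rewrite -!EFinD !lee_fin => H1 H2; rewrite ler_norml; apply/andP; split; lra.
Qed.

Hypothesis ctf : forall x (t0 : R), (0 < t0)%R ->
  rdif t f x @[t --> t0] --> rdif t0 f x.

(** |rdif t f - f| is split at the times t + dl j and dl j. The first piece is at most 4 C^2 lam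
    outside the set of the maximal inequality, the second at most lam for small t by continuity in
    time, the third at most lam outside a set controlled by Markov's inequality. *)
Let exceptional (lam e : R) : (0 < lam)%R -> (0 < e)%R ->
  exists S, [/\ measurable S, mu S <= e%:E &
    forall x, ~ S x -> \forall t \near 0%R^'+,
       (`|rdif t f x - f x| <= (4 * C ^+ 2 + 2) * lam)%R].
Proof.
move=> lam0 e0.
(* Both weak-type bounds divide the integral of [h j] by [lam], which leaves e/2 for each of the two
   exceptional sets. *)
have el : (0 < lam * e / 2)%R by rewrite divr_gt0// mulr_gt0.
have [j _ /(_ j (leqnn j)) oj] := sf.2 _ el.
have hj := le_trans (le_int_h j) oj.
have hoo : \int[mu]_x (h j x)%:E < +oo by exact: le_lt_trans hj (ltry _).
have [W [mW muW HW]] := maximal_inequality lam0 (nh j) hoo.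
pose A := [set x | lam%:E < (h j x)%:E].
have mA : measurable A.
  rewrite /A -[X in measurable X]setTI.
  by apply: emeasurable_fun_o_infty => //; exact: (nh j).1.
have muA : lam%:E * mu A <= \int[mu]_x (h j x)%:E.
  rewrite -[X in _ * mu X]setIT -integral_indic// -ge0_integralZl_EFin//.
  - apply: ge0_le_integral.
    + exact: measurableT.
    + by move=> x _; rewrite mule_ge0// lee_fin// ltW.
    + by apply: measurable_funeM; exact/measurable_EFinP/measurable_indic.
    + exact: (nh j).1.
    + move=> x _; rewrite indicE; have [/set_mem xA|_] := boolP (x \in A).
        by rewrite mule1 ltW.
      by rewrite mule0 lee_fin normr_ge0.
  - exact/measurable_EFinP/measurable_indic.
  - exact: ltW.
exists (W `|` A); split; first exact: measurableU.
  have H B : lam%:E * mu B <= \int[mu]_x (h j x)%:E -> measurable B -> mu B <= (e / 2)%:E.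
    move=> H mB; rewrite -(lee_pmul2l (x := lam%:E))//.
    by apply: le_trans H _; apply: le_trans hj _; rewrite -EFinM mulrA.
  have -> : e%:E = (e / 2)%:E + (e / 2)%:E by rewrite -EFinD -splitr.
  exact: (le_trans (measureU2 mu mW mA) (leeD (H _ muW mW) (H _ muA mA))).
move=> x /not_orP[Wx Ax].
have d1 : (0 < lam)%R by [].
have := @ctf x _ (dl0 j) => /cvgrPdist_le /(_ lam lam0) H.
have Hs : \forall t \near 0%R^'+, (`|rdif (dl j) f x - rdif (t + dl j) f x| <= lam)%R.
  have Hc : (t + dl j)%R @[t --> (0%R : R)^'+] --> dl j.
    apply: cvg_at_right_filter.
    rewrite -[X in _ --> X]add0r; apply: (@cvgD _ R^o); [exact: cvg_id|exact: cvg_cst].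
  exact: (Hc _ H).
near=> t.
have t0 : (0 < t)%R by near: t; exact: nbhs_right_gt.
have t1 : (t <= 1)%R by near: t; apply: nbhs_right_le.
have Ht : (`|rdif (dl j) f x - rdif (t + dl j) f x| <= lam)%R by near: t.
have hx : (`|f x - rdif (dl j) f x| <= lam)%R.
  by rewrite leNgt -lte_fin; apply/negP.
have : dif t (EFin \o h j) x <= (4 * C ^+ 2 * lam)%:E.
  by rewrite leNgt; apply/negP => ?; apply: Wx; apply: (HW t) => //; rewrite t0.
move/(le_trans (@rdif_split j t x t0)); rewrite lee_fin => Hr.
move: Hr hx Ht; rewrite !ler_norml => /andP[? ?] /andP[? ?] /andP[? ?].
by apply/andP; split; lra.
Unshelve. all: by end_near. Qed.

(** For each tolerance the bad set lies in exceptional sets of arbitrarily small measure, hence is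
    negligible; countably many tolerances suffice. *)
Lemma rdif_ae_cvg : {ae mu, forall x, rdif t f x @[t --> 0%R^'+] --> f x}.
Proof.
have CC : (0 < 4 * C ^+ 2 + 2)%R by rewrite ltr_wpDl// mulr_ge0// sqr_ge0.
pose B m := [set x | ~ \forall t \near 0%R^'+,
  (`|rdif t f x - f x| <= (4 * C ^+ 2 + 2) * m.+1%:R^-1)%R].
have nB m : mu.-negligible (B m).
  have m0 : (0 < m.+1%:R^-1 :> R)%R by rewrite invr_gt0.
  have /choice[S HS] : forall i : nat, exists S, [/\ measurable S,
      mu S <= (i.+1%:R^-1)%:E & forall x, ~ S x -> \forall t \near 0%R^'+,
       (`|rdif t f x - f x| <= (4 * C ^+ 2 + 2) * m.+1%:R^-1)%R].
    by move=> i; apply: exceptional => //; rewrite invr_gt0.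
  have mS : measurable (\bigcap_i S i).
    by apply: bigcap_measurable => // i _; have [] := HS i.
  exists (\bigcap_i S i); split => //.
    apply/eqP; rewrite eq_le measure_ge0 andbT.
    apply/lee_addgt0Pr => e e0; rewrite add0e.
    apply: le_trans (_ : ((Num.truncn e^-1).+1%:R^-1)%:E <= _).
      apply: le_trans (_ : mu (S (Num.truncn e^-1)) <= _); last by have [] := HS (Num.truncn e^-1).
      apply: le_measure; rewrite ?inE//; first by have [] := HS (Num.truncn e^-1).
      by move=> x; apply.
    rewrite lee_fin -[leRHS]invrK lef_pV2 ?posrE ?invr_gt0//.
    exact/ltW/truncnS_gt.
  by move=> x Bx i _; apply: contrapT => Sx; apply: Bx; have [_ _] := HS i; apply.
have := negligible_bigcup nB; apply: negligibleS => x /= H.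
apply: contrapT => nx; apply: H; apply/cvgrPdist_le => e e0.
pose m := Num.truncn (e / (4 * C ^+ 2 + 2))^-1.
have : ~ B m x by move=> Bm; apply: nx; exists m.
move=> /contrapT; apply: filterS => t; rewrite distrC => /le_trans; apply.
rewrite -ler_pdivlMl// mulrC -[leRHS]invrK lef_pV2 ?posrE ?invr_gt0 ?divr_gt0//.
exact/ltW/truncnS_gt.
Qed.

End ae.
End diffusion.

(** * The gaussian kernel *)

Section pointwise_derivatives.
Context (R : realType).
Implicit Types (f g : R -> R) (x a b : R).

Lemma derD f g x a b : is_derive x 1 f a -> is_derive x 1 g b ->
  is_derive x 1 (fun y => f y + g y) (a + b).
Proof. exact: is_deriveD. Qed.

Lemma derN f x a : is_derive x 1 f a -> is_derive x 1 (fun y => - f y) (- a).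
Proof. exact: is_deriveN. Qed.

Lemma derM f g x a b : is_derive x 1 f a -> is_derive x 1 g b ->
  is_derive x 1 (fun y => f y * g y) (f x * b + g x * a).
Proof. exact: is_deriveM. Qed.

Lemma der_cst (c : R) x : is_derive x 1 (fun _ => c) 0.
Proof. exact: is_derive_cst. Qed.

Lemma der_id x : is_derive x 1 (fun y : R => y) 1.
Proof. exact: is_derive_id. Qed.

Lemma der_sqr f x a : is_derive x 1 f a ->
  is_derive x 1 (fun y => f y ^+ 2) (2 * f x * a).
Proof.
move=> H; apply: (@is_derive_eq _ _ _ _ _ _ _ _ (is_deriveX 2 H)).
by rewrite expr1.
Qed.

Lemma derV f x a : f x != 0 -> is_derive x 1 f a ->
  is_derive x 1 (fun y => (f y)^-1) (- (f x) ^- 2 * a).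
Proof. exact: is_deriveV. Qed.

Lemma der_exp f x a : is_derive x 1 f a ->
  is_derive x 1 (fun y => expR (f y)) (expR (f x) * a).
Proof. by move=> H; apply: (@is_derive1_comp _ expR). Qed.

Lemma der_ln f x a : 0 < f x -> is_derive x 1 f a ->
  is_derive x 1 (fun y => ln (f y)) ((f x)^-1 * a).
Proof. by move=> f0 H; apply: (@is_derive1_comp _ (@ln R)); exact: is_derive1_ln. Qed.

Lemma derE f x a b : is_derive x 1 f a -> a = b -> is_derive x 1 f b.
Proof. by move=> H <-. Qed.

End pointwise_derivatives.

Section gauss.
Context (R : realType).
Implicit Types s t a b : R.

(** The prefactor (4 pi t)^(-1/2) is kept inside the exponential, so that products and comparisons
    of gaussians become statements about exponents. *)
Definition gauss t s : R := expR (- (ln (4 * pi * t) / 2) - s ^+ 2 / (4 * t)).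
Definition gauss1 t s : R := - (s / (2 * t)) * gauss t s.
Definition gauss2 t s : R := (s ^+ 2 / (4 * t ^+ 2) - (2 * t)^-1) * gauss t s.

Lemma gauss_gt0 t s : 0 < gauss t s.
Proof. exact: expR_gt0. Qed.

Lemma gaussN t s : gauss t (- s) = gauss t s.
Proof. by rewrite /gauss sqrrN. Qed.

Lemma is_derive_gauss t s : 0 < t -> is_derive s 1 (gauss t) (gauss1 t s).
Proof.
move=> t0.
have H := (der_exp (derD (der_cst (- (ln (4 * pi * t) / 2)) s)
  (derN (derM (der_sqr (der_id s)) (der_cst (4 * t)^-1 s))))).
apply: (derE H).
rewrite /gauss1 /gauss; set E := expR _.
by field; rewrite gt_eqF.
Qed.

Lemma is_derive_gauss1 t s : 0 < t -> is_derive s 1 (gauss1 t) (gauss2 t s).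
Proof.
move=> t0.
have H := derM (derN (derM (der_id s) (der_cst (2 * t)^-1 s))) (is_derive_gauss s t0).
apply: (derE H).
by rewrite /gauss2 /gauss1; set E := gauss _ _; field; rewrite gt_eqF.
Qed.

(** The derivative is the same [gauss2] as the second derivative in space: this is the heat equation
    for one term of the theta series. *)
Lemma is_derive_gauss_time t s : 0 < t -> is_derive t 1 (gauss ^~ s) (gauss2 t s).
Proof.
move=> t0; have p0 := pi_gt0 R.
have d4 : is_derive t 1 (fun t => 4 * pi * t) (4 * pi).
  by have H := derM (der_cst (4 * pi) t) (der_id t); apply: (derE H); ring.
have d4' : is_derive t 1 (fun t => 4 * t) 4.
  by have H := derM (der_cst 4 t) (der_id t); apply: (derE H); ring.
have h1 : 0 < 4 * pi * t by rewrite !mulr_gt0.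
have h2 : 4 * t != 0 by rewrite gt_eqF// mulr_gt0.
have H := der_exp (derD (derN (derM (der_ln h1 d4) (der_cst 2^-1 t)))
  (derN (derM (der_cst (s ^+ 2) t) (derV h2 d4')))).
apply: (derE H).
rewrite /gauss2 /gauss; set E := expR _.
clearbody E; clear H d4 h1; move: (@pi R) p0 => P p0.
by field; rewrite !gt_eqF.
Qed.

(** One envelope for the kernel and its derivatives, uniform over a compact interval of times. The
    profile exp(-|s|) is preferred to a gaussian because its sums over the integers are geometric
    and a shift of s costs only a factor. *)
Lemma gauss_bound a b : 0 < a -> a <= b ->
  exists2 D, 0 <= D & forall t s, a <= t <= b ->
   [/\ `|gauss t s| <= D * expR (- `|s|), `|gauss1 t s| <= D * expR (- `|s|) &
       `|gauss2 t s| <= D * expR (- `|s|)].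
Proof.
move=> a0 ab; have b0 : 0 < b by exact: lt_le_trans ab.
have p0 := pi_gt0 R.
(* [P * (1 + s ^+ 2)] dominates the coefficients of all three functions for times at least [a]. *)
pose P := 1 + (2 * a)^-1 + (4 * a ^+ 2)^-1.
have ia0 : 0 <= (2 * a)^-1 by rewrite invr_ge0 mulr_ge0// ltW.
have iaa0 : 0 <= (4 * a ^+ 2)^-1 by rewrite invr_ge0 mulr_ge0// sqr_ge0.
pose D := P * expR (- (ln (4 * pi * a) / 2)) * ((1 + 8 * b) * expR (2 * b)).
have P0 : 0 <= P by rewrite /P !addr_ge0.
exists D; first by rewrite /D !mulr_ge0 ?expR_ge0// addr_ge0// mulr_ge0// ltW.
move=> t s /andP[at_ tb]; have t0 : 0 < t by exact: lt_le_trans at_.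
have gb : gauss t s <= expR (- (ln (4 * pi * a) / 2)) * expR (- (s ^+ 2 / (4 * b))).
  rewrite /gauss expRD ler_pM ?expR_ge0// ler_expR lerN2.
    rewrite ler_pM2r// ler_ln ?posrE ?mulr_gt0// ler_pM2l ?mulr_gt0//.
  by rewrite ler_wpM2l ?sqr_ge0// lef_pV2 ?posrE ?mulr_gt0// ler_pM2l.
(* Half of the exponent absorbs the factor 1 + s^2; the other half gives exp(-|s|) through (|s| -
   4b)^2 >= 0. *)
have eb : (1 + s ^+ 2) * expR (- (s ^+ 2 / (4 * b))) <=
    (1 + 8 * b) * expR (2 * b) * expR (- `|s|).
  have h1 : 1 + s ^+ 2 <= (1 + 8 * b) * expR (s ^+ 2 / (8 * b)).
    apply: le_trans (_ : (1 + 8 * b) * (1 + s ^+ 2 / (8 * b)) <= _); last first.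
      by rewrite ler_pM2l ?addr_gt0 ?mulr_gt0// expR_ge1Dx.
    rewrite (_ : (1 + 8 * b) * _ = 1 + s ^+ 2 + 8 * b + s ^+ 2 / (8 * b)); last first.
      by field; rewrite gt_eqF.
    have := sqr_ge0 s; have : 0 <= s ^+ 2 / (8 * b) by rewrite divr_ge0 ?sqr_ge0// mulr_ge0// ltW.
    by lra.
  have h2 : `|s| <= s ^+ 2 / (8 * b) + 2 * b.
    rewrite -subr_ge0.
    rewrite (_ : _ - _ = (`|s| - 4 * b) ^+ 2 / (8 * b)); last first.
      by rewrite -[s ^+ 2]real_normK ?num_real//; field; rewrite gt_eqF.
    by rewrite divr_ge0 ?sqr_ge0// mulr_ge0// ltW.
  apply: le_trans (_ : (1 + 8 * b) * expR (s ^+ 2 / (8 * b)) * expR (- (s ^+ 2 / (4 * b))) <= _).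
    by rewrite ler_wpM2r ?expR_ge0.
  rewrite -[leLHS]mulrA -[leRHS]mulrA ler_pM2l ?addr_gt0 ?mulr_gt0// -!expRD ler_expR.
  rewrite (_ : s ^+ 2 / (4 * b) = 2 * (s ^+ 2 / (8 * b))); last by field; rewrite gt_eqF.
  lra.
have key c : 0 <= c <= P * (1 + s ^+ 2) -> c * gauss t s <= D * expR (- `|s|).
  move=> /andP[c0 cP].
  apply: le_trans (_ : P * (1 + s ^+ 2) * (expR (- (ln (4 * pi * a) / 2)) * expR (- (s ^+ 2 / (4 * b)))) <= _).
    by rewrite ler_pM// ltW// gauss_gt0.
  rewrite /D [leLHS](_ : _ = P * expR (- (ln (4 * pi * a) / 2)) * ((1 + s ^+ 2) * expR (- (s ^+ 2 / (4 * b))))); last by ring.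
  by rewrite -[leRHS]mulrA ler_wpM2l// mulr_ge0// expR_ge0.
have s20 := sqr_ge0 s.
have it : 0 <= t^-1 <= a^-1 by rewrite invr_ge0 ltW//= lef_pV2 ?posrE.
have hs : `|s| <= 1 + s ^+ 2.
  rewrite -[s ^+ 2]real_normK ?num_real//.
  by have := sqr_ge0 (`|s| - 1); rewrite !expr2; have := normr_ge0 s; nra.
have P1 : 1 <= P by rewrite /P -addrA lerDl addr_ge0.
have P2 : (2 * a)^-1 <= P by rewrite /P; lra.
have i2 : 0 <= (2 * t)^-1 <= (2 * a)^-1.
  by rewrite invr_ge0 mulr_ge0 ?(ltW t0)//= lef_pV2 ?posrE ?mulr_gt0// ler_pM2l.
have i4 : 0 <= (4 * t ^+ 2)^-1 <= (4 * a ^+ 2)^-1.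
  rewrite invr_ge0 mulr_ge0 ?sqr_ge0//= lef_pV2 ?posrE ?mulr_gt0 ?exprn_gt0// ler_pM2l//.
  by rewrite ler_pXn2r ?nnegrE ?(ltW t0) ?(ltW a0).
split.
- rewrite gtr0_norm ?gauss_gt0// -[gauss t s]mul1r; apply: key; rewrite ler01/=.
  by nra.
- rewrite /gauss1 normrM normrN (gtr0_norm (gauss_gt0 _ _)); apply: key.
  rewrite normr_ge0/= normrM [leRHS]mulrC; case/andP: i2 => i2 i2'.
  by rewrite ler_pM// (ger0_norm i2); exact: le_trans P2.
- rewrite /gauss2 normrM (gtr0_norm (gauss_gt0 _ _)); apply: key.
  rewrite normr_ge0/=; apply: le_trans (ler_normB _ _) _.
  rewrite !ger0_norm; [|by case/andP: i2|by rewrite mulr_ge0//; case/andP: i4].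
  rewrite /P; set A := (2 * a)^-1 in i2 ia0 *; set B := (4 * a ^+ 2)^-1 in i4 iaa0 *.
  by case/andP: i2 => _ ?; case/andP: i4 => ? ?; nra.
Qed.

(** The prefactors have ratio at most sqrt 2, here [expR (ln 2 / 2)], and the remaining exponential
    increases with time. *)
Lemma gauss_doubling t s x : 0 < t -> t <= s <= 2 * t ->
  gauss t x <= expR (ln 2 / 2) * gauss s x.
Proof.
move=> t0 /andP[ts s2]; have s0 : 0 < s by exact: lt_le_trans ts.
have p0 := pi_gt0 R.
rewrite /gauss -expRD ler_expR.
have : ln (4 * pi * s) <= ln 2 + ln (4 * pi * t).
  rewrite -lnM ?posrE ?mulr_gt0// ler_ln ?posrE ?mulr_gt0//.
  by rewrite mulrCA ler_pM2l ?mulr_gt0.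
have : x ^+ 2 / (4 * s) <= x ^+ 2 / (4 * t).
  by rewrite ler_wpM2l ?sqr_ge0// lef_pV2 ?posrE ?mulr_gt0// ler_pM2l.
lra.
Qed.

(** The exponent x^2/(4t) is twice x^2/(8t): one half is the exponent at time 2t, the other is at
    least r^2/(8t). The extra decay thus comes with a kernel that still has mass one. *)
Lemma gauss_concentration t x r : 0 < t -> 0 <= r <= `|x| ->
  gauss t x <= expR (ln 2 / 2 - r ^+ 2 / (8 * t)) * gauss (2 * t) x.
Proof.
move=> t0 /andP[r0 rx]; have p0 := pi_gt0 R.
rewrite /gauss -expRD ler_expR.
rewrite (_ : 4 * pi * (2 * t) = 2 * (4 * pi * t)); last by ring.
rewrite (@lnM _ 2 (4 * pi * t)) ?posrE ?mulr_gt0//.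
have rx2 : r ^+ 2 <= x ^+ 2.
  by rewrite -[leRHS]real_normK ?num_real// ler_pXn2r ?nnegrE.
have : r ^+ 2 / (8 * t) <= x ^+ 2 / (8 * t).
  by rewrite ler_wpM2r// invr_ge0 mulr_ge0// ltW.
rewrite (_ : x ^+ 2 / (4 * t) = 2 * (x ^+ 2 / (8 * t))); last by field; rewrite gt_eqF.
rewrite (_ : 4 * (2 * t) = 8 * t); last by ring.
lra.
Qed.

Lemma continuous_gauss t : 0 < t -> continuous (gauss t).
Proof.
move=> t0 s; apply: differentiable_continuous; apply/derivable1_diffP.
by have [] := is_derive_gauss s t0.
Qed.

Lemma measurable_gauss t : 0 < t -> measurable_fun setT (gauss t).
Proof. by move=> t0; apply: continuous_measurable_fun; exact: continuous_gauss. Qed.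

Let gauss_normal t : 0 < t -> gauss t = normal_pdf 0 (Num.sqrt (2 * t)).
Proof.
move=> t0; apply/funext => x; have p0 := pi_gt0 R.
have s0 : Num.sqrt (2 * t) != 0 by rewrite gt_eqF// sqrtr_gt0 mulr_gt0.
rewrite normal_pdfE// /gauss expRD; congr *%R.
  rewrite /normal_peak sqr_sqrtr ?mulr_ge0 ?ltW//.
  rewrite (_ : 2 * t * pi *+ 2 = 4 * pi * t); last by ring.
  by rewrite -powR12_sqrt ?mulr_ge0 ?ltW// /powR gt_eqF ?mulr_gt0// expRN mulrC.
rewrite /normal_fun subr0 sqr_sqrtr ?mulr_ge0 ?ltW//; congr expR.
by rewrite mulNr; congr (- (_ / _)); ring.
Qed.

Lemma integral_gauss t m : 0 < t ->
  (\int[lebesgue_measure]_y (gauss t (y - m))%:E = 1)%E.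
Proof.
move=> t0; rewrite -(integral_normal_pdf m (Num.sqrt (2 * t))); apply: eq_integral => y _.
have s0 : Num.sqrt (2 * t) != 0 by rewrite gt_eqF// sqrtr_gt0 mulr_gt0.
by rewrite gauss_normal// !normal_pdfE// /normal_fun subr0.
Qed.

(** Completing the square in y: [m] is the weighted mean of the two centres and 1/u = 1/s + 1/t. *)
Lemma gauss_convolution s t a b : 0 < s -> 0 < t ->
  (\int[lebesgue_measure]_y (gauss t (y - a) * gauss s (y - b))%:E =
    (gauss (s + t) (a - b))%:E)%E.
Proof.
move=> s0 t0; have p0 := pi_gt0 R.
have st0 : 0 < s + t by rewrite addr_gt0.
pose u := s * t / (s + t); have u0 : 0 < u by rewrite /u divr_gt0// mulr_gt0.
pose m := (s * a + t * b) / (s + t).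
under eq_integral => y _.
  rewrite (_ : gauss t (y - a) * _ = gauss (s + t) (a - b) * gauss u (y - m)); last first.
    rewrite /gauss -!expRD; congr expR.
    have : ln (4 * pi * t) + ln (4 * pi * s) = ln (4 * pi * (s + t)) + ln (4 * pi * u).
      rewrite -(@lnM _ (4 * pi * t) (4 * pi * s)) ?posrE ?mulr_gt0//.
      rewrite -(@lnM _ (4 * pi * (s + t)) (4 * pi * u)) ?posrE ?mulr_gt0 ?invr_gt0//.
      rewrite /u; move: (@pi R) => P; congr ln; field.
      by rewrite gt_eqF.
    move=> H.
    have : (y - a) ^+ 2 / (4 * t) + (y - b) ^+ 2 / (4 * s) =
           (a - b) ^+ 2 / (4 * (s + t)) + (y - m) ^+ 2 / (4 * u).
      by rewrite /u /m; field; rewrite ?gt_eqF ?mulr_gt0 ?invr_gt0.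
    move=> H2; lra.
  rewrite EFinM; over.
rewrite ge0_integralZl_EFin//.
- by rewrite integral_gauss// mule1.
- by move=> y _; rewrite lee_fin ltW// gauss_gt0.
- apply/measurable_EFinP; apply: (measurableT_comp (measurable_gauss u0)).
  by apply: measurable_funB.
- by rewrite ltW// gauss_gt0.
Qed.

End gauss.

(** * The theta function *)

Lemma is_derive_Rintegral d (Y : measurableType d) (R : realType)
    (mu : {measure set Y -> \bar R}) (f f' : R -> Y -> R) (G : Y -> R) (a e : R) :
  0 < e -> (forall x, `|x - a| < e -> mu.-integrable setT (EFin \o f x)) ->
  (forall x y, `|x - a| < e -> is_derive x 1 (f ^~ y) (f' x y)) ->
  mu.-integrable setT (EFin \o G) ->
  (forall x y, `|x - a| < e -> `|f' x y| <= G y) ->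
  is_derive a 1 (fun x => \int[mu]_y f x y) (\int[mu]_y f' a y).
Proof.
move=> e0 intf df intG ub.
pose I : set R := `]a - e, a + e[%classic.
have inI x : I x -> `|x - a| < e.
  by rewrite /I /= in_itv/= => /andP[h1 h2]; rewrite ltr_norml; apply/andP; split; lra.
have Ia : I a by rewrite /I /= in_itv/=; apply/andP; split; lra.
have G0 y : 0 <= G y by apply: le_trans (ub a y _) => //; rewrite subrr normr0.
have d1 x y : I x -> partial1of2 f x y = f' x y.
  move=> /inI xa; rewrite partial1of2E; exact: (@derive_val _ _ _ _ _ _ _ (df x y xa)).
have H1 x y : I x -> setT y -> derivable (f ^~ y) x 1.
  by move=> /inI xa _; have [] := df x y xa.
have H2 x y : I x -> setT y -> `|partial1of2 f x y| <= G y.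
  by move=> xI _; rewrite d1//; exact/ub/inI.
have H3 x : I x -> mu.-integrable setT (EFin \o f x).
  by move=> /inI; exact: intf.
split; first exact: (derivable_under_integral measurableT Ia H3 H1 G0 intG H2).
rewrite -derive1E.
rewrite (differentiation_under_integral measurableT Ia H3 H1 G0 intG H2).
by congr Rintegral; apply/funext => y; rewrite d1.
Qed.

Section lattice.
Context (R : realType).
Implicit Types (s t : R) (q : R -> R).
Local Notation cnt := (@counting nat R).

(** Enumerates the integers as 0, -1, 1, -2, 2, ..., so that lattice sums become integrals for the
    counting measure on [nat]. *)
Definition zn (k : nat) : int := if odd k then Negz k./2 else Posz k./2.

Lemma zn_bij : set_bij [set: nat] [set: int] zn.
Proof.
split=> //.
- move=> i j _ _; rewrite /zn.
  case: ifP => oi; case: ifP => oj // -[]; move: oi oj; lia.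
- move=> [m|m] _.
    by exists m.*2 => //; rewrite /zn odd_double doubleK.
  by exists m.*2.+1 => //; rewrite /zn /= odd_double/= uphalf_double.
Qed.

Lemma esum_zn (a : int -> \bar R) : (forall z, 0 <= a z)%E ->
  \esum_(z in [set: int]) a z = (\sum_(k <oo) a (zn k))%E.
Proof.
move=> a0; rewrite nneseries_esumT; last by move=> *; exact: a0.
exact: (reindex_esum [set: nat] [set: int] zn a zn_bij).
Qed.

Lemma esum_int_shift (a : int -> \bar R) (m : int) :
  \esum_(z in [set: int]) a (z + m) = \esum_(z in [set: int]) a z.
Proof.
apply/esym; apply: (reindex_esum [set: int] [set: int] (fun z : int => z + m) a); split => //.
- by move=> i j _ _ /= /addIr.
- by move=> z _; exists (z - m) => //; rewrite subrK.
Qed.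

Lemma zn_sum_shift (a : int -> \bar R) (m : int) : (forall z, 0 <= a z)%E ->
  (\sum_(k <oo) a (zn k + m)%R = \sum_(k <oo) a (zn k))%E.
Proof.
move=> a0; rewrite -(esum_zn a0) -(esum_int_shift a m) esum_zn//.
Qed.

Lemma zn_sumN (a : int -> \bar R) : (forall z, 0 <= a z)%E ->
  (\sum_(k <oo) a (- zn k)%R = \sum_(k <oo) a (zn k))%E.
Proof.
move=> a0; rewrite -(esum_zn a0) -(@esum_zn (fun z => a (- z)))//.
apply/esym; apply: (reindex_esum [set: int] [set: int] (fun z : int => - z) a); split => //.
Qed.

Let half_exp : R := expR (- 2^-1).
Let M0 : R := (1 - half_exp)^-1.

Let half_exp_lt1 : 0 <= half_exp < 1.
Proof. by rewrite expR_ge0/= expR_lt1 oppr_lt0 invr_gt0. Qed.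

Lemma le_norm_zn k : k%:R / 2 <= `|(zn k)%:~R| :> R.
Proof.
rewrite -intr_norm ler_pdivrMr// -[k%:R]/(k%:Z%:~R) -[2]/(2%:Z%:~R) -intrM ler_int.
rewrite /zn; case: ifP => ok; lia.
Qed.

(** As |zn k| >= k/2, the series is dominated by the geometric series of ratio exp(-1/2). *)
Lemma sum_exp_zn : (\sum_(k <oo) (expR (- `|(zn k)%:~R : R|))%:E <= M0%:E)%E.
Proof.
have M0E : limn (EFin \o series (geometric 1 half_exp)) = (1 * M0)%:E.
  apply/cvg_lim => //; apply: cvg_EFin; first exact: nearW.
  by apply: cvg_geometric_series; rewrite ger0_norm; case/andP: half_exp_lt1.
rewrite mul1r in M0E; rewrite -M0E.
apply: (@le_trans _ _ (\sum_(k <oo) (half_exp ^+ k)%:E)%E); last first.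
  rewrite le_eqVlt; apply/orP; left; apply/eqP; congr (limn _); apply/funext => k /=.
  by rewrite sumEFin /series/=; congr EFin; apply: eq_bigr => i _; rewrite mul1r.
apply: lee_nneseries => [k _ _|k _]; first by rewrite lee_fin expR_ge0.
rewrite lee_fin /half_exp -expRM_natl ler_expR mulrN lerN2.
exact: le_norm_zn.
Qed.

Definition latM : R := expR 1 * M0.

(** The integer part of [s] is removed by reindexing the lattice; the fractional part costs at most
    the factor [expR 1]. *)
Lemma sum_exp_shift s : (\sum_(k <oo) (expR (- `|s + (zn k)%:~R|))%:E <= latM%:E)%E.
Proof.
pose m := Num.floor s; pose r := s - m%:~R.
have r01 : 0 <= r < 1.
  have /andP[h1 h2] := floor_itv s.
  by rewrite /r subr_ge0 h1/= ltrBlDr addrC -[1]/(1%:~R) -intrD.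
rewrite (@eq_eseriesr _ _ (fun k => (expR (- `|r + (zn k + m)%:~R|))%:E)); last first.
  by move=> k _; congr (expR (- `|_|))%:E; rewrite /r intrD; ring.
rewrite (@zn_sum_shift (fun z : int => (expR (- `|r + z%:~R|))%:E) m); last first.
  by move=> z; rewrite lee_fin expR_ge0.
apply: (@le_trans _ _ (\sum_(k <oo) ((expR 1)%:E * (expR (- `|(zn k)%:~R : R|))%:E))%E).
  apply: lee_nneseries => [k _ _|k _]; first by rewrite lee_fin expR_ge0.
  rewrite -EFinM lee_fin -expRD ler_expR.
  have : `|(zn k)%:~R : R| <= `|r + (zn k)%:~R| + `|r|.
    by rewrite -[leLHS]/(`|(zn k)%:~R|) -{1}[(zn k)%:~R](addKr r) addrC (le_trans (ler_normB _ _))// .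
  have : `|r| <= 1 by rewrite ger0_norm; case/andP: r01 => // _ /ltW.
  lra.
rewrite nneseriesZl; last by move=> k _; rewrite lee_fin expR_ge0.
by rewrite /latM EFinM lee_wpmul2l ?lee_fin ?expR_ge0// sum_exp_zn.
Qed.


(** The periodization of [q], written as an integral so that differentiation under the integral sign
    applies to the series. *)
Definition lat q s : R := \int[cnt]_k q (s + (zn k)%:~R).

Section lat.
Variables (q : R -> R) (D : R).
Hypothesis qD : forall u, `|q u| <= D * expR (- `|u|).

Let D0 : 0 <= D.
Proof.
by have := le_trans (normr_ge0 _) (qD 0); rewrite pmulr_lge0// expR_gt0.
Qed.

Lemma lat_integral_norm s :
  (\int[cnt]_k (`|q (s + (zn k)%:~R)|)%:E <= (D * latM)%:E)%E.
Proof.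
rewrite ge0_integral_count; last by move=> k; rewrite lee_fin.
apply: (@le_trans _ _ (\sum_(k <oo) (D%:E * (expR (- `|s + (zn k)%:~R|))%:E))%E).
  by apply: lee_nneseries => [k _ _|k _]; rewrite ?lee_fin// -EFinM lee_fin.
rewrite nneseriesZl; last by move=> k _; rewrite lee_fin expR_ge0.
by rewrite EFinM lee_wpmul2l ?lee_fin// sum_exp_shift.
Qed.

Lemma lat_integrable s : cnt.-integrable setT (EFin \o (fun k => q (s + (zn k)%:~R))).
Proof.
apply/integrableP; split => //.
exact: (le_lt_trans (lat_integral_norm s) (ltry _)).
Qed.

Lemma lat_bounded s : `|lat q s| <= D * latM.
Proof.
have i := lat_integrable s.
apply: le_trans (le_normr_Rintegral measurableT i) _.
rewrite -lee_fin; apply: le_trans (lat_integral_norm s).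
rewrite /Rintegral fineK//.
rewrite ge0_fin_numE; last by apply: integral_ge0 => k _; rewrite lee_fin.
exact: (le_lt_trans (lat_integral_norm s) (ltry _)).
Qed.

Lemma latE s : (forall u, 0 <= q u) ->
  (lat q s)%:E = (\sum_(k <oo) (q (s + (zn k)%:~R))%:E)%E.
Proof.
move=> q0; rewrite /lat /Rintegral fineK; last first.
  exact: (integrable_fin_num measurableT (lat_integrable s)).
by rewrite ge0_integral_count// => k; rewrite lee_fin.
Qed.

End lat.

Lemma is_derive_lat q q' (D : R) s :
  (forall u, `|q u| <= D * expR (- `|u|)) ->
  (forall u, `|q' u| <= D * expR (- `|u|)) ->
  (forall u : R, is_derive u 1 q (q' u)) -> is_derive s 1 (lat q) (lat q' s).
Proof.
move=> qD q'D dq.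
have D0 : 0 <= D.
  by have := le_trans (normr_ge0 _) (qD 0); rewrite pmulr_lge0// expR_gt0.
(* For |x - s| < 1 the triangle inequality bounds |x + zn k| below by |zn k| - |s| - 1, which makes
   the domination independent of x. *)
pose G k := D * expR (`|s| + 1) * expR (- `|(zn k)%:~R : R|).
apply: (@is_derive_Rintegral _ _ _ _ (fun x k => q (x + (zn k)%:~R))
  (fun x k => q' (x + (zn k)%:~R)) G s 1) => //.
- by move=> x _; exact: (lat_integrable qD).
- move=> x k _.
  have H := derD (der_id x) (der_cst (zn k)%:~R x).
  by have := @is_derive1_comp _ q _ x _ _ (dq _) H; rewrite addr0 mulr1.
- apply/integrableP; split => //.
  under eq_integral do rewrite /= ger0_norm ?mulr_ge0 ?expR_ge0//.
  rewrite ge0_integral_count; last by move=> k; rewrite lee_fin !mulr_ge0// expR_ge0.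
  under eq_eseriesr do rewrite EFinM.
  rewrite nneseriesZl; last by move=> k _; rewrite lee_fin expR_ge0.
  rewrite lte_mul_pinfty// ?lee_fin ?mulr_ge0 ?expR_ge0//.
  exact: (le_lt_trans sum_exp_zn (ltry _)).
- move=> x k xs; apply: le_trans (q'D _) _.
  rewrite /G -mulrA ler_wpM2l// -expRD ler_expR.
  have h1 : `|(zn k)%:~R : R| <= `|x + (zn k)%:~R| + `|x|.
    by rewrite -{1}[(zn k)%:~R](addKr x) addrC (le_trans (ler_normB _ _)).
  have h2 : `|x| <= `|s| + `|x - s|.
    by rewrite -{1}[x](subrK s) addrC (le_trans (ler_normD _ _)).
  lra.
Qed.

Lemma is_derive_lat_time (q q2 : R -> R -> R) (D a b : R) t s : a < t < b ->
  (forall t u, a <= t <= b -> `|q t u| <= D * expR (- `|u|)) ->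
  (forall t u, a <= t <= b -> `|q2 t u| <= D * expR (- `|u|)) ->
  (forall t u : R, a <= t <= b -> is_derive t 1 (q ^~ u) (q2 t u)) ->
  is_derive t 1 (fun t => lat (q t) s) (lat (q2 t) s).
Proof.
move=> /andP[at_ tb] qD q2D dq.
have D0 : 0 <= D.
  have abt : a <= t <= b by rewrite !ltW.
  by have := le_trans (normr_ge0 _) (qD t 0 abt); rewrite pmulr_lge0// expR_gt0.
pose e := Num.min (t - a) (b - t).
have e0 : 0 < e by rewrite /e lt_min !subr_gt0 at_.
have near_t x : `|x - t| < e -> a <= x <= b.
  rewrite /e lt_min !ltr_norml => /andP[/andP[? ?] /andP[? ?]]; apply/andP; split; lra.
pose G k := D * expR (- `|s + (zn k)%:~R|).
apply: (@is_derive_Rintegral _ _ _ _ (fun x k => q x (s + (zn k)%:~R))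
  (fun x k => q2 x (s + (zn k)%:~R)) G t e) => //.
- by move=> x /near_t xab; apply: (@lat_integrable (q x) D) => u; exact: qD.
- by move=> x k /near_t xab; exact: dq.
- apply: (@lat_integrable (fun u => D * expR (- `|u|)) D _ s) => u.
  by rewrite ger0_norm// mulr_ge0// expR_ge0.
- by move=> x k /near_t xab; exact: q2D.
Qed.

End lattice.

Section theta.
Context (R : realType).
Implicit Types (s t a b : R).

Definition theta t : R -> R := lat (gauss t).
Definition theta1 t : R -> R := lat (gauss1 t).
Definition theta2 t : R -> R := lat (gauss2 t).

Let gaussD t : 0 < t -> exists2 D, 0 <= D & forall s,
   [/\ `|gauss t s| <= D * expR (- `|s|), `|gauss1 t s| <= D * expR (- `|s|) &
       `|gauss2 t s| <= D * expR (- `|s|)].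
Proof.
move=> t0; have [D D0 HD] := gauss_bound t0 (lexx t).
by exists D => // s; apply: HD; rewrite lexx.
Qed.

Lemma thetaE t s : 0 < t ->
  (theta t s)%:E = (\sum_(k <oo) (gauss t (s + (zn k)%:~R))%:E)%E.
Proof.
move=> t0; have [D D0 HD] := gaussD t0.
by apply: (@latE _ _ D) => u; [have [] := HD u|rewrite ltW// gauss_gt0].
Qed.

Lemma is_derive_theta t s : 0 < t -> is_derive s 1 (theta t) (theta1 t s).
Proof.
move=> t0; have [D D0 HD] := gaussD t0.
by apply: (@is_derive_lat _ _ _ D) => u; [have [] := HD u|have [] := HD u|exact: is_derive_gauss].
Qed.

Lemma is_derive_theta1 t s : 0 < t -> is_derive s 1 (theta1 t) (theta2 t s).
Proof.
move=> t0; have [D D0 HD] := gaussD t0.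
by apply: (@is_derive_lat _ _ _ D) => u; [have [] := HD u|have [] := HD u|exact: is_derive_gauss1].
Qed.

Lemma is_derive_theta_time t s : 0 < t -> is_derive t 1 (theta ^~ s) (theta2 t s).
Proof.
move=> t0.
have [D D0 HD] := @gauss_bound _ (t / 2) (2 * t) ltac:(lra) ltac:(lra).
change (is_derive t 1 (fun t => lat (gauss t) s) (lat (gauss2 t) s)).
apply: (@is_derive_lat_time _ _ _ D (t / 2) (2 * t)).
- apply/andP; split; lra.
- by move=> t' u h; have [] := HD t' u h.
- by move=> t' u h; have [] := HD t' u h.
- by move=> t' u /andP[? ?]; apply: is_derive_gauss_time; lra.
Qed.

Lemma theta_bound a b : 0 < a -> a <= b ->
  exists2 M, 0 <= M & forall t s, a <= t <= b ->
   [/\ `|theta t s| <= M, `|theta1 t s| <= M & `|theta2 t s| <= M].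
Proof.
move=> a0 ab; have [D D0 HD] := gauss_bound a0 ab.
exists (D * latM R).
  apply: le_trans (normr_ge0 _) (@lat_bounded _ (gauss a) D _ 0) => u.
  by have [] := HD a u _; rewrite ?lexx.
by move=> t s tab; split; apply: lat_bounded => u; have [] := HD t u tab.
Qed.

(** The single term of index - floor s has its argument in [0, 1), where the gaussian is at least
    its value at 1. *)
Lemma theta_lower t : 0 < t -> forall s, gauss t 1 <= theta t s.
Proof.
move=> t0 s; rewrite -lee_fin thetaE//.
have g0 u : (0 <= (gauss t u)%:E)%E by rewrite lee_fin ltW// gauss_gt0.
rewrite -(@esum_zn _ (fun z => (gauss t (s + z%:~R))%:E))//.
apply: (@le_trans _ _ (gauss t (s + (- Num.floor s)%:~R))%:E).
  rewrite lee_fin /gauss ler_expR lerD2l lerN2 ler_pM2r ?invr_gt0 ?mulr_gt0//.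
  have /andP[h1 h2] := floor_itv s; rewrite expr1n.
  rewrite intrN; rewrite intrD in h2.
  by rewrite expr_le1// ?subr_ge0// lerBlDr addrC ltW.
rewrite -(@esum_set1 _ _ (- Num.floor s) (fun z => (gauss t (s + z%:~R))%:E))//.
apply: (@le_trans _ _ (\esum_(z in [set: int] `&` [set - Num.floor s]) (gauss t (s + z%:~R))%:E)).
  by rewrite setTI.
rewrite esum_mkcondr; apply: le_esum => z _.
by case: ifPn.
Qed.

Lemma theta_gt0 t s : 0 < t -> 0 < theta t s.
Proof. by move=> t0; apply: lt_le_trans (theta_lower t0 s); exact: gauss_gt0. Qed.

Lemma thetaN t s : 0 < t -> theta t (- s) = theta t s.
Proof.
move=> t0; apply: EFin_inj; rewrite !thetaE//.
have g0 u : (0 <= (gauss t u)%:E)%E by rewrite lee_fin ltW// gauss_gt0.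
rewrite -(@zn_sumN _ (fun z => (gauss t (s + z%:~R))%:E))//.
by apply: eq_eseriesr => k _; rewrite -[in LHS]gaussN opprD opprK intrN.
Qed.

Lemma theta_periodic t s (m : int) : 0 < t -> theta t (s + m%:~R) = theta t s.
Proof.
move=> t0; apply: EFin_inj; rewrite !thetaE//.
have g0 u : (0 <= (gauss t u)%:E)%E by rewrite lee_fin ltW// gauss_gt0.
rewrite -[RHS](@zn_sum_shift _ (fun z => (gauss t (s + z%:~R))%:E) m)//.
by apply: eq_eseriesr => k _; rewrite intrD; congr (gauss _ _)%:E; ring.
Qed.

Lemma theta_doubling t s x : 0 < t -> t <= s <= 2 * t ->
  theta t x <= expR (ln 2 / 2) * theta s x.
Proof.
move=> t0 ts; have s0 : 0 < s by case/andP: ts => + _; exact: lt_le_trans.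
rewrite -lee_fin EFinM !thetaE// -nneseriesZl; last first.
  by move=> k _; rewrite lee_fin ltW// gauss_gt0.
apply: lee_nneseries => [k _ _|k _]; first by rewrite lee_fin ltW// gauss_gt0.
by rewrite -EFinM lee_fin gauss_doubling.
Qed.

(** Term by term; the hypothesis says that x is at distance at least r from 0 on the circle. *)
Lemma theta_concentration t x r : 0 < t -> 0 <= r ->
  (forall z : int, r <= `|x + z%:~R|) ->
  theta t x <= expR (ln 2 / 2 - r ^+ 2 / (8 * t)) * theta (2 * t) x.
Proof.
move=> t0 r0 H; have t20 : 0 < 2 * t by rewrite mulr_gt0.
rewrite -lee_fin EFinM !thetaE// -nneseriesZl; last first.
  by move=> k _; rewrite lee_fin ltW// gauss_gt0.
apply: lee_nneseries => [k _ _|k _]; first by rewrite lee_fin ltW// gauss_gt0.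
by rewrite -EFinM lee_fin gauss_concentration// r0 H.
Qed.

Lemma continuous_theta t : 0 < t -> continuous (theta t).
Proof.
move=> t0 s; apply: differentiable_continuous; apply/derivable1_diffP.
by have [] := is_derive_theta s t0.
Qed.

Lemma measurable_theta t : 0 < t -> measurable_fun setT (theta t).
Proof. by move=> t0; apply: continuous_measurable_fun; exact: continuous_theta. Qed.

End theta.

(** * The heat semigroup on the circle *)

Lemma ge0_integral_mrestr d (T : measurableType d) (R : realType)
    (m : {measure set T -> \bar R}) (D : set T) (mD : measurable D)
    (f : T -> \bar R) : measurable_fun setT f -> (forall x, 0 <= f x)%E ->
  (\int[mrestr m mD]_x f x = \int[m]_(x in D) f x)%E.
Proof.
move=> mf f0.
rewrite (@ge0_negligible_integral _ _ _ _ setT (~` D))//.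
- rewrite setTD setCK; apply: eq_measure_integral => A mA AD.
  by rewrite /= /mrestr setIidl.
- exact: measurableC.
- by rewrite /= /mrestr setICl measure0.
Qed.

Section shift.
Context (R : realType).
Local Notation leb := (@lebesgue_measure R).
Implicit Types (c : R) (F : R -> \bar R).

Let measurable_shift c :
  measurable_fun setT (fun x : measurableTypeR R => x + c : measurableTypeR R).
Proof. by apply: measurable_funD. Qed.

Lemma lebesgue_measure_shift c (A : set (measurableTypeR R)) : measurable A ->
  pushforward leb (fun x : measurableTypeR R => x + c : measurableTypeR R) A = leb A.
Proof.
move=> mA; apply/esym/lebesgue_measure_unique => //= _ [[a b]] _ <-.
rewrite /pushforward.
rewrite (_ : _ @^-1` _ = `]a - c, b - c]%classic); last first.
  by apply/seteqP; split => x /=; rewrite !in_itv/= ltrBlDr lerBrDr.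
rewrite !lebesgue_measure_itv/= !lte_fin ltrD2r.
by case: ifP => // _; rewrite -!EFinB; congr EFin; ring.
Qed.

Lemma ge0_integral_shift c F : measurable_fun setT F -> (forall x, 0 <= F x)%E ->
  (\int[leb]_x F (x + c)%R = \int[leb]_x F x)%E.
Proof.
move=> mF F0.
have := @ge0_integral_pushforward _ _ _ _ R _ (measurable_shift c) leb setT F measurableT mF (fun y _ => F0 y).
rewrite preimage_setT => <-.
apply: eq_measure_integral => A mA _; exact: lebesgue_measure_shift.
Qed.

Definition Q1 : set (measurableTypeR R) := `[- 2^-1, 2^-1[%classic.

Lemma measurable_Q1 : measurable Q1.
Proof. exact: measurable_itv. Qed.

Lemma lebesgue_Q1 : leb Q1 = 1%E.
Proof.
rewrite /Q1 lebesgue_measure_itv/= lte_fin ifT; last by lra.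
by rewrite -EFinB; congr EFin; lra.
Qed.

(** The circle is modelled by the real line carrying the restriction of Lebesgue measure to a
    period, so periodic functions and kernels remain functions on the line. *)
Definition mu1 : set (measurableTypeR R) -> \bar R := mrestr leb measurable_Q1.

HB.instance Definition _ := Measure.on mu1.

Let mu1_setT : mu1 setT = 1%E.
Proof. by rewrite /mu1 /mrestr setTI lebesgue_Q1. Qed.

HB.instance Definition _ := Measure_isProbability.Build _ _ _ mu1 mu1_setT.

Lemma ge0_integral_mu1 F : measurable_fun setT F -> (forall x, 0 <= F x)%E ->
  (\int[mu1]_x F x = \int[leb]_(x in Q1) F x)%E.
Proof. by move=> mF F0; exact: ge0_integral_mrestr. Qed.

(** The integer translates of the half-open interval [Q1] tile the line; the tile of x has index
    floor (x + 1/2). *)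
Lemma ge0_integral_unfold F : measurable_fun setT F -> (forall x, 0 <= F x)%E ->
  (\int[leb]_x F x = \sum_(k <oo) \int[mu1]_x F (x + (zn k)%:~R)%R)%E.
Proof.
move=> mF F0.
pose P (k : nat) : set (measurableTypeR R) :=
  `[(zn k)%:~R - 2^-1, (zn k)%:~R + 2^-1[%classic.
have [_ zn_inj zn_surj] := zn_bij.
have mP k : measurable (P k) by exact: measurable_itv.
have PT : \bigcup_k P k = setT.
  apply/seteqP; split => // x _.
  have [k _ zk] := zn_surj (Num.floor (x + 2^-1)) I.
  exists k => //; rewrite /P /= in_itv/= zk.
  have /andP[h1 h2] := floor_itv (x + 2^-1); rewrite intrD in h2.
  by apply/andP; split; lra.
have tP : trivIset setT P.
  apply/trivIsetP => i j _ _ ij; apply/seteqP; split => // x [].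
  rewrite /P /= !in_itv/= => /andP[h1 h2] /andP[h3 h4].
  move/eqP: ij; apply; apply: zn_inj; rewrite ?inE//.
  apply/eqP; rewrite eq_le -!(ltzD1) -!(ltr_int R) !intrD.
  by apply/andP; split; lra.
have mFP : measurable_fun (\bigcup_k P k) F by exact: measurable_funTS.
have := @ge0_integral_bigcup _ _ _ leb P F mP mFP (fun x _ => F0 x) tP.
rewrite PT => ->; apply: eq_eseriesr => k _.
have mFk : measurable_fun setT (fun x : R => F (x + (zn k)%:~R)%R).
  by apply: (measurableT_comp mF); exact: measurable_shift.
rewrite ge0_integral_mu1// [RHS]integral_mkcond integral_mkcond.
rewrite -(@ge0_integral_shift (zn k)%:~R (F \_ (P k))).
- apply: eq_integral => x _; rewrite !patchE.
  rewrite (_ : (x + (zn k)%:~R \in P k) = (x \in Q1))//.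
  apply/idP/idP => /set_mem H; apply/mem_set; move: H; rewrite /P /Q1 /= !in_itv/=;
    by move=> /andP[? ?]; apply/andP; split; lra.
- by apply: (measurable_restrictT F (mP k)).1; exact: measurable_funTS.
- by move=> x; apply: erestrict_ge0.
Qed.

(** Unfolding: since [w] is periodic, the sum over the lattice inside theta merges with the sum over
    tiles, leaving one gaussian on the whole line. *)
Lemma theta_unfold t a (w : R -> R) : 0 < t -> measurable_fun setT w ->
  (forall x, 0 <= w x) -> (forall x (m : int), w (x + m%:~R) = w x) ->
  (\int[mu1]_y ((theta t (y - a))%:E * (w y)%:E) =
   \int[leb]_y ((gauss t (y - a))%:E * (w y)%:E))%E.
Proof.
move=> t0 mw w0 pw.
have mB : measurable_fun setT (fun y : R => y - a) by apply: measurable_funB.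
have mgw : measurable_fun setT (fun y : R => ((gauss t (y - a))%:E * (w y)%:E)%E).
  apply: emeasurable_funM; last exact/measurable_EFinP.
  by apply/measurable_EFinP; exact: (measurableT_comp (measurable_gauss t0)).
have g0 y : (0 <= (gauss t y)%:E)%E by rewrite lee_fin ltW// gauss_gt0.
have gw0 y : (0 <= (gauss t (y - a))%:E * (w y)%:E)%E by rewrite mule_ge0// lee_fin.
have mk (k : nat) : measurable_fun setT (fun y : R =>
    ((gauss t (y + (zn k)%:~R - a))%:E * (w (y + (zn k)%:~R))%:E)%E).
  by apply: (measurableT_comp mgw); exact: measurable_shift.
rewrite (ge0_integral_unfold mgw gw0) -integral_nneseries//.
apply: eq_integral => y _; rewrite thetaE// muleC -nneseriesZl//.
apply: eq_eseriesr => k _; rewrite pw muleC; congr ((gauss t _)%:E * _)%E.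
by ring.
Qed.

Lemma integral_theta t x : 0 < t -> (\int[mu1]_y (theta t (x - y))%:E = 1)%E.
Proof.
move=> t0.
transitivity (\int[mu1]_y ((theta t (y - x))%:E * (cst 1 y)%:E))%E.
  by apply: eq_integral => y _; rewrite mule1 -thetaN// opprB.
have mc : measurable_fun setT (cst 1 : R -> R) by exact: measurable_cst.
rewrite (theta_unfold x t0 mc (fun _ => ler01) (fun _ _ => erefl)) -[RHS](integral_gauss x t0).
by apply: eq_integral => y _; rewrite mule1.
Qed.

(** One theta factor is unfolded to the line, the other is expanded in gaussians; each term is then
    a gaussian convolution and the results sum to theta again. *)
Lemma theta_semigroup s t x z : 0 < s -> 0 < t ->
  (\int[mu1]_y ((theta s (x - y))%:E * (theta t (y - z))%:E) =
   (theta (s + t) (x - z))%:E)%E.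
Proof.
move=> s0 t0; have st0 : 0 < s + t by rewrite addr_gt0.
transitivity (\int[mu1]_y ((theta t (y - z))%:E * (theta s (y - x))%:E))%E.
  by apply: eq_integral => y _; rewrite muleC -[theta s (x - y)]thetaN// opprB.
have mB a : measurable_fun setT (fun y : R => y - a) by apply: measurable_funB.
have g0 u y : (0 <= (gauss u y)%:E)%E by rewrite lee_fin ltW// gauss_gt0.
rewrite theta_unfold//; last 3 first.
- exact: (measurableT_comp (measurable_theta s0) (mB x)).
- by move=> y; rewrite ltW// theta_gt0.
- by move=> y m; rewrite -(theta_periodic (y - x) m s0); congr (theta s _); ring.
transitivity (\sum_(k <oo) \int[leb]_y
    (gauss t (y - z) * gauss s (y - (x - (zn k)%:~R)))%:E)%E.
  rewrite -integral_nneseries//; last 2 first.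
  - move=> k; apply/measurable_EFinP; apply: measurable_funM.
      exact: (measurableT_comp (measurable_gauss t0) (mB z)).
    exact: (measurableT_comp (measurable_gauss s0) (mB _)).
  - by move=> k y _; rewrite EFinM mule_ge0.
  apply: eq_integral => y _; rewrite thetaE// -nneseriesZl//.
  apply: eq_eseriesr => k _; rewrite EFinM; congr (_ * (gauss s _)%:E)%E; ring.
under eq_eseriesr do rewrite gauss_convolution//.
rewrite -[theta _ _]thetaN// opprB thetaE//.
by apply: eq_eseriesr => k _; congr (gauss _ _)%:E; ring.
Qed.

Definition theta_kernel (t x y : R) := theta t (x - y).

Lemma diffusion_theta : diffusion mu1 theta_kernel (expR (ln 2 / 2)).
Proof.
split.
- exact: expR_gt0.
- move=> t t0; apply: (measurableT_comp (measurable_theta t0)).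
  by apply: measurable_funB.
- by move=> t x y t0; rewrite ltW// theta_gt0.
- by move=> t x y t0; rewrite /theta_kernel -thetaN// opprB.
- by move=> t x t0; exact: integral_theta.
- by move=> s t x z s0 t0; exact: theta_semigroup.
- by move=> s t x y t0 ts; exact: theta_doubling.
- move=> t t0; have [M M0 HM] := theta_bound t0 (lexx t).
  exists M => x y; apply: le_trans (ler_norm _) _.
  by have [] := HM t (x - y) _; rewrite ?lexx.
Qed.

End shift.

(** * Vanishing oscillation on the circle *)

Section oscillation_1d.
Context (R : realType).
Local Notation mu := (@mu1 R).
Local Notation K := (@theta_kernel R).
Local Notation leb := (@lebesgue_measure R).

Definition dl (j : nat) : R := j.+1%:R^-1.

Lemma dl_gt0 j : 0 < dl j.
Proof. by rewrite invr_gt0. Qed.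

(** The bound exp y >= y compares the sequence with a multiple of 1/(j+1). *)
Lemma cvg_exp_dl (r : R) : 0 < r ->
  expR (ln 2 / 2 - r ^+ 2 / (8 * dl j)) @[j --> \oo] --> (0 : R).
Proof.
move=> r0; have r20 : 0 < r ^+ 2 by rewrite exprn_gt0.
apply: (@squeeze_cvgr _ _ _ _ (cst 0) (fun j => expR (ln 2 / 2) * (8 / r ^+ 2) * harmonic j)).
- apply: nearW => j; rewrite expR_ge0/= expRD -mulrA ler_pM2l ?expR_gt0//.
  rewrite expRN -[leRHS]invrK lef_pV2 ?posrE ?expR_gt0 ?invr_gt0 ?mulr_gt0 ?invr_gt0//.
  rewrite /dl !invfM !invrK.
  apply: le_trans (expR_ge1Dx _); rewrite (_ : r ^+ 2 * _ = 8^-1 * r ^+ 2 * j.+1%:R); last by ring.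
  by rewrite lerDr.
- exact: cvg_cst.
- rewrite -[X in _ --> X](mulr0 (expR (ln 2 / 2) * (8 / r ^+ 2))).
  by apply: cvgM; [exact: cvg_cst|exact: cvg_harmonic].
Qed.

(** At almost every x the indicator is constant near x on the circle, so only points y at circle
    distance at least some r > 0 contribute. There theta is a vanishing factor times theta at the
    doubled time, which has integral one. *)
Let osc_ray a : osc_cvg0 mu K dl \1_(`]a, +oo[%classic).
Proof.
have mA : measurable (`]a, +oo[%classic : set R) by exact: measurable_itv.
have I1 (z : R) : \1_(`]a, +oo[%classic) z = (a < z)%R%:R :> R.
  rewrite indicE; congr (_%:R); congr nat_of_bool.
  apply/idP/idP => [/set_mem|h]; first by rewrite /= in_itv/= andbT.
  by apply/mem_set; rewrite /= in_itv/= andbT.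
have mI : measurable_fun setT (\1_(`]a, +oo[%classic) : R -> R) by exact: measurable_indic.
apply: (@osc_cvg0_pointwise _ _ _ mu K _ (diffusion_theta R) dl dl_gt0 _ 1 mI).
  by move=> x y; rewrite !indicE; case: (_ \in _); case: (_ \in _);
    rewrite /= ?subrr ?subr0 ?sub0r ?normrN ?normr0 ?normr1.
(* Seen on the circle, the indicator may jump at [a] and at the point where the two ends of [Q1]
   meet; the right end is not in [Q1]. *)
exists (~` @Q1 R `|` ([set a] `|` [set - 2^-1])); split.
- apply: measurableU; first by apply: measurableC; exact: measurable_Q1.
  by apply: measurableU; exact: measurable_set1.
- transitivity (leb ((~` @Q1 R `|` ([set a] `|` [set - 2^-1])) `&` @Q1 R)) => //.
  rewrite setIUl setICl set0U; apply/eqP; rewrite eq_le measure_ge0 andbT.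
  apply: (@le_trans _ _ (leb ([set a] `|` [set - 2^-1]))).
    apply: le_measure; rewrite ?inE; last exact: subIsetl.
      by apply: measurableI; [apply: measurableU; exact: measurable_set1|exact: measurable_Q1].
    by apply: measurableU; exact: measurable_set1.
  apply: (le_trans (measureU2 leb (measurable_set1 a) (measurable_set1 (- 2^-1)))).
  have E : (leb [set a] + leb [set (- 2^-1)%R] = 0)%E by rewrite !lebesgue_measure_set1 adde0.
  by rewrite le_eqVlt; apply/orP; left; apply/eqP; exact: E.
move=> x /= Hx; apply: contrapT => /not_orP[/contrapT Qx /not_orP[xa xh]]; apply: Hx.
move: Qx; rewrite /Q1 /= in_itv/= => /andP[x1 x2].
have {}xh : - 2^-1 < x by rewrite lt_neqAle x1 andbT eq_sym; apply/eqP.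
have {}xa : 0 < `|x - a| by rewrite normr_gt0 subr_eq0; apply/eqP.
pose r := Num.min `|x - a| (Num.min (x + 2^-1) (2^-1 - x)).
have r0 : 0 < r by rewrite /r !lt_min xa subr_gt0 x2 andbT -ltrBlDr sub0r.
have [ra rl rr] : [/\ r <= `|x - a|, r <= x + 2^-1 & r <= 2^-1 - x].
  by split; rewrite /r !ge_min lexx ?orbT.
have n_incr := @nnmeas_incr _ _ R (\1_(`]a, +oo[%classic)) x mI.
suff Hn : \forall j \near \oo, (cst 0 j <= dif mu K (dl j)
    (fun y => (`|\1_(`]a, +oo[%classic) x - \1_(`]a, +oo[%classic) y : R|)%:E) x <=
    (expR (ln 2 / 2 - r ^+ 2 / (8 * dl j)))%:E)%E.
  apply: (squeeze_cvge Hn); first exact: cvg_cst.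
  by apply: cvg_EFin; [exact: nearW|exact: cvg_exp_dl].
- apply: nearW => j; have d0 := dl_gt0 j; have d20 : 0 < 2 * dl j by rewrite mulr_gt0.
  rewrite (nnmeas_dif (diffusion_theta R) d0 n_incr).2/=.
  set c := expR _; have c0 : 0 <= c by exact: expR_ge0.
  have mth t : 0 < t -> measurable_fun setT (fun y : R => (theta t (x - y))%:E).
    move=> t0; apply/measurable_EFinP; apply: (measurableT_comp (measurable_theta t0)).
    by apply: measurable_funB.
  rewrite -[leRHS]mule1 -(integral_theta x d20) -ge0_integralZl_EFin//; last 2 first.
  - by move=> y _; rewrite lee_fin ltW// theta_gt0.
  - exact: mth.
  have t0 y : (0 <= (theta (dl j) (x - y))%:E)%E by rewrite lee_fin ltW// theta_gt0.
  have m1 : measurable_fun setT (fun y : R =>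
     ((theta (dl j) (x - y))%:E * (`|\1_(`]a, +oo[%classic) x - \1_(`]a, +oo[%classic) y|)%:E)%E).
    by apply: emeasurable_funM; [exact: mth|exact: n_incr.1].
  have m2 : measurable_fun setT (fun y : R => (c%:E * (theta (2 * dl j) (x - y))%:E)%E).
    by apply: measurable_funeM; exact: mth.
  rewrite /dif /theta_kernel ge0_integral_mu1//; last by move=> y; rewrite mule_ge0.
  rewrite ge0_integral_mu1//; last first.
    by move=> y; rewrite mule_ge0// lee_fin ltW// theta_gt0.
  apply: ge0_le_integral.
  + exact: measurable_Q1.
  + by move=> y _; rewrite mule_ge0.
  + exact: measurable_funTS m1.
  + exact: measurable_funTS m2.
  move=> y; rewrite /Q1 /= in_itv/= => /andP[y1 y2].
  rewrite -!EFinM lee_fin !I1.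
  (* When x and y lie on different sides of a, |x - y| >= |x - a| >= r. For a nonzero integer z, |x
     - y| <= 1 - r while |z| >= 1. *)
  have Hc : (a < x) != (a < y) -> theta (dl j) (x - y) <= c * theta (2 * dl j) (x - y).
    move=> axy; apply: theta_concentration => //; first exact: ltW.
    move=> z; have [->|z0] := eqVneq z 0.
      rewrite addr0; apply: le_trans ra _.
      have [ax|xa'] := ltP a x; have [ay|ya] := ltP a y; move: axy; rewrite ?ax ?ay ?(le_gtF xa') ?(le_gtF ya)// => _.
        by rewrite !ger0_norm; lra.
      by rewrite !ler0_norm; lra.
    have : 1 <= `|z%:~R : R|.
      by rewrite -intr_norm ler1z -gtz0_ge1 normr_gt0.
    have : `|z%:~R : R| <= `|x - y + z%:~R| + `|x - y|.
      by rewrite -{1}[z%:~R](addKr (x - y)) addrC (le_trans (ler_normB _ _)).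
    have : `|x - y| <= 1 - r by rewrite ler_norml; apply/andP; split; lra.
    lra.
  have [/eqP E|/Hc] := boolP ((a < x) == (a < y)).
    by rewrite E subrr normr0 mulr0 mulr_ge0// ltW// theta_gt0.
  case: (a < x); case: (a < y); rewrite /= ?subrr ?subr0 ?sub0r ?normrN ?normr0 ?normr1 ?mulr0 ?mulr1//.
    by rewrite mulr_ge0// ltW// theta_gt0.
  by rewrite mulr_ge0// ltW// theta_gt0.
Qed.

Lemma osc_cvg0_theta (A : set (measurableTypeR R)) : measurable A ->
  osc_cvg0 mu K dl \1_A.
Proof.
move=> mA.
have HG (B : set (measurableTypeR R)) : measurable B -> <<s @RGenOInfty.G R >> B.
  by move=> mB; have := mB; rewrite [X in X _]RGenOInfty.measurableE.
have HC (B : set (measurableTypeR R)) : @RGenOInfty.G R B ->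
    measurable B /\ osc_cvg0 mu K dl \1_B.
  by move=> [a ->]; split; [exact: measurable_itv|exact: osc_ray].
exact: (@osc_cvg0_sigma _ _ _ mu K _ (diffusion_theta R) dl dl_gt0 _ HG HC A mA).
Qed.

End oscillation_1d.

(** * The heat semigroup on the torus *)

Section torus_measure.
Context (R : realType).
Local Notation leb := (@lebesgue_measure R).
Implicit Types n : nat.

Definition QB n : set (n.-tuple R) := [set x | forall i, Q1 (tnth x i)].

Lemma measurable_QB n : measurable (@QB n).
Proof.
rewrite (_ : @QB n = \bigcap_(i in [set: 'I_n])
    (fun x : n.-tuple R => tnth x i) @^-1` @Q1 R).
  apply: fin_bigcap_measurable => // i _.
  by rewrite -[X in measurable X]setTI; apply: measurable_tnth => //; exact: measurable_Q1.
by apply/seteqP; split => x /= H i; [move=> _|]; exact: H.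
Qed.

(** The Borel counterpart of [torus], on the sigma-algebra of tuples. *)
Definition tauB n : set (n.-tuple R) -> \bar R := mrestr (borel_lebesgue n) (@measurable_QB n).

HB.instance Definition _ n := Measure.on (@tauB n).

Let tauB_setT n : tauB [set: n.-tuple R] = 1%E.
Proof.
rewrite /tauB /mrestr setTI (borel_lebesgue_box (fun _ => @measurable_Q1 R)).
by rewrite big1// => i _; exact: lebesgue_Q1.
Qed.

HB.instance Definition _ n := Measure_isProbability.Build _ _ _ (@tauB n) (@tauB_setT n).

(** Restriction to the cube commutes with the product: the section of the restricted set at a is
    restricted to the smaller cube if a lies in [Q1], and empty otherwise. *)
Lemma tauBS n (A : set (n.+1.-tuple R)) : measurable A ->
  tauB A = pushforward (@mu1 R \x @tauB n)%E (@tcons R n) A.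
Proof.
move=> mA.
have mtA : measurable (@tcons R n @^-1` A).
  by rewrite -[X in measurable X]setTI; exact: measurable_tcons.
transitivity (\int[leb]_a borel_lebesgue n (xsection (@tcons R n @^-1` (A `&` @QB n.+1)) a))%E.
  by [].
transitivity (\int[@mu1 R]_a tauB (xsection (@tcons R n @^-1` A) a))%E; last by [].
rewrite ge0_integral_mu1; last 2 first.
- exact: (measurable_fun_xsection (@tauB n) mtA).
- by move=> x; exact: measure_ge0.
rewrite [RHS]integral_mkcond; apply: eq_integral => a _.
rewrite patchE; case: ifPn => [/set_mem aQ|aQ].
  rewrite /tauB /mrestr; congr (borel_lebesgue n _).
  apply/seteqP; split => t.
    rewrite /xsection /= inE => -[tA tQ]; split; first by rewrite /= inE.
    by move=> i; have := tQ (lift ord0 i); rewrite tnthS.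
  rewrite /xsection /= !inE => -[tA tQ]; split => //.
  by move=> i; case: (unliftP ord0 i) => [j ->|->] //; rewrite tnthS; exact: tQ.
rewrite (_ : xsection _ _ = set0) ?measure0//.
apply/seteqP; split => // t; rewrite /xsection /= inE => -[_ /(_ ord0)].
by rewrite /tcons /= => aQ'; move/negP: aQ; apply; apply/mem_set.
Qed.

Lemma ge0_integral_tauBS n (F : n.+1.-tuple R -> \bar R) :
  measurable_fun setT F -> (forall x, 0 <= F x)%E ->
  (\int[@tauB n.+1]_x F x = \int[@mu1 R]_a \int[@tauB n]_t F (tcons (a, t)))%E.
Proof.
move=> mF F0.
have mFt : measurable_fun setT (F \o @tcons R n).
  by apply: (measurableT_comp mF); exact: measurable_tcons.
transitivity (\int[pushforward (@mu1 R \x @tauB n)%E (@tcons R n)]_x F x)%E.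
  apply: eq_measure_integral; first exact: measurable_tcons.
  by move=> ? A mA _; exact: tauBS.
rewrite (@ge0_integral_pushforward _ _ _ _ R _ (@measurable_tcons R n)
  (@mu1 R \x @tauB n)%E setT F measurableT mF (fun y _ => F0 y)) preimage_setT.
exact: (fubini_tonelli1 (m1 := @mu1 R) (m2 := @tauB n) (F \o @tcons R n) mFt (fun z => F0 (tcons z))).
Qed.

Lemma tnth_tconsS n a (t : n.-tuple R) i : tnth (tcons (a, t)) (lift ord0 i) = tnth t i.
Proof. by rewrite tnthS. Qed.

Lemma measurable_prod_tnth n (g : 'I_n -> R -> R) :
  (forall i, measurable_fun setT (g i)) ->
  measurable_fun setT (fun y : n.-tuple R => \prod_(i < n) g i (tnth y i)).
Proof.
move=> mg; apply: measurable_prod => i _.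
by apply: (measurableT_comp (mg i)); exact: measurable_tnth.
Qed.

Lemma integral_prod n (g : 'I_n -> R -> R) :
  (forall i, measurable_fun setT (g i)) -> (forall i b, 0 <= g i b) ->
  (\int[@tauB n]_y (\prod_(i < n) g i (tnth y i))%:E =
   \prod_(i < n) \int[@mu1 R]_b (g i b)%:E)%E.
Proof.
elim: n g => [|n IH] g mg g0.
  rewrite big_ord0; under eq_integral do rewrite big_ord0.
  rewrite integral_cst// mul1e; exact: (tauB_setT 0).
have mtail : measurable_fun setT (fun t : n.-tuple R =>
    (\prod_(i < n) g (lift ord0 i) (tnth t i))%:E).
  by apply/measurable_EFinP; exact: (@measurable_prod_tnth n (fun i => g (lift ord0 i))).
rewrite ge0_integral_tauBS; last 2 first.
- by apply/measurable_EFinP; exact: measurable_prod_tnth.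
- by move=> x; rewrite lee_fin prodr_ge0.
rewrite big_ord_recl -(IH (fun i => g (lift ord0 i)))//.
transitivity (\int[@mu1 R]_a ((g ord0 a)%:E *
    \int[@tauB n]_t (\prod_(i < n) g (lift ord0 i) (tnth t i))%:E))%E.
  apply: eq_integral => a _; rewrite -ge0_integralZl_EFin//; last first.
    by move=> t _; rewrite lee_fin prodr_ge0.
  apply: eq_integral => t _; rewrite big_ord_recl -EFinM.
  by under eq_bigr do rewrite tnth_tconsS.
rewrite ge0_integralZr//.
- by apply/measurable_EFinP; exact: mg.
- by move=> a _; rewrite lee_fin.
- by apply: integral_ge0 => t _; rewrite lee_fin prodr_ge0.
Qed.

Definition kernelB n (t : R) (x y : n.-tuple R) :=
  \prod_(i < n) theta t (tnth x i - tnth y i).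

(** Every axiom follows factor by factor from the circle, the integrals by Tonelli; the doubling
    constant becomes the n-th power of sqrt 2. *)
Lemma diffusion_kernelB n : diffusion (@tauB n) (@kernelB n) (expR (ln 2 / 2) ^+ n).
Proof.
have mth t x : 0 < t -> measurable_fun setT (fun b : R => theta t (x - b)).
  move=> t0; apply: (measurableT_comp (measurable_theta t0)).
  by apply: measurable_funB.
have mth' t x : 0 < t -> measurable_fun setT (fun b : R => theta t (b - x)).
  move=> t0; apply: (measurableT_comp (measurable_theta t0)).
  by apply: measurable_funB.
split.
- by rewrite exprn_gt0// expR_gt0.
- move=> t t0; apply: measurable_prod => i _.
  apply: (measurableT_comp (measurable_theta t0)); apply: measurable_funB.
    by apply: (measurableT_comp (measurable_tnth i)); exact: measurable_fst.
  by apply: (measurableT_comp (measurable_tnth i)); exact: measurable_snd.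
- by move=> t x y t0; apply: prodr_ge0 => i _; rewrite ltW// theta_gt0.
- by move=> t x y t0; apply: eq_bigr => i _; rewrite -thetaN// opprB.
- move=> t x t0.
  rewrite (@integral_prod n (fun i b => theta t (tnth x i - b))).
  + by rewrite big1// => i _; exact: integral_theta.
  + by move=> i; exact: mth.
  + by move=> i b; rewrite ltW// theta_gt0.
- move=> s t x z s0 t0.
  transitivity (\int[@tauB n]_y (\prod_(i < n)
     (theta s (tnth x i - tnth y i) * theta t (tnth y i - tnth z i)))%:E)%E.
    by apply: eq_integral => y _; rewrite big_split/= EFinM.
  rewrite (@integral_prod n (fun i b => theta s (tnth x i - b) * theta t (b - tnth z i))).
  + rewrite /kernelB -prodEFin; apply: eq_bigr => i _.
    by rewrite -theta_semigroup//; apply: eq_integral => b _; rewrite EFinM.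
  + by move=> i; apply: measurable_funM; [exact: mth|exact: mth'].
  + by move=> i b; rewrite mulr_ge0// ltW// theta_gt0.
- move=> s t x y t0 ts.
  rewrite /kernelB (_ : _ ^+ n = \prod_(i < n) expR (ln 2 / 2)); last first.
    by rewrite prodr_const card_ord.
  rewrite -big_split/=; apply: ler_prod => i _.
  by rewrite ltW ?theta_gt0//= theta_doubling.
- move=> t t0; have [M M0 HM] := theta_bound t0 (lexx t).
  exists (M ^+ n) => x y.
  rewrite (_ : M ^+ n = \prod_(i < n) M); last by rewrite prodr_const card_ord.
  apply: ler_prod => i _; rewrite ltW ?theta_gt0//=.
  apply: le_trans (ler_norm _) _.
  by have [] := HM t (tnth x i - tnth y i) _; rewrite ?lexx.
Qed.

End torus_measure.

(** * Vanishing oscillation on the torus *)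

Section oscillation_nd.
Context (R : realType).

Lemma integral_tauB_marginal n (q : 'I_n -> R -> R) (F : R -> R) (i : 'I_n) :
  (forall j, measurable_fun setT (q j)) -> (forall j b, 0 <= q j b) ->
  (forall j, (\int[@mu1 R]_b (q j b)%:E = 1)%E) ->
  measurable_fun setT F -> (forall b, 0 <= F b) ->
  (\int[@tauB R n]_y ((\prod_(j < n) q j (tnth y j))%:E * (F (tnth y i))%:E) =
   \int[@mu1 R]_b ((q i b)%:E * (F b)%:E))%E.
Proof.
move=> mq q0 q1 mF F0.
pose g j b := q j b * (if j == i then F b else 1).
transitivity (\int[@tauB R n]_y (\prod_(j < n) g j (tnth y j))%:E)%E.
  apply: eq_integral => y _; rewrite -EFinM; congr EFin.
  rewrite /g big_split/=; congr *%R.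
  by rewrite -big_mkcond/= big_pred1_eq.
have mg j : measurable_fun setT (g j).
  apply: measurable_funM; first exact: mq.
  by case: (j == i) => //; exact: measurable_cst.
have g0 j b : 0 <= g j b by rewrite mulr_ge0//; case: ifP.
rewrite integral_prod// (bigD1 i)//= big1 ?mule1.
  by apply: eq_integral => b _; rewrite /g eqxx EFinM.
move=> j ji; rewrite -[RHS](q1 j); apply: eq_integral => b _.
by rewrite /g (negbTE ji) mulr1.
Qed.

Let mth t x : 0 < t -> measurable_fun setT (fun b : R => theta t (x - b)).
Proof.
move=> t0; apply: (measurableT_comp (measurable_theta t0)).
by apply: measurable_funB.
Qed.

(** The other coordinates integrate out, in y by mass one and then in x. The bound on [g] keeps the
    inner integral finite, as the marginal formula is for real-valued functions. *)
Lemma oscillation_tnth n (t : R) (g : R -> R) (i : 'I_n) : 0 < t ->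
  measurable_fun setT g -> (forall a b, `|g a - g b| <= 1) ->
  oscillation (@tauB R n) (@kernelB R n) t (fun y => g (tnth y i)) =
  oscillation (@mu1 R) (@theta_kernel R) t g.
Proof.
move=> t0 mg g1; rewrite !oscillationE.
pose Phi a := dif (@mu1 R) (@theta_kernel R) t (fun b => (`|g a - g b|)%:E) a.
have HD := diffusion_theta R.
have nPhi : nnmeas Phi by exact: (nnmeas_osc HD t0 mg).
have Phi1 a : (Phi a <= 1)%E.
  have H b : ((`|g a - g b|)%:E <= cst 1%:E b)%E by rewrite lee_fin.
  have n1 : nnmeas (cst 1%:E : R -> \bar R) by exact: nnmeas_cst.
  rewrite -[leRHS](dif_cst HD a t0 ler01).
  exact: (@le_dif _ _ _ _ _ _ HD _ _ _ a t0 (nnmeas_incr a mg) n1 H).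
have fPhi a : (fine (Phi a))%:E = Phi a.
  by rewrite fineK// ge0_fin_numE ?nPhi.2// (le_lt_trans (Phi1 a))// ltry.
have mfPhi : measurable_fun setT (fine \o Phi).
  apply/measurable_EFinP; apply: eq_measurable_fun nPhi.1.
  by move=> a _ /=; rewrite fPhi.
transitivity (\int[@tauB R n]_x Phi (tnth x i))%E.
  apply: eq_integral => x _; rewrite /dif /kernelB.
  rewrite (@integral_tauB_marginal n (fun j b => theta t (tnth x j - b))
    (fun b => `|g (tnth x i) - g b|) i)//.
  - by move=> j; exact: mth.
  - by move=> j b; rewrite ltW// theta_gt0.
  - by move=> j; exact: integral_theta.
  - by apply: measurableT_comp => //; apply: measurable_funB.
(* A product of ones is inserted so that the marginal formula also performs the integration in x. *)
transitivity (\int[@tauB R n]_x ((\prod_(j < n) (cst 1 : R -> R) (tnth x j))%:E *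
   (fine (Phi (tnth x i)))%:E))%E.
  by apply: eq_integral => x _; rewrite big1// mul1e fPhi.
rewrite (@integral_tauB_marginal n (fun _ => cst 1) (fine \o Phi) i)//.
- by apply: eq_integral => a _; rewrite mul1e /= fPhi.
- move=> j; transitivity (\int[@mu1 R]_(b in setT) cst 1%E b)%E => //.
  by rewrite integral_cst// mul1e; exact: (@probability_setT _ _ _ (@mu1 R)).
- by move=> b; rewrite /= fine_ge0// nPhi.2.
Qed.

Lemma osc_cvg0_kernelB n (A : set (n.-tuple R)) : measurable A ->
  osc_cvg0 (@tauB R n) (@kernelB R n) (@dl R) \1_A.
Proof.
move=> mA.
(* The coordinate cylinders that generate the sigma-algebra of tuples by definition, so that [HG]
   holds by conversion. *)
pose G : set (set (n.-tuple R)) := \big[setU/set0]_(i < n)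
  preimage_set_system setT (fun x : n.-tuple R => tnth x i) (@measurable _ (measurableTypeR R)).
have HG (B : set (n.-tuple R)) : measurable B -> <<s G >> B by [].
apply: (@osc_cvg0_sigma _ _ _ (@tauB R n) (@kernelB R n) _ (@diffusion_kernelB R n)
  (@dl R) (@dl_gt0 R) G HG _ A mA) => B.
rewrite /G => GB.
have [i [I mI <-]] : exists i : 'I_n, preimage_set_system setT
   (fun x : n.-tuple R => tnth x i) (@measurable _ (measurableTypeR R)) B.
  move: GB; elim/big_ind : _ => //.
    by move=> P Q HP HQ [/HP|/HQ].
  by move=> i _ Hi; exists i.
rewrite setTI; have mB : measurable ((fun x : n.-tuple R => tnth x i) @^-1` I).
  by rewrite -[X in measurable X]setTI; exact: measurable_tnth.
split; first exact: mB.
have [mI1 HI] := osc_cvg0_theta mI.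
split; first exact: measurable_indic.
move=> e /HI; apply: filterS => j.
rewrite -(@oscillation_tnth n (dl R j) (\1_I) i) ?dl_gt0//.
by move=> a b; rewrite !indicE; case: (_ \in _); case: (_ \in _);
    rewrite /= ?subrr ?subr0 ?sub0r ?normrN ?normr0 ?normr1.
Qed.

End oscillation_nd.

(** * The heat kernel as a product of theta functions *)

Section heat_kernel_product.
Context (R : realType).

(** One inequality holds for every constant; used with [c] and with its inverse, it gives
    equality. *)
Lemma esumZl (T : choiceType) (c : R) (a : T -> \bar R) : 0 <= c ->
  (forall z, 0 <= a z)%E ->
  (\esum_(z in [set: T]) (c%:E * a z) = c%:E * \esum_(z in [set: T]) a z)%E.
Proof.
move=> c0 a0.
have le_sum (k : R) (b : T -> \bar R) : 0 <= k -> (forall z, 0 <= b z)%E ->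
    (\esum_(z in [set: T]) (k%:E * b z) <= k%:E * \esum_(z in [set: T]) b z)%E.
  move=> k0 b0; apply: ge_ereal_sup => _ [X [finX _] <-].
  rewrite -ge0_mule_fsumr//.
  rewrite lee_wpmul2l ?lee_fin//; apply: esum_ge; exists X => //.
have [->|cn0] := eqVneq c 0.
  by rewrite mul0e esum1// => z _; rewrite mul0e.
apply/eqP; rewrite eq_le le_sum//=.
have ci0 : 0 <= c^-1 by rewrite invr_ge0.
have := le_sum c^-1 (fun z => c%:E * a z)%E ci0 (fun z => mule_ge0 _ (a0 z)).
under eq_esum do rewrite muleA -EFinM mulVf// mul1e.
rewrite lee_fin => /(_ c0) H.
have := lee_wpmul2l (_ : 0 <= c%:E)%E H; rewrite lee_fin => /(_ c0).
by rewrite muleA -EFinM mulfV// mul1e.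
Qed.

Lemma esum_tuple_prod n (q : 'I_n -> int -> R) (c : 'I_n -> R) :
  (forall i z, 0 <= q i z) ->
  (forall i, \esum_(z in [set: int]) (q i z)%:E = (c i)%:E) ->
  \esum_(k in [set: n.-tuple int]) (\prod_(i < n) q i (tnth k i))%:E =
  (\prod_(i < n) c i)%:E.
Proof.
elim: n q c => [|n IH] q c q0 qc.
  rewrite big_ord0 (_ : [set: 0.-tuple int] = [set [tuple]]); last first.
    by apply/seteqP; split => // k _ /=; rewrite tuple0.
  by rewrite esum_set1 ?big_ord0.
have c0 i : 0 <= c i.
  by rewrite -lee_fin -qc; apply: esum_ge0 => z _; rewrite lee_fin.
pose e (z : int * n.-tuple int) : n.+1.-tuple int := [tuple of z.1 :: z.2].
have e_bij : set_bij [set: int * n.-tuple int] [set: n.+1.-tuple int] e.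
  split => //.
  - move=> [a t] [b u] _ _ /(congr1 val)/= [-> tu].
    by congr (_, _); exact: val_inj.
  - move=> k _; exists (thead k, [tuple of behead k]) => //.
    by rewrite /e /= [RHS]tuple_eta.
rewrite (reindex_esum [set: int * n.-tuple int] [set: n.+1.-tuple int] e)//.
transitivity (\esum_(a in [set: int]) \esum_(t in [set: n.-tuple int])
   ((q ord0 a)%:E * (\prod_(i < n) q (lift ord0 i) (tnth t i))%:E))%E.
  rewrite esum_esum; last by move=> i j _ _; rewrite mule_ge0 ?lee_fin// prodr_ge0.
  rewrite (_ : [set: int] `*`` _ = setT); last by apply/seteqP; split => // -[].
  apply: eq_esum => -[a t] _ /=; rewrite big_ord_recl -EFinM.
  by congr (_ * _)%:E; apply: eq_bigr => i _; rewrite tnthS.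
rewrite big_ord_recl.
transitivity (\esum_(a in [set: int]) ((\prod_(i < n) c (lift ord0 i))%:E * (q ord0 a)%:E))%E.
  apply: eq_esum => a _; rewrite esumZl//; last by move=> t; rewrite lee_fin prodr_ge0.
  by rewrite (IH (fun i => q (lift ord0 i)) (fun i => c (lift ord0 i)))// muleC.
rewrite (@esumZl _ _ (fun z => (q ord0 z)%:E)) ?prodr_ge0//.
  by rewrite (qc ord0) muleC -EFinM.
by move=> z; rewrite lee_fin.
Qed.

(** The exponential of the squared norm factors over the coordinates and the lattice sum is finite,
    so [fine] loses nothing; the prefactor is [w ^+ n], one [w] for each theta. *)
Lemma heat_kernelE n (t : R) (x : Rn R n) : 0 < t ->
  heat_kernel t x = \prod_(i < n) theta t (tnth x i).
Proof.
move=> t0; have p0 := pi_gt0 R.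
have h4 : 0 < 4 * pi * t by rewrite !mulr_gt0.
pose w := expR (- (ln (4 * pi * t) / 2)).
have w0 : w != 0 by rewrite gt_eqF// expR_gt0.
pose q (i : 'I_n) (z : int) := expR (- ((tnth x i + z%:~R) ^+ 2 / (4 * t))).
have qE i z : gauss t (tnth x i + z%:~R) = w * q i z by rewrite /gauss expRD.
have qc i : \esum_(z in [set: int]) (q i z)%:E = (theta t (tnth x i) / w)%:E.
  transitivity (\esum_(z in [set: int]) ((w^-1)%:E * (gauss t (tnth x i + z%:~R))%:E))%E.
    by apply: eq_esum => z _; rewrite qE -EFinM mulrA mulVf// mul1r.
  have g0 z : (0 <= (gauss t (tnth x i + z%:~R))%:E)%E by rewrite lee_fin ltW// gauss_gt0.
  by rewrite esumZl ?invr_ge0 ?expR_ge0// esum_zn// -thetaE// -EFinM mulrC.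
rewrite /heat_kernel.
rewrite (_ : \esum_(k in _) _ = (\prod_(i < n) (theta t (tnth x i) / w))%:E); last first.
  rewrite -(@esum_tuple_prod n q _ _ qc); last by move=> i z; exact: expR_ge0.
  apply: eq_esum => k _; congr EFin; rewrite /q -expR_sum; congr expR.
  rewrite sumrN -mulr_suml /sqnorm; congr (- (_ / _)).
  by apply: eq_bigr => i _; rewrite tnth_mktuple.
rewrite /= big_split/= prodr_const card_ord mulrCA.
rewrite (_ : _ `^ _ = w ^+ n); last first.
  rewrite /powR gt_eqF// /w -expRM_natl; congr expR.
  by rewrite mulrN mulNr; congr (- _); field.
by rewrite -exprMn mulfV// expr1n mulr1.
Qed.

End heat_kernel_product.

(** * The heat equation *)

(** Leibniz rule; [uniq] ensures that the condition j != i drops exactly one factor. *)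
Lemma is_derive_prod_seq (R : realType) (I : eqType) (s : seq I) (g : I -> R -> R)
    (g' : I -> R) (t : R) : uniq s ->
  (forall i, is_derive t 1 (g i) (g' i)) ->
  is_derive t 1 (fun t => \prod_(i <- s) g i t)
    (\sum_(i <- s) g' i * \prod_(j <- s | j != i) g j t).
Proof.
move=> + dg; elim: s => [|a s IH] /=.
  move=> _; rewrite big_nil; under eq_fun do rewrite big_nil.
  exact: der_cst.
move=> /andP[as_ us]; under eq_fun do rewrite big_cons.
apply: (derE (derM (dg a) (IH us))).
rewrite big_cons big_cons eqxx/= addrC mulrC; congr (_ + _).
  congr (_ * _); rewrite big_seq [RHS]big_seq_cond; apply: eq_bigl => j.
  case: (boolP (j \in s)) => //= js; apply/esym; apply: contraNneq as_ => <-.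
  exact: js.
rewrite mulr_sumr; apply: eq_big_seq => i is_.
rewrite big_cons ifT; last by rewrite eq_sym; apply: contraNneq as_ => <-.
by rewrite mulrCA.
Qed.

Lemma integrableM_bounded d (Y : measurableType d) (R : realType)
    (mu : {measure set Y -> \bar R}) (b f : Y -> R) (M : R) :
  measurable_fun setT b -> (forall y, `|b y| <= M) ->
  mu.-integrable setT (EFin \o f) -> mu.-integrable setT (EFin \o (fun y => b y * f y)).
Proof.
move=> mb bM intf.
have M0 (y : Y) : 0 <= M by exact: le_trans (normr_ge0 (b y)) (bM y).
have mf : measurable_fun setT f by apply/measurable_EFinP; exact: (measurable_int mu intf).
apply: (@le_integrable _ _ _ mu setT measurableT _ (fun y => (M * f y)%:E)).
- by apply/measurable_EFinP; exact: measurable_funM.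
- move=> y _; rewrite /= lee_fin !normrM ler_pM// (le_trans (bM y))// ler_norm//.
- by under [X in integrable _ _ X]eq_fun do rewrite EFinM; exact: integrableZl.
Qed.

(** A pointwise limit of measurable difference quotients. It serves [theta2], whose own derivative
    is never computed. *)
Lemma measurable_derivative (R : realType) (q q' : R -> R) :
  measurable_fun setT q -> (forall s : R, is_derive s 1 q (q' s)) ->
  measurable_fun setT q'.
Proof.
move=> mq dq.
pose h j (s : R) := (@dl R j)^-1 *: ((q \o shift s) (@dl R j)%:A - q s).
refine (@measurable_fun_cvg _ _ _ setT h q' _ _).
- move=> j; rewrite (_ : h j = (fun s => (@dl R j)^-1 * (q (@dl R j + s) - q s))); last first.
    by apply/funext => s; rewrite /h /= scaler1.
  apply: measurable_funM => //; apply: measurable_funB => //.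
  by apply: (measurableT_comp mq); exact: measurable_funD.
- move=> s _; have [ds <-] := dq s.
  have /cvgr_dnbhsP := ds; apply; split => [j|].
    by rewrite gt_eqF//; exact: dl_gt0.
  exact: cvg_harmonic.
Qed.

Lemma Rintegral_sum d (Y : measurableType d) (R : realType)
    (mu : {measure set Y -> \bar R}) (I : Type) (s : seq I) (g : I -> Y -> R) :
  (forall i, mu.-integrable setT (EFin \o g i)) ->
  mu.-integrable setT (EFin \o (fun y => \sum_(i <- s) g i y)) /\
  \int[mu]_y (\sum_(i <- s) g i y) = \sum_(i <- s) \int[mu]_y g i y.
Proof.
move=> ig; elim: s => [|a s [IH1 IH2]].
  rewrite big_nil; under [in X in _ /\ X]eq_Rintegral do rewrite big_nil.
  rewrite Rintegral_cst// mul0r; split => //.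
  rewrite (_ : _ \o _ = cst 0%E); first exact: integrable0.
  by apply/funext => y /=; rewrite big_nil.
rewrite (_ : (fun y => _) = g a \+ (fun y => \sum_(i <- s) g i y)); last first.
  by apply/funext => y /=; rewrite big_cons.
rewrite big_cons -IH2 -RintegralD//; split => //.
rewrite (_ : _ \o _ = ((EFin \o g a) \+ (EFin \o (fun y => (\sum_(i <- s) g i y)%R)))%E)//.
exact: integrableD.
Qed.

Lemma integrable_normM d (Y : measurableType d) (R : realType)
    (mu : {measure set Y -> \bar R}) (M : R) (h : Y -> R) :
  mu.-integrable setT (EFin \o h) ->
  mu.-integrable setT (EFin \o (fun y => `|M * h y|)).
Proof.
by move=> inth; apply: integrable_abse (integrableZl measurableT M inth).
Qed.

Section heat_solution.
Context d (Y : measurableType d) (R : realType) (mu : {measure set Y -> \bar R}).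
Variables (n : nat) (c : 'I_n -> Y -> R) (f : Y -> R).
Hypothesis mc : forall i, measurable_fun setT (c i).
Hypothesis intf : mu.-integrable setT (EFin \o f).

Let mtheta (q : R -> R) i (a : R) : measurable_fun setT q ->
  measurable_fun setT (fun y => q (a - c i y)).
Proof. by move=> mq; apply: (measurableT_comp mq); exact: measurable_funB. Qed.

Let mtheta1 (t : R) : 0 < t -> measurable_fun setT (theta1 t).
Proof.
move=> t0; apply: continuous_measurable_fun => s.
apply: differentiable_continuous; apply/derivable1_diffP.
by have [] := is_derive_theta1 s t0.
Qed.

Definition rest (t : R) (x : Rn R n) (i : 'I_n) (y : Y) : R :=
  \prod_(j < n | j != i) theta t (tnth x j - c j y).

Definition kern (t : R) (x : Rn R n) (y : Y) : R :=
  \prod_(j < n) theta t (tnth x j - c j y).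

(** Integration is over an abstract space with coordinate functions [c], so that the same lemmas
    serve the Lebesgue measurable torus and the Borel one. *)
Definition heat_U (t : R) (x : Rn R n) : R := \int[mu]_y (kern t x y * f y).
Definition heat_D1 i (t : R) (x : Rn R n) : R :=
  \int[mu]_y (theta1 t (tnth x i - c i y) * (rest t x i y * f y)).
Definition heat_D2 i (t : R) (x : Rn R n) : R :=
  \int[mu]_y (theta2 t (tnth x i - c i y) * (rest t x i y * f y)).

Lemma measurable_kern t x : 0 < t -> measurable_fun setT (kern t x).
Proof.
by move=> t0; apply: measurable_prod => i _; apply: mtheta; exact: measurable_theta.
Qed.

Lemma measurable_rest t x i : 0 < t -> measurable_fun setT (rest t x i).
Proof.
move=> t0; rewrite /rest; under eq_fun do rewrite big_mkcond.
apply: measurable_prod => j _; case: (j != i) => //.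
by apply: mtheta; exact: measurable_theta.
Qed.

(** The bound is raised to at least 1, so that a product over any part of the indices stays below
    [M ^+ n]. *)
Let bound a b : 0 < a -> a <= b -> exists M, [/\ 1 <= M,
  (forall t s, a <= t <= b -> [/\ `|theta t s| <= M, `|theta1 t s| <= M & `|theta2 t s| <= M]) &
  (forall t x (P : pred 'I_n) y, a <= t <= b ->
     `|\prod_(j < n | P j) theta t (tnth x j - c j y)| <= M ^+ n)].
Proof.
move=> a0 ab; have [M M0 HM] := theta_bound a0 ab.
have M1 : 1 <= Num.max 1 M by rewrite le_max lexx.
exists (Num.max 1 M); split => //.
  move=> t s tab; have [h0 h1 h2] := HM t s tab.
  by split; rewrite le_max ?h0 ?h1 ?h2 orbT.
move=> t x P y tab; rewrite normr_prod big_mkcond.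
rewrite (_ : _ ^+ n = \prod_(j < n) Num.max 1 M); last by rewrite prodr_const card_ord.
apply: ler_prod => j _; case: ifP => _; last by rewrite ler01.
rewrite normr_ge0/= le_max; have [h0 _ _] := HM t (tnth x j - c j y) tab.
by rewrite h0 orbT.
Qed.

Lemma integrable_kern t x : 0 < t ->
  mu.-integrable setT (EFin \o (fun y => kern t x y * f y)).
Proof.
move=> t0; have [M [M1 _ HM]] := bound t0 (lexx t).
apply: (@integrableM_bounded _ _ _ _ _ _ (M ^+ n)) => //; first exact: measurable_kern.
by move=> y; apply: HM; rewrite lexx.
Qed.

Let integrable_rest t x i : 0 < t ->
  mu.-integrable setT (EFin \o (fun y => rest t x i y * f y)).
Proof.
move=> t0; have [M [M1 _ HM]] := bound t0 (lexx t).
apply: (@integrableM_bounded _ _ _ _ _ _ (M ^+ n)) => //; first exact: measurable_rest.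
by move=> y; apply: HM; rewrite lexx.
Qed.

Let is_derive_conv (q q' : R -> R) i (h : Y -> R) (M s : R) :
  (forall s : R, is_derive s 1 q (q' s)) -> (forall s, `|q s| <= M) ->
  (forall s, `|q' s| <= M) -> mu.-integrable setT (EFin \o h) ->
  is_derive s 1 (fun s => \int[mu]_y (q (s - c i y) * h y))
    (\int[mu]_y (q' (s - c i y) * h y)).
Proof.
move=> dq qM q'M inth.
have mq : measurable_fun setT q.
  apply: continuous_measurable_fun => a.
  apply: differentiable_continuous; apply/derivable1_diffP.
  by have [] := dq a.
apply: (@is_derive_Rintegral _ _ _ _ (fun s y => q (s - c i y) * h y)
   (fun s y => q' (s - c i y) * h y) (fun y => `|M * h y|) s 1) => //.
- move=> a _; apply: (@integrableM_bounded _ _ _ _ _ _ M) => //.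
  exact: mtheta.
- move=> a y _.
  have H1 := derD (der_id a) (der_cst (- c i y) a).
  have H2 := @is_derive1_comp _ q _ a _ _ (dq _) H1.
  by have H3 := derM H2 (der_cst (h y) a); apply: (derE H3); ring.
- exact: integrable_normM.
- move=> a y _; rewrite !normrM ler_wpM2r//.
  by apply: le_trans (q'M _) _; exact: ler_norm.
Qed.

Lemma tnth_set_coord (x : Rn R n) i s j :
  tnth (set_coord x i s) j = if j == i then s else tnth x j.
Proof. by rewrite tnth_mktuple. Qed.

Lemma rest_set_coord t (x : Rn R n) i s y : rest t (set_coord x i s) i y = rest t x i y.
Proof. by apply: eq_bigr => j ji; rewrite tnth_set_coord (negbTE ji). Qed.

Lemma kern_set_coord t (x : Rn R n) i s y :
  kern t (set_coord x i s) y = theta t (s - c i y) * rest t x i y.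
Proof.
transitivity (\prod_j theta t ((if j == i then s else tnth x j) - c j y)).
  by apply: eq_bigr => j _; rewrite tnth_set_coord.
rewrite (bigD1 i isT) eqxx; congr (_ * _).
by apply: eq_bigr => j ji; rewrite (negbTE ji).
Qed.

Lemma is_derive_heat_U (t : R) (x : Rn R n) i : 0 < t ->
  is_derive (tnth x i) 1 (fun s => heat_U t (set_coord x i s)) (heat_D1 i t x).
Proof.
move=> t0; have [M [M1 HM _]] := bound t0 (lexx t); have tt : t <= t <= t by rewrite lexx.
rewrite /heat_U (_ : (fun s => _) =
    (fun s => \int[mu]_y (theta t (s - c i y) * (rest t x i y * f y)))); last first.
  by apply/funext => s; apply: eq_Rintegral => y _; rewrite kern_set_coord mulrA.
apply: (@is_derive_conv _ _ _ _ M) => [s|s|s|]; last exact: integrable_rest.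
- exact: is_derive_theta.
- by have [] := HM t s tt.
- by have [] := HM t s tt.
Qed.

Lemma is_derive_heat_D1 (t : R) (x : Rn R n) i : 0 < t ->
  is_derive (tnth x i) 1 (fun s => heat_D1 i t (set_coord x i s)) (heat_D2 i t x).
Proof.
move=> t0; have [M [M1 HM _]] := bound t0 (lexx t); have tt : t <= t <= t by rewrite lexx.
rewrite /heat_D1 (_ : (fun s => _) =
    (fun s => \int[mu]_y (theta1 t (s - c i y) * (rest t x i y * f y)))); last first.
  apply/funext => s; apply: eq_Rintegral => y _.
  by rewrite rest_set_coord tnth_set_coord eqxx.
apply: (@is_derive_conv _ _ _ _ M) => [s|s|s|]; last exact: integrable_rest.
- exact: is_derive_theta1.
- by have [] := HM t s tt.
- by have [] := HM t s tt.
Qed.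

(** The heat equation: by Leibniz the time derivative falls on one theta at a time, where it equals
    the second space derivative. The window from t/2 to 2t keeps the domination uniform. *)
Lemma is_derive_heat_time (t : R) (x : Rn R n) : 0 < t ->
  is_derive t 1 (heat_U ^~ x) (\sum_(i < n) heat_D2 i t x).
Proof.
move=> t0.
have [M [M1 HM HP]] := @bound (t / 2) (2 * t) ltac:(lra) ltac:(lra).
have M0 : 0 <= M by rewrite (le_trans ler01).
pose k' t y := \sum_(i < n) theta2 t (tnth x i - c i y) * rest t x i y.
have tab s : `|s - t| < t / 2 -> t / 2 <= s <= 2 * t.
  by rewrite ltr_norml => /andP[? ?]; apply/andP; split; lra.
have b0 i s y : t / 2 <= s <= 2 * t ->
    `|theta2 s (tnth x i - c i y) * rest s x i y| <= M * M ^+ n.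
  move=> sab; rewrite normrM ler_pM//; first by have [] := HM s (tnth x i - c i y) sab.
  exact: HP.
have mk' i : mu.-integrable setT (EFin \o
    (fun y => theta2 t (tnth x i - c i y) * (rest t x i y * f y))).
  apply: (@integrableM_bounded _ _ _ _ _ _ M).
  - apply: mtheta; apply: measurable_derivative (mtheta1 t0) _ => s.
    exact: is_derive_theta1.
  - by move=> y; have [] := HM t (tnth x i - c i y) ltac:(lra).
  - exact: integrable_rest.
have -> : \sum_(i < n) heat_D2 i t x = \int[mu]_y (k' t y * f y).
  have [_ <-] := Rintegral_sum (index_enum _) mk'.
  by apply: eq_Rintegral => y _; rewrite /k' mulr_suml; apply: eq_bigr => i _; rewrite mulrA.
apply: (@is_derive_Rintegral _ _ _ _ (fun t y => kern t x y * f y)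
   (fun t y => k' t y * f y) (fun y => `|n%:R * (M * M ^+ n) * f y|) t (t / 2)).
- by rewrite divr_gt0.
- by move=> s /tab /andP[s0 _]; apply: integrable_kern; lra.
- move=> s y /tab /andP[sa sb]; have s0 : 0 < s by lra.
  have H1 := is_derive_prod_seq (index_enum_uniq _) (fun i : 'I_n =>
     is_derive_theta_time (tnth x i - c i y) s0).
  have H2 := derM H1 (der_cst (f y) s); apply: (derE H2).
  by rewrite mulr0 add0r mulrC.
- exact: integrable_normM.
- move=> s y /tab sab; rewrite !normrM ler_wpM2r//.
  rewrite -!normrM [leRHS]ger0_norm ?mulr_ge0 ?exprn_ge0//.
  apply: le_trans (ler_norm_sum _ _ _) _.
  apply: le_trans (ler_sum _ (fun i _ => b0 i s y sab)) _.
  by rewrite sumr_const card_ord mulr_natl.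
Qed.

End heat_solution.

Local Open Scope complex_scope.

Section borel_in_lebesgue.
Variables (R : realType) (n : nat).

Lemma borel_measurable (A : set (n.-tuple R)) :
  measurable A -> measurable (A : set (Rn R n)).
Proof. by move=> mA; apply: sub_caratheodory; apply: sub_sigma_algebra. Qed.

Lemma measurable_coord (i : 'I_n) : measurable_fun setT (fun y : Rn R n => tnth y i).
Proof.
move=> _ B mB; rewrite setTI; apply: borel_measurable.
by rewrite -[X in measurable X]setTI; apply: measurable_tnth.
Qed.

End borel_in_lebesgue.

(** * The equation for complex-valued data *)

Section complex_derivatives.
Variable R : realType.

Lemma cderiveP (g : R -> R[i]) (s a b : R) :
  is_derive s 1 (fun r => complex.Re (g r)) a ->
  is_derive s 1 (fun r => complex.Im (g r)) b ->
  cderivable g s /\ cderive g s = a +i* b.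
Proof.
move=> [da <-] [db <-]; split; first by split.
by rewrite /cderive !derive1E.
Qed.

Lemma sum_complex (I : Type) (s : seq I) (a b : I -> R) :
  \sum_(i <- s) (a i +i* b i) = (\sum_(i <- s) a i) +i* (\sum_(i <- s) b i).
Proof.
by apply: (big_rec3 (fun x y z => z = x +i* y)) => // i x y z _ ->.
Qed.

End complex_derivatives.

Section solution.
Variables (R : realType) (n : nat) (f : Rn R n -> R[i]).
Hypothesis intRe : (torus n).-integrable setT (fun y => (complex.Re (f y))%:E).
Hypothesis intIm : (torus n).-integrable setT (fun y => (complex.Im (f y))%:E).
Hypothesis intN : (torus n).-integrable setT (fun y => (normc (f y))%:E).

Let c (i : 'I_n) (y : Rn R n) := tnth y i.
Let mc i : measurable_fun setT (c i). Proof. exact: measurable_coord. Qed.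
Let fr y := complex.Re (f y).
Let fi y := complex.Im (f y).

Lemma heat_kernel_kern t (x y : Rn R n) : 0 < t ->
  heat_kernel t (Rn_sub x y) = kern c t x y.
Proof.
by move=> t0; rewrite heat_kernelE//; apply: eq_bigr => i _; rewrite tnth_mktuple.
Qed.

Lemma heat_convE t x : 0 < t ->
  heat_conv f x t = heat_U (torus n) c fr t x +i* heat_U (torus n) c fi t x.
Proof.
move=> t0; rewrite /heat_conv /heat_U; congr (_ +i* _);
by apply: eq_Rintegral => y _; rewrite heat_kernel_kern.
Qed.

Lemma heat_conv_pderive i t x : 0 < t ->
  pderivable i ((heat_conv f) ^~ t) x /\
  pderive i ((heat_conv f) ^~ t) x =
    heat_D1 (torus n) c fr i t x +i* heat_D1 (torus n) c fi i t x.
Proof.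
move=> t0; apply: cderiveP.
- rewrite (_ : (fun s => _) = fun s => heat_U (torus n) c fr t (set_coord x i s)).
    exact: is_derive_heat_U.
  by apply/funext => s; rewrite heat_convE.
- rewrite (_ : (fun s => _) = fun s => heat_U (torus n) c fi t (set_coord x i s)).
    exact: is_derive_heat_U.
  by apply/funext => s; rewrite heat_convE.
Qed.

Lemma heat_conv_pderive2 i t x : 0 < t ->
  pderivable i (pderive i ((heat_conv f) ^~ t)) x /\
  pderive i (pderive i ((heat_conv f) ^~ t)) x =
    heat_D2 (torus n) c fr i t x +i* heat_D2 (torus n) c fi i t x.
Proof.
move=> t0; rewrite (_ : pderive i _ = fun x =>
    heat_D1 (torus n) c fr i t x +i* heat_D1 (torus n) c fi i t x); last first.
  by apply/funext => y; have [_ ->] := heat_conv_pderive i y t0.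
by apply: cderiveP; exact: is_derive_heat_D1.
Qed.

Lemma heat_conv_time t x : 0 < t ->
  cderivable (heat_conv f x) t /\
  cderive (heat_conv f x) t =
    (\sum_(i < n) heat_D2 (torus n) c fr i t x) +i*
    (\sum_(i < n) heat_D2 (torus n) c fi i t x).
Proof.
move=> t0; have near0 : \near t, 0 < t by exact: lt_nbhsr.
apply: cderiveP.
- apply: near_eq_is_derive (is_derive_heat_time mc intRe x t0).
  by apply: filterS near0 => s s0; rewrite heat_convE.
- apply: near_eq_is_derive (is_derive_heat_time mc intIm x t0).
  by apply: filterS near0 => s s0; rewrite heat_convE.
Qed.

Lemma integrable_heat_conv_solution T : heat_conv_solution f T.
Proof.
move=> x t /andP[t0 _]; split.
  rewrite /heat_conv_abs_cvg.
  rewrite (_ : (fun y => _) = EFin \o (fun y => kern c t x y * normc (f y))).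
    exact: (integrable_kern mc intN x t0).
  by apply/funext => y; rewrite heat_kernel_kern.
split.
- by have [] := heat_conv_time x t0.
- by move=> i y; have [] := heat_conv_pderive i y t0.
- by move=> i y; have [] := heat_conv_pderive2 i y t0.
- have [_ ->] := heat_conv_time x t0; rewrite /laplacian -sum_complex.
  by apply: eq_bigr => i _; have [_ ->] := heat_conv_pderive2 i x t0.
Qed.

End solution.

(** * From Lebesgue to Borel sets *)

Section lebesgue_to_borel.
Variables (R : realType) (n : nat).
Local Notation leb := (@lebesgue R n).
Local Notation tor := (@torus R n).
Local Notation tau := (@tauB R n).

Lemma QcubeE : (@Qcube R n : set (n.-tuple R)) = @QB R n.
Proof.
by apply/seteqP; split => x H i; have := H i; rewrite /Q1 /= in_itv.
Qed.

Lemma torus_borel (A : set (n.-tuple R)) : measurable A -> tor A = tau A.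
Proof.
move=> mA; transitivity (leb (A `&` @QB R n)); first by rewrite -QcubeE.
by apply: lebesgueE; apply: measurableI => //; exact: measurable_QB.
Qed.

Lemma torus_setT : tor setT = 1%E.
Proof. by rewrite torus_borel// probability_setT. Qed.

Lemma torus_le1 (A : set (Rn R n)) : measurable A -> (tor A <= 1)%E.
Proof. by move=> mA; rewrite -torus_setT le_measure// inE. Qed.

Lemma torus_fin_num (A : set (Rn R n)) : measurable A -> tor A \is a fin_num.
Proof. by move=> mA; rewrite ge0_fin_numE// (le_lt_trans (torus_le1 mA))// ltry. Qed.

(** The extended measure is an infimum over countable Borel covers, so a nearly optimal cover
    provides [G]. *)
Let borel_cover_eps (A : set (Rn R n)) (e : R) : measurable A -> 0 < e ->
  exists G : set (n.-tuple R), [/\ measurable G,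
    A `&` @Qcube R n `<=` G & (tau G <= tor A + e%:E)%E].
Proof.
move=> mA e0.
have [x [F [mF AF] <-] xlt] :=
  lb_ereal_inf_adherent e0 (torus_fin_num mA : ereal_inf _ \is a fin_num).
exists (\bigcup_k F k); split => //; first exact: bigcupT_measurable.
apply: ltW; apply: le_lt_trans xlt.
apply: (@le_trans _ _ (borel_lebesgue n (\bigcup_k F k))).
  apply: le_measure; rewrite ?inE//.
  - by apply: measurableI; [exact: bigcupT_measurable|exact: measurable_QB].
  - exact: bigcupT_measurable.
by apply: measure_sigma_subadditive => //; exact: bigcupT_measurable.
Qed.

Lemma borel_cover (A : set (Rn R n)) : measurable A ->
  exists G : set (n.-tuple R), [/\ measurable G,
    A `&` @Qcube R n `<=` G & (tau G <= tor A)%E].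
Proof.
move=> mA; have /choice[G HG] : forall j, exists G : set (n.-tuple R),
    [/\ measurable G, A `&` @Qcube R n `<=` G & (tau G <= tor A + (@dl R j)%:E)%E].
  by move=> j; apply: borel_cover_eps => //; exact: dl_gt0.
have mG : measurable (\bigcap_j G j).
  by apply: bigcapT_measurable => j; have [] := HG j.
exists (\bigcap_j G j); split => //.
  by move=> x Ax j _; have [_ + _] := HG j; exact.
apply/lee_addgt0Pr => e e0; have [j je] : exists j, @dl R j < e.
  by have [k _ /(_ k (leqnn k)) H] := @near_infty_natSinv_lt R (PosNum e0); exists k.
have [mGj _ Gj] := HG j.
apply: (@le_trans _ _ (tau (G j))).
  by apply: le_measure; rewrite ?inE//; apply: bigcap_inf.
by apply: (le_trans Gj); rewrite leeD2l// lee_fin ltW.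
Qed.

(** Let G and H be optimal covers of A and of its complement. Then tau G + tau H <= 1 <= tau (G [|]
    H), so their intersection is null, and off it A and G agree inside the cube; the outside of the
    cube is put into [N]. *)
Lemma borel_modification (A : set (Rn R n)) : measurable A ->
  exists G N : set (n.-tuple R), [/\ measurable G, measurable N, tau N = 0 &
    A `\` N = G `\` N].
Proof.
move=> mA; have [G [mG AG Gle]] := borel_cover mA.
have [H [mH AH Hle]] := borel_cover (measurableC mA).
have mQ := @measurable_QB R n.
exists G, ((G `&` H) `|` ~` @QB R n); split => //.
- by apply: measurableU; [exact: measurableI|exact: measurableC].
- have tQ : tau (~` @QB R n) = 0.
    by rewrite /tauB /mrestr setICl measure0.
  have mGH : measurable (G `&` H) by exact: measurableI.
  suff tGH : tau (G `&` H) = 0.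
    apply/eqP; rewrite eq_le measure_ge0 andbT.
    have : (tau ((G `&` H) `|` ~` @QB R n) <= tau (G `&` H) + tau (~` @QB R n))%E.
      by apply: measureU2 => //; exact: measurableC.
    by rewrite tGH tQ adde0.
  have mGUH : measurable (G `|` H) by exact: measurableU.
  have tauQ : tau (@QB R n) = 1%E.
    transitivity (tau setT); last exact: probability_setT.
    by rewrite /tauB /mrestr setIid setTI.
  have QGH : @QB R n `<=` G `|` H.
    move=> x Qx; rewrite -QcubeE in Qx.
    by have [Ax|Ax] := pselect (A x); [left; apply: AG|right; apply: AH].
  have GH1 : (1 <= tau (G `|` H))%E by rewrite -tauQ le_measure// inE.
  have torA : (tor A + tor (~` A) = 1)%E.
    rewrite -torus_setT -(setUv A) measureU//; first exact: measurableC.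
    by rewrite setICr.
  have fin (B : set (n.-tuple R)) : measurable B -> tau B = (fine (tau B))%:E.
    by move=> mB; rewrite fineK//; exact: fin_num_measure.
  have Htor : (tau G + tau H <= 1)%E by rewrite -torA leeD.
  have GHlt : (tau G < +oo)%E by rewrite (fin _ mG) ltry.
  have : (tau (G `|` H) = tau G + tau H - tau (G `&` H))%E by exact: measureUfinl.
  move: Htor GH1; rewrite (fin _ mG) (fin _ mH) (fin _ mGH) (fin _ mGUH).
  rewrite -!EFinD !lee_fin => H1 H2 [H3].
  have : 0 <= fine (tau (G `&` H)) by exact/fine_ge0/measure_ge0.
  by move=> H4; congr (_%:E); lra.
- apply/seteqP; split => x [Hx /not_orP[GHx /contrapT Qx]];
    have Qx' : @Qcube R n x by rewrite QcubeE.
    split; first exact: AG.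
    by move=> [/GHx|/(_ Qx)].
  split; last by move=> [/GHx|/(_ Qx)].
  by apply: contrapT => Ax; apply: GHx; split => //; exact: AH.
Qed.

End lebesgue_to_borel.

Section borel_function.
Variables (R : realType) (n : nat).
Local Notation tor := (@torus R n).
Local Notation tau := (@tauB R n).

(** Enumerates the rationals; an index that codes none gives 0, again a rational. *)
Let q k : R := if unpickle k is Some r then ratr r else 0.

Let q_between (a b : R) : a < b -> exists k, a < q k < b.
Proof.
move=> /rat_in_itvoo[r]; rewrite in_itv/= => rab.
by exists (pickle r); rewrite /q pickleK.
Qed.

(** The superlevel sets of [h] at rational heights are modified into Borel sets off a common null
    set [M], and [h] is replaced by 0 on [M]. *)
Lemma borel_version (h : Rn R n -> R) : measurable_fun setT h -> (forall x, 0 <= h x) ->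
  exists h' : n.-tuple R -> R, [/\ measurable_fun setT h', (forall x, 0 <= h' x) &
    exists N : set (n.-tuple R), [/\ measurable N, tau N = 0 &
      forall x, ~ N x -> h' x = h x]].
Proof.
move=> mh h0.
pose A k : set (Rn R n) := h @^-1` `]q k, +oo[.
have mA k : measurable (A k) by rewrite -[A k]setTI; exact: mh.
have /choice[G /choice[N HGN]] := fun k => borel_modification (mA k).
pose M := \bigcup_k N k.
have mM : measurable M by apply: bigcupT_measurable => k; have [] := HGN k.
have M0 : tau M = 0.
  apply/(negligibleP _ mM); apply: negligible_bigcup => k.
  by have [_ mN N0 _] := HGN k; exact/(negligibleP _ mN).
pose h' (x : n.-tuple R) := h x * \1_(~` M) x.
have h'M x : M x -> h' x = 0 by move=> Mx; rewrite /h' indicE memNset ?mulr0//; exact.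
have h'N x : ~ M x -> h' x = h x by move=> Mx; rewrite /h' indicE mem_set ?mulr1.
have h'0 x : 0 <= h' x by rewrite mulr_ge0.
have AG k : A k `\` M = G k `\` M.
  have [_ _ _ /seteqP[AG GA]] := HGN k.
  apply/seteqP; split => x [Hx Mx]; split => //.
    by have [] := AG x (conj Hx (fun Nx => Mx (ex_intro2 _ _ k I Nx))).
  by have [] := GA x (conj Hx (fun Nx => Mx (ex_intro2 _ _ k I Nx))).
exists h'; split => //; last by exists M.
apply: (measurability (@RGenOInfty.G R)); first exact: RGenOInfty.measurableE.
move=> _ [_ [a ->] <-]; rewrite setTI.
(* A superlevel set at height a is the union of those at the rational heights q k >= a: everything
   if q k < 0, since h' >= 0, and otherwise a set that avoids [M], where h' vanishes. *)
rewrite (_ : _ @^-1` _ = \bigcup_k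
    (if (a <= q k) then (if q k < 0 then setT else G k `\` M) else set0)).
  apply: bigcupT_measurable => k; case: ifP => // _; case: ifP => // _.
  by apply: measurableD => //; have [] := HGN k.
apply/seteqP; split => x /=.
  rewrite in_itv/= andbT => /q_between[k /andP[aq qh]].
  exists k => //; rewrite (ltW aq); case: ltP => // q0.
  rewrite -AG; have nMx : ~ M x by move=> Mx; move: qh; rewrite h'M// ltNge q0.
  by split => //; rewrite /A /= in_itv/= andbT -h'N.
move=> [k _]; rewrite in_itv/= andbT; case: ifP => // aq; case: ltP => [q0 _|q0].
  by apply: (le_lt_trans aq); apply: lt_le_trans q0 _.
rewrite -AG => -[+ nMx]; rewrite /A /= in_itv/= andbT h'N//.
exact: le_lt_trans.
Qed.

Lemma torus_integral_borel (g : n.-tuple R -> \bar R) :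
  measurable_fun setT g -> (forall x, 0 <= g x)%E ->
  (\int[tor]_x g x = \int[tau]_x g x)%E.
Proof.
move=> mg g0.
have mid : measurable_fun setT (id : Rn R n -> n.-tuple R).
  by move=> _ B mB; rewrite setTI; exact: borel_measurable.
transitivity (\int[pushforward tor (id : Rn R n -> n.-tuple R)]_x g x)%E.
  rewrite (@ge0_integral_pushforward _ _ _ _ _ _ mid tor setT g measurableT mg)//.
apply: eq_measure_integral => //.
by move=> A mA _; exact: (torus_borel mA).
Qed.

Lemma torus_negligible (A : set (n.-tuple R)) : tau.-negligible A -> tor.-negligible A.
Proof.
move=> [B [mB B0 AB]]; exists B; split => //; first exact: borel_measurable.
by rewrite torus_borel.
Qed.

End borel_function.

Section abstract_ae.
Context d (Z : measurableType d) (R : realType) (mu : {measure set Z -> \bar R}).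

Lemma ae_impl (P Q S : Z -> Prop) : {ae mu, forall x, P x} -> {ae mu, forall x, Q x} ->
  (forall x, P x -> Q x -> S x) -> {ae mu, forall x, S x}.
Proof. by move=> HP HQ PQS; apply: filterS2 HP HQ. Qed.

Lemma ae_eq_EFin_integral (f g : Z -> R) : measurable_fun setT f -> measurable_fun setT g ->
  {ae mu, forall x, f x = g x} -> (\int[mu]_x (f x)%:E = \int[mu]_x (g x)%:E)%E.
Proof.
move=> mf mg fg; apply: ae_eq_integral => //; try exact/measurable_EFinP.
by apply: filterS fg => x E _; rewrite /= E.
Qed.

Lemma ge0_integrable_integral_lty (h : Z -> R) : mu.-integrable setT (EFin \o h) ->
  (forall x, 0 <= h x) -> (\int[mu]_x (h x)%:E < +oo)%E.
Proof.
move=> /integrableP[_ +] h0; congr (_ < _)%E.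
by apply: eq_integral => x _; rewrite /= ger0_norm.
Qed.

Lemma integrable_maxr0 (h : Z -> R) : mu.-integrable setT (EFin \o h) ->
  mu.-integrable setT (EFin \o (fun x => Num.max (h x) 0)).
Proof.
move=> ih; have mh : measurable_fun setT h.
  by apply/measurable_EFinP; exact: (measurable_int mu ih).
apply: le_integrable ih => //.
  by apply/measurable_EFinP; exact: measurable_maxr.
move=> x _; rewrite /= lee_fin; case: (leP (h x) 0) => // _.
by rewrite normr0.
Qed.

Lemma maxr0_subr (a : R) : a = Num.max a 0 - Num.max (- a) 0.
Proof. by case: (leP a 0); case: (leP (- a) 0); lra. Qed.

Lemma heat_UB n (c : 'I_n -> Z -> R) (f g : Z -> R) (t : R) (x : Rn R n) :
  (forall i, measurable_fun setT (c i)) ->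
  mu.-integrable setT (EFin \o f) -> mu.-integrable setT (EFin \o g) -> 0 < t ->
  heat_U mu c (f \- g) t x = heat_U mu c f t x - heat_U mu c g t x.
Proof.
move=> mc intf intg t0; rewrite /heat_U.
rewrite -(RintegralB measurableT (integrable_kern mc intf x t0) (integrable_kern mc intg x t0)).
by apply: eq_Rintegral => y _; rewrite /= mulrBr.
Qed.

End abstract_ae.

(** * Convergence to the initial data on the torus *)

Section ae_limit.
Variables (R : realType) (n : nat).
Local Notation tor := (@torus R n).
Local Notation tau := (@tauB R n).
Let c (i : 'I_n) (y : Rn R n) := tnth y i.
Let mc i : measurable_fun setT (c i). Proof. exact: measurable_coord. Qed.
Let cB (i : 'I_n) (y : n.-tuple R) := tnth y i.
Let mcB i : measurable_fun setT (cB i). Proof. exact: measurable_tnth. Qed.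

Let borel_measurable_fun (h : n.-tuple R -> R) : measurable_fun setT h ->
  @measurable_fun _ _ (Rn R n) _ setT h.
Proof.
move=> mh _ B mB; rewrite setTI; apply: (@borel_measurable R n (h @^-1` B)).
by rewrite -[X in measurable X]setTI; exact: mh.
Qed.

(** Equality holds at every x, since integration in y ignores null sets; passing to the Borel
    version changes only the limit value, and that only on a null set. *)
Let heat_U_borel (t : R) (x : Rn R n) (h : Rn R n -> R) (h' : n.-tuple R -> R) :
  measurable_fun setT h -> measurable_fun setT h' -> (forall x, 0 <= h' x) ->
  {ae tor, forall x, h' x = h x} ->
  0 < t -> heat_U tor c h t x = rdif tau (@kernelB R n) t h' x.
Proof.
move=> mh mh' h'0 nN t0; have mh'L := borel_measurable_fun mh'.
congr (fine _).
  transitivity (\int[tor]_y (kern c t x y * h' y)%:E)%E.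
    have mk := measurable_kern mc x t0.
    apply: ae_eq_EFin_integral; [exact: measurable_funM|exact: measurable_funM|].
    by apply: (ae_impl nN nN) => y -> _.
  apply: (@torus_integral_borel R n (fun y => (kernelB t x y * h' y)%:E)).
    by apply/measurable_EFinP; apply: measurable_funM => //; exact: (measurable_kern mcB).
  move=> y; rewrite lee_fin mulr_ge0// prodr_ge0// => i _.
  by apply: ltW; exact: theta_gt0.
Qed.

(** The continuity in time required by [rdif_ae_cvg] comes from differentiability in time. *)
Let continuous_rdif_kernelB (h : n.-tuple R -> R) : tau.-integrable setT (EFin \o h) ->
  forall (x : n.-tuple R) (t0 : R), 0 < t0 ->
  rdif tau (@kernelB R n) t h x @[t --> t0] --> rdif tau (@kernelB R n) t0 h x.
Proof.
move=> ih x t0 t00; have [d _] := is_derive_heat_time mcB ih (x : Rn R n) t00.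
exact: (differentiable_continuous ((derivable1_diffP _ _).1 d)).
Qed.

Let heat_U_cvg_ge0 (h : Rn R n -> R) : tor.-integrable setT (EFin \o h) ->
  (forall x, 0 <= h x) ->
  {ae tor, forall x, heat_U tor c h t x @[t --> 0^'+] --> h x}.
Proof.
move=> ih h0.
have mh : measurable_fun setT h by apply/measurable_EFinP; exact: (measurable_int tor ih).
have [h' [mh' h'0 [N [mN N0 hN]]]] := borel_version mh h0.
have nN : {ae tor, forall x, h' x = h x}.
  exists N; split; [exact: borel_measurable|by rewrite torus_borel|].
  by move=> x /= Hx; apply: contrapT => Nx; apply: Hx; exact: hN.
have mh'L := borel_measurable_fun mh'.
have foo : (\int[tau]_y (h' y)%:E < +oo)%E.
  rewrite -torus_integral_borel; last 2 first.
  - exact/measurable_EFinP.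
  - by move=> x; rewrite lee_fin.
  have -> : (\int[tor]_y (h' y)%:E = \int[tor]_y (h y)%:E)%E.
    exact: ae_eq_EFin_integral.
  exact: ge0_integrable_integral_lty.
have ih' : tau.-integrable setT (EFin \o h').
  apply/integrableP; split; first exact/measurable_EFinP.
  by under eq_integral => y _ do rewrite /= ger0_norm//.
have EU t x : 0 < t -> heat_U tor c h t x = rdif tau (@kernelB R n) t h' x.
  exact: (heat_U_borel x mh mh' h'0 nN).
have ct := continuous_rdif_kernelB ih'.
have osc := osc_cvg0_integrable (diffusion_kernelB R n) (@dl_gt0 R)
  (@osc_cvg0_kernelB R n) mh' h'0 foo.
have H := rdif_ae_cvg (diffusion_kernelB R n) (@dl_gt0 R) mh' h'0 foo osc ct.
apply: (ae_impl (torus_negligible H) nN) => x Hx <-.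
apply: cvg_trans Hx; apply: near_eq_cvg.
by apply: filterS (nbhs_right_gt 0) => t t0; rewrite EU.
Qed.

Lemma heat_U_cvg (h : Rn R n -> R) : tor.-integrable setT (EFin \o h) ->
  {ae tor, forall x, heat_U tor c h t x @[t --> 0^'+] --> h x}.
Proof.
move=> ih.
pose hp x := Num.max (h x) 0; pose hm x := Num.max (- h x) 0.
have ip : tor.-integrable setT (EFin \o hp) by exact: integrable_maxr0.
have im : tor.-integrable setT (EFin \o hm).
  exact: (integrable_maxr0 (integrableN ih)).
have hE : h = hp \- hm.
  by apply/funext => x; exact: maxr0_subr.
have h1 x : 0 <= hp x by rewrite /hp le_max lexx orbT.
have h2 x : 0 <= hm x by rewrite /hm le_max lexx orbT.
apply: (ae_impl (heat_U_cvg_ge0 ip h1) (heat_U_cvg_ge0 im h2)).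
move=> x Hp Hm; have -> : h x = hp x - hm x by rewrite hE.
apply: cvg_trans (cvgB Hp Hm); apply: near_eq_cvg.
apply: filterS (nbhs_right_gt 0) => t t0.
by rewrite [in RHS]hE (heat_UB x mc ip im t0).
Qed.

Lemma integrable_ae_initial_limit (f : Rn R n -> R[i]) :
  tor.-integrable setT (fun y => (complex.Re (f y))%:E) ->
  tor.-integrable setT (fun y => (complex.Im (f y))%:E) -> ae_initial_limit f.
Proof.
move=> iRe iIm; apply: (ae_impl (heat_U_cvg iRe) (heat_U_cvg iIm)) => x HRe HIm.
have H (u : R -> R) (l : R) : u t @[t --> 0^'+] --> l ->
    (u t - l) ^+ 2 @[t --> 0^'+] --> (0 : R).
  move=> ul.
  have H : u t - l @[t --> 0^'+] --> l - l by apply: cvgB => //; exact: cvg_cst.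
  have HH := cvgM H H; rewrite subrr mulr0 in HH.
  under eq_fun do rewrite expr2.
  exact: HH.
pose N t := (heat_U tor c (fun y => complex.Re (f y)) t x - complex.Re (f x)) ^+ 2 +
  (heat_U tor c (fun y => complex.Im (f y)) t x - complex.Im (f x)) ^+ 2.
have HD : N t @[t --> 0^'+] --> (0 : R).
  by rewrite -[X in _ --> X]addr0; apply: cvgD; exact: H.
have HS : Num.sqrt (N t) @[t --> 0^'+] --> Num.sqrt (0 : R).
  by apply: continuous_cvg HD; exact: sqrt_continuous.
rewrite sqrtr0 in HS; apply: cvg_trans HS; apply: near_eq_cvg.
apply: filterS (nbhs_right_gt 0) => t t0.
by rewrite heat_convE// /N; case: (f x).
Qed.

End ae_limit.

(** * Duality for weighted Lebesgue spaces *)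

Section hoelder_lty.
Context d (Z : measurableType d) (R : realType) (mu : {measure set Z -> \bar R}).
Hypothesis mu0 : (0 < mu setT)%E.

Lemma hoelder_conjugate_gt1 (p : R) : 1 < p ->
  hoelder_conjugate p%:E = (p / (p - 1))%:E.
Proof.
move=> p1; have p0 : p != 0 by rewrite gt_eqF// (lt_trans ltr01).
apply/esym/hoelder_conjugateP; [exact: ltNyr|by rewrite eqe|].
rewrite !inver (negbTE p0) mulf_eq0 (negbTE p0) invr_eq0 subr_eq0 gt_eqF//=.
rewrite -EFinD; congr (_%:E); field.
by rewrite p0 subr_eq0 gt_eqF.
Qed.

(** Hoelder for p > 1; for p = 1 the conjugate exponent is infinite and [s] is bounded almost
    everywhere by its essential supremum. *)
Lemma Lnorm_mul_lty (p : R) (u s : Z -> R) : 1 <= p ->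
  measurable_fun setT u -> measurable_fun setT s ->
  (Lnorm mu p%:E (fun x => (u x)%:E) < +oo)%E ->
  (Lnorm mu (hoelder_conjugate p%:E) (fun x => (s x)%:E) < +oo)%E ->
  (\int[mu]_x (`|u x * s x|)%:E < +oo)%E.
Proof.
rewrite le_eqVlt => /orP[/eqP<-|p1] mu_ ms.
  (* [Lnorm] at exponent +oo is the essential supremum only for a measure of positive mass. *)
  rewrite hoelder_conjugate1 Lnorm1 unlock mu0 => uoo soo.
  have s0 : (0 <= ess_sup mu (abse \o (fun x => (s x)%:E)))%E.
    by apply: ess_sup_gee => //; apply: nearW => x; exact: abse_ge0.
  have /fineK E : ess_sup mu (abse \o (fun x => (s x)%:E)) \is a fin_num.
    by rewrite ge0_fin_numE.
  have := ess_sup_ge mu (abse \o (fun x => (s x)%:E)); rewrite -E.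
  set M := fine _ => HM.
  apply: (@le_lt_trans _ _ (\int[mu]_x (M%:E * `|(u x)%:E|))%E).
    apply: ae_ge0_le_integral; first exact: measurableT.
    - by move=> x _; rewrite lee_fin.
    - by apply/measurable_EFinP; apply: measurableT_comp => //; exact: measurable_funM.
    - by move=> x _; rewrite mule_ge0// lee_fin fine_ge0.
    - apply: emeasurable_funM => //; apply/measurable_EFinP; exact: measurableT_comp.
    - apply: filterS HM => x /= Hx _; rewrite -EFinM lee_fin normrM mulrC.
      by rewrite ler_wpM2r// -lee_fin.
  rewrite ge0_integralZl//.
  - by rewrite lte_mul_pinfty// lee_fin fine_ge0.
  - by apply/measurable_EFinP; exact: measurableT_comp.
  - by rewrite lee_fin fine_ge0.
rewrite hoelder_conjugate_gt1// => uoo soo.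
have p0 : 0 < p by lra.
have q0 : 0 < p / (p - 1) by rewrite divr_gt0// subr_gt0.
have pq : p^-1 + (p / (p - 1))^-1 = 1 by field; apply/andP; split; lra.
have H := hoelder mu mu_ ms p0 q0 pq.
rewrite Lnorm1 in H.
apply: (le_lt_trans _ (le_lt_trans H _)) => //.
by rewrite lte_mul_pinfty ?Lnorm_ge0 ?ge0_fin_numE ?Lnorm_ge0.
Qed.

End hoelder_lty.

(** * Test functions for the converse of Hoelder's inequality *)

Section converse.
Context d (Z : measurableType d) (R : realType) (mu : {measure set Z -> \bar R}).
Hypothesis mu1 : mu setT = 1%E.
Variable w : Z -> R.
Hypotheses (mw : measurable_fun setT w) (w0 : forall z, 0 < w z).

(** The normalized indicator of the values above [B]: the set where [w] exceeds [B] has positive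
    measure, or [B] would bound the essential supremum. *)
Let test_function1 (B : R) : (Lnorm mu +oo%E (EFin \o w) = +oo)%E -> 0 <= B ->
  exists G : R -> R, [/\ measurable_fun setT G, (forall r, 0 <= G r),
    (\int[mu]_z (G (w z))%:E <= 1)%E &
    (B%:E <= \int[mu]_z (G (w z) * w z)%:E)%E].
Proof.
have muT : (0 < mu setT)%E by rewrite mu1.
rewrite unlock muT => woo B0.
pose A := w @^-1` `]B, +oo[%classic.
have mA : measurable A by rewrite -[A]setTI; exact: mw.
have wA z : A z -> B < w z by rewrite /A /= in_itv/= andbT.
have wNA z : ~ A z -> w z <= B by rewrite /A /= in_itv/= andbT => /negP; rewrite -leNgt.
have muA : (0 < mu A)%E.
  rewrite lt0e measure_ge0 andbT; apply/eqP => muA0.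
  have : (ess_sup mu (abse \o (EFin \o w)) <= B%:E)%E.
    apply/ess_supP; exists A; split => // z /= Hz; apply: contrapT => /wNA wB.
    by apply: Hz; rewrite lee_fin ger0_norm// ltW.
  by rewrite woo leNgt ltry.
have /fineK mE : mu A \is a fin_num.
  rewrite ge0_fin_numE//; apply: (@le_lt_trans _ _ (mu setT)); last by rewrite mu1 ltry.
  by apply: le_measure; rewrite ?inE.
move: muA mE; set m := fine (mu A) => muA mE.
have m0 : 0 < m by rewrite -lte_fin mE.
pose G r : R := \1_(`]B, +oo[%classic) r / m.
have G0 r : 0 <= G r by rewrite /G mulr_ge0// invr_ge0 ltW.
have mG : measurable_fun setT G by apply: measurable_funM => //; exact: measurable_indic.
have mGw : measurable_fun setT (fun z => G (w z)) by exact: (measurableT_comp mG).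
have GE : (\int[mu]_z (G (w z))%:E = 1)%E.
  transitivity (\int[mu]_z ((m^-1)%:E * (\1_A z)%:E))%E.
    by apply: eq_integral => z _; rewrite -EFinM mulrC.
  rewrite ge0_integralZl//; last 2 first.
  - by apply/measurable_EFinP; exact: measurable_indic.
  - by rewrite lee_fin invr_ge0 ltW.
  have -> : (\int[mu]_z (\1_A z)%:E = mu A)%E by rewrite integral_indic// setIT.
  by rewrite -mE -EFinM mulVf// gt_eqF.
exists G; split => //; first by rewrite GE.
rewrite -[leLHS]mule1 -[X in (_ * X)%E]GE -ge0_integralZl; last 4 first.
- exact: measurableT.
- exact/measurable_EFinP.
- by move=> z _; rewrite lee_fin.
- by rewrite lee_fin.
apply: ge0_le_integral => //.
- by move=> z _; rewrite mule_ge0// lee_fin.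
- by apply: emeasurable_funM => //; exact/measurable_EFinP.
- by apply/measurable_EFinP; exact: measurable_funM.
move=> z _; rewrite -EFinM lee_fin mulrC.
have [/wA wB|nA] := pselect (A z); first by rewrite ler_wpM2l// ltW.
by rewrite /G indicE memNset// !mul0r.
Qed.

(** The extremal function of Hoelder for the truncation W of [w]: G = W^(q-1) I^(-1/p) with I the
    integral of W^q. As (q-1)p = q, the integral of G^p is 1, and that of G w is at least I^(1-1/p)
    = I^(1/q), which reaches [B] once I >= B^q. *)
Let test_function2 (p B : R) : 1 < p ->
  (Lnorm mu (hoelder_conjugate p%:E) (EFin \o w) = +oo)%E -> 1 <= B ->
  exists G : R -> R, [/\ measurable_fun setT G, (forall r, 0 <= G r),
    (\int[mu]_z (G (w z) `^ p)%:E <= 1)%E &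
    (B%:E <= \int[mu]_z (G (w z) * w z)%:E)%E].
Proof.
move=> p1; rewrite hoelder_conjugate_gt1// unlock; set q := p / (p - 1).
have q0 : 0 < q by rewrite divr_gt0 ?subr_gt0//; lra.
have qp : (q - 1) * p = q by rewrite /q; field; lra.
have qV : 1 - p^-1 = q^-1 by rewrite /q; field; apply/andP; split; lra.
move=> woo B1.
pose W j (r : R) := Num.min r j.+1%:R.
have mW j : measurable_fun setT (W j) by exact: measurable_minr.
have W0 j z : 0 < W j (w z) by rewrite /W lt_min w0 ltr0n.
pose g j z := (W j (w z) `^ q)%:E.
have mWw j a : measurable_fun setT (fun z => W j (w z) `^ a).
  by apply: (measurableT_comp (measurable_powR a)); exact: (measurableT_comp (mW j)).
have intw : (\int[mu]_z (w z `^ q)%:E = +oo)%E.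
  apply/eqP; rewrite -leye_eq leNgt; apply/negP => H.
  have := poweR_lty q^-1 H.
  suff -> : (\int[mu]_z (w z `^ q)%:E = \int[mu]_z (`|(EFin \o w) z| `^ q))%E.
    by rewrite woo ltxx.
  by apply: eq_integral => z _ /=; rewrite ger0_norm// ltW.
have cg : (\int[mu]_z g j z)%E @[j --> \oo] --> +oo%E.
  rewrite -intw (_ : (fun z => _) = fun z => limn (g ^~ z)); last first.
    apply/funext => z; apply/esym/cvg_lim => //.
    apply: cvg_near_cst.
    have [k wk] : exists k, w z <= k%:R.
      by exists (Num.truncn (w z)).+1; rewrite ltW// truncnS_gt.
    near=> j; rewrite /g /W min_l// (le_trans wk)// ler_nat.
    by apply: leqW; near: j; exact: nbhs_infty_ge.
  apply: cvg_monotone_convergence => //.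
  - by move=> j; exact/measurable_EFinP.
  - by move=> j z _; rewrite lee_fin powR_ge0.
  - move=> z _ i j ij; rewrite /g lee_fin ge0_ler_powR ?nnegrE ?(ltW (W0 _ _))// ?(ltW q0)//.
    by rewrite /W le_min ge_min lexx ge_min ler_nat ltnS ij orbT.
have [j HB] : exists j, ((B `^ q)%:E <= \int[mu]_z g j z)%E.
  by have /cvgeyPge /(_ (B `^ q)) [k _ /(_ k (leqnn k))] := cg; exists k.
have Ifin : (\int[mu]_z g j z)%E \is a fin_num.
  rewrite ge0_fin_numE; last first.
    by apply: integral_ge0 => z _; rewrite lee_fin powR_ge0.
  apply: (@le_lt_trans _ _ (\int[mu]_z (cst (j.+1%:R `^ q)%:E z))%E).
    apply: ge0_le_integral => //.
    - by move=> z _; rewrite lee_fin powR_ge0.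
    - exact/measurable_EFinP.
    - move=> z _; rewrite lee_fin ge0_ler_powR ?nnegrE ?(ltW (W0 _ _))// ?(ltW q0)//.
      by rewrite /W ge_min lexx orbT.
  rewrite integral_cst// lte_mul_pinfty ?lee_fin ?powR_ge0//.
  by rewrite mu1 ltry.
move: HB; rewrite -(fineK Ifin); set I := fine _; rewrite lee_fin => BI.
have B0 : 0 < B by rewrite (lt_le_trans ltr01).
have I0 : 0 < I by apply: lt_le_trans BI; rewrite powR_gt0.
pose G r := W j r `^ (q - 1) * I `^ (- p^-1).
have GW z : G (w z) * W j (w z) = W j (w z) `^ q * I `^ (- p^-1).
  rewrite /G mulrAC; congr (_ * _).
  rewrite -[X in _ * X]powRr1; last exact: ltW.
  rewrite -powRD; last by apply/implyP => _; rewrite gt_eqF.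
  by congr (_ `^ _); ring.
have mG : measurable_fun setT G.
  apply: measurable_funM => //.
  by apply: (measurableT_comp (measurable_powR _)); exact: mW.
have G0 r : 0 <= G r by rewrite mulr_ge0// powR_ge0.
have mGw : measurable_fun setT (fun z => G (w z)) by exact: (measurableT_comp mG).
exists G; split => //.
  rewrite (_ : (\int[mu]_z _)%E = (\int[mu]_z ((I^-1)%:E * g j z))%E); last first.
    apply: eq_integral => z _; rewrite /g -EFinM; congr (_%:E).
    rewrite /G powRM ?powR_ge0// -!powRrM qp mulNr mulVf ?powR_inv1 1?mulrC//.
      exact: ltW.
    by rewrite gt_eqF//; lra.
  rewrite ge0_integralZl; last 4 first.
  - exact: measurableT.
  - exact/measurable_EFinP.
  - by move=> z _; rewrite lee_fin powR_ge0.
  - by rewrite lee_fin invr_ge0 ltW.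
  by rewrite -(fineK Ifin) -/I -EFinM mulVf// gt_eqF.
apply: (@le_trans _ _ (\int[mu]_z ((I `^ (- p^-1))%:E * g j z))%E).
  rewrite ge0_integralZl; last 4 first.
  - exact: measurableT.
  - exact/measurable_EFinP.
  - by move=> z _; rewrite lee_fin powR_ge0.
  - by rewrite lee_fin powR_ge0.
  rewrite -(fineK Ifin) -/I -EFinM lee_fin.
  rewrite -[X in _ * X](powRr1 (ltW I0)) -powRD; last by apply/implyP => _; rewrite gt_eqF.
  rewrite addrC qV -[leLHS](powRr1 (ltW B0)) -(mulfV (lt0r_neq0 q0)) powRrM.
  by rewrite ge0_ler_powR ?nnegrE ?powR_ge0 ?invr_ge0 ?(ltW q0)// ltW.
apply: ge0_le_integral => //.
- by move=> z _; rewrite mule_ge0// lee_fin powR_ge0.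
- by apply: emeasurable_funM => //; exact/measurable_EFinP.
- by apply/measurable_EFinP; exact: measurable_funM.
move=> z _; rewrite /g -EFinM lee_fin mulrC -GW ler_wpM2l//.
by rewrite /W ge_min lexx.
Unshelve. all: by end_near.
Qed.

Lemma test_function (p B : R) : 1 <= p ->
  (Lnorm mu (hoelder_conjugate p%:E) (EFin \o w) = +oo)%E -> 1 <= B ->
  exists G : R -> R, [/\ measurable_fun setT G, (forall r, 0 <= G r),
    (\int[mu]_z (G (w z) `^ p)%:E <= 1)%E &
    (B%:E <= \int[mu]_z (G (w z) * w z)%:E)%E].
Proof.
rewrite le_eqVlt => /orP[/eqP<-|p1]; last exact: test_function2.
rewrite hoelder_conjugate1 => woo B1.
have [G [mG G0 G1 GB]] := test_function1 woo (le_trans ler01 B1).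
exists G; split => //; rewrite (_ : (\int[mu]_z _)%E = (\int[mu]_z (G (w z))%:E)%E)//.
by apply: eq_integral => z _; rewrite powRr1.
Qed.

(** F^p is the sum of the 2^-(k+1) G_k^p; summing p-th powers bounds the integral of F^p without
    Minkowski's inequality. As F >= 2^-(k+1) G_k almost everywhere, the integral of F w is at least
    2^-(k+1) 4^k >= k/2 for every k. *)
Lemma not_dual_integrable (p : R) : 1 <= p ->
  (Lnorm mu (hoelder_conjugate p%:E) (EFin \o w) = +oo)%E ->
  exists F : R -> R, [/\ measurable_fun setT F, (forall r, 0 <= F r),
    (\int[mu]_z (F (w z) `^ p)%:E < +oo)%E &
    (\int[mu]_z (F (w z) * w z)%:E = +oo)%E].
Proof.
move=> p1 woo.
have p0 : 0 < p by rewrite (lt_le_trans ltr01).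
have B1 k : 1 <= 4 ^+ k :> R by rewrite exprn_ege1// ler1n.
have /choice[G HG] k := test_function p1 woo (B1 k).
pose s k (r : R) : \bar R := (2 ^- k.+1 * G k r `^ p)%:E.
have s0 k r : (0 <= s k r)%E by rewrite lee_fin mulr_ge0// ?invr_ge0 ?exprn_ge0// powR_ge0.
have ms k : measurable_fun setT (s k).
  apply/measurable_EFinP; apply: measurable_funM => //.
  by apply: (measurableT_comp (measurable_powR p)); have [] := HG k.
pose S r : \bar R := (\sum_(0 <= k <oo) s k r)%E.
have S0 r : (0 <= S r)%E by apply: nneseries_ge0.
have mS : measurable_fun setT S by apply: ge0_emeasurable_sum.
have mSw : measurable_fun setT (S \o w) by exact: (measurableT_comp mS).
have msw k : measurable_fun setT (fun z => s k (w z)) by exact: (measurableT_comp (ms k)).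
have c0 k : 0 < (2 ^- k.+1 : R) by rewrite invr_gt0 exprn_gt0.
have mGp k : measurable_fun setT (fun z => G k (w z) `^ p).
  apply: (measurableT_comp (measurable_powR p)).
  by apply: (measurableT_comp _ mw); have [] := HG k.
have intS : (\int[mu]_z S (w z) <= 1)%E.
  rewrite integral_nneseries//.
  apply: le_trans (epsilon_trick0 xpredT ler01).
  apply: lee_nneseries => [k _ _|k _]; first exact: integral_ge0.
  under eq_integral do rewrite /s EFinM.
  rewrite ge0_integralZl; last 4 first.
  - exact: measurableT.
  - exact/measurable_EFinP.
  - by move=> z _; rewrite lee_fin powR_ge0.
  - by rewrite lee_fin ltW.
  have [_ _ G1 _] := HG k.
  rewrite div1r natrX -[leRHS]mule1 lee_wpmul2l// lee_fin ltW//.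
(* Where [S] is infinite, [fine] turns [F] into 0, so [F] dominates the [G k] only off this null
   set. *)
have Sfin : {ae mu, forall z, S (w z) \is a fin_num}.
  have : mu.-integrable setT (S \o w).
    apply/integrableP; split => //.
    rewrite (_ : (\int[mu]_z _)%E = (\int[mu]_z S (w z))%E).
      by rewrite (le_lt_trans intS)// ltry.
    by apply: eq_integral => z _ /=; rewrite gee0_abs.
  by move=> /(integrable_ae measurableT); apply: filterS => z; exact.
pose F r := fine (S r) `^ p^-1.
have F0 r : 0 <= F r by exact: powR_ge0.
have mF : measurable_fun setT F.
  apply: (measurableT_comp (measurable_powR _)).
  by apply: measurableT_comp mS; exact: fine_measurable.
have mFw : measurable_fun setT (fun z => F (w z)) by exact: (measurableT_comp mF).
exists F; split => //.
  apply: le_lt_trans (le_lt_trans intS (ltry 1)).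
  apply: ge0_le_integral => //.
  - by move=> z _; rewrite lee_fin powR_ge0.
  - by apply/measurable_EFinP; apply: (measurableT_comp (measurable_powR p)).
  move=> z _; rewrite /F -powRrM mulVf ?gt_eqF// powRr1 ?fine_ge0//.
  by move: (S0 (w z)); case: (S (w z)) => [r||] //=; rewrite leey.
have sS k r : (s k r <= S r)%E.
  apply: le_trans (nneseries_lim_ge k.+1 _) => //.
  by rewrite big_nat_recr//= leeDr// sume_ge0.
have low k : ((k%:R / 2)%:E <= \int[mu]_z (F (w z) * w z)%:E)%E.
  have [mG G0 G1 GB] := HG k.
  have mGw : measurable_fun setT (fun z => (G k (w z) * w z)%:E).
    by apply/measurable_EFinP; apply: measurable_funM => //; exact: (measurableT_comp mG).
  apply: (@le_trans _ _ (\int[mu]_z ((2 ^- k.+1)%:E * (G k (w z) * w z)%:E))%E).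
    rewrite ge0_integralZl; last 4 first.
    - exact: measurableT.
    - exact: mGw.
    - by move=> z _; rewrite lee_fin mulr_ge0// ltW.
    - by rewrite lee_fin ltW.
    apply: (@le_trans _ _ ((2 ^- k.+1)%:E * (4 ^+ k)%:E)%E); last first.
      by rewrite lee_wpmul2l// lee_fin ltW.
    rewrite -EFinM lee_fin (_ : 4 = 2 * 2 :> R); last by rewrite -natrM.
    have a0 : 2 ^+ k != 0 :> R by rewrite expf_neq0.
    rewrite exprMn exprS;
      rewrite (_ : (2 * 2 ^+ k)^-1 * (2 ^+ k * 2 ^+ k) = 2 ^+ k / 2); last first.
      by move: a0; set a := 2 ^+ k => a0; field.
    rewrite ler_wpM2r ?invr_ge0// -natrX ler_nat.
    by rewrite ltnW// ltn_expl.
  apply: ae_ge0_le_integral; first exact: measurableT.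
  - by move=> z _; rewrite -EFinM lee_fin !mulr_ge0// ltW.
  - by apply: emeasurable_funM.
  - by move=> z _; rewrite lee_fin mulr_ge0// ltW.
  - by apply/measurable_EFinP; exact: measurable_funM.
  apply: filterS Sfin => z Sz _; rewrite -EFinM lee_fin mulrA ler_wpM2r ?(ltW (w0 z))//.
  (* The weight is at most 1 and so is 1/p, hence its power 1/p is no smaller than the weight
     itself. *)
  have c1 : 2 ^- k.+1 <= 1 :> R by rewrite invf_le1 ?exprn_gt0// exprn_ege1// ler1n.
  apply: (@le_trans _ _ ((2 ^- k.+1 * G k (w z) `^ p) `^ p^-1)).
    rewrite powRM ?powR_ge0 ?(ltW (c0 k))// -powRrM mulfV ?gt_eqF// powRr1//.
    rewrite ler_wpM2r// -[leLHS]powRr1 ?(ltW (c0 k))// ger_powR ?c0//.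
    by rewrite invf_le1.
  rewrite ge0_ler_powR ?nnegrE ?invr_ge0 ?(ltW p0)// ?fine_ge0//.
    by rewrite mulr_ge0 ?powR_ge0// ltW.
  by rewrite -lee_fin fineK//; exact: sS.
apply/eqyP => A A0; apply: le_trans (low (Num.truncn (2 * A)).+1).
by rewrite lee_fin ler_pdivlMr// mulrC ltW// truncnS_gt.
Qed.

End converse.

Section duality.
Context d (Z : measurableType d) (R : realType) (mu : {measure set Z -> \bar R}).
Hypothesis mu1 : mu setT = 1%E.

Let mu_gt0 : (0 < mu setT)%E. Proof. by rewrite mu1. Qed.

Lemma integrable_dominated (g h : Z -> R) : measurable_fun setT h ->
  (forall z, `|h z| <= g z) -> mu.-integrable setT (EFin \o g) ->
  mu.-integrable setT (EFin \o h).
Proof.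
move=> mh hg; apply: le_integrable => //; first exact/measurable_EFinP.
by move=> z _; rewrite /= lee_fin (le_trans (hg z))// ler_norm.
Qed.

Lemma Lnorm_mul_bounded (p M : R) (w k : Z -> R) : 1 <= p ->
  measurable_fun setT w -> measurable_fun setT k -> (forall z, `|k z| <= M) ->
  (Lnorm mu (hoelder_conjugate p%:E) (EFin \o w) < +oo)%E ->
  (Lnorm mu (hoelder_conjugate p%:E) (fun z => (w z * k z)%:E) < +oo)%E.
Proof.
move=> p1 mw mk kM.
have wk z : `|w z * k z| <= `|M * w z|.
  by rewrite !normrM mulrC ler_wpM2r// (le_trans (kM z))// ler_norm.
move: p1; rewrite le_eqVlt => /orP[/eqP<-|p1].
  rewrite hoelder_conjugate1 unlock mu_gt0 => woo.
  have s0 : (0 <= ess_sup mu (abse \o (EFin \o w)))%E.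
    by apply: ess_sup_gee => //; apply: nearW => x; exact: abse_ge0.
  have /fineK E : ess_sup mu (abse \o (EFin \o w)) \is a fin_num.
    by rewrite ge0_fin_numE.
  have := ess_sup_ge mu (abse \o (EFin \o w)); rewrite -E => Hw.
  apply: (@le_lt_trans _ _ (`|M| * fine (ess_sup mu (abse \o (EFin \o w))))%:E); last exact: ltry.
  apply/ess_supP; apply: filterS Hw => z /= Hz; rewrite lee_fin (le_trans (wk z))//.
  by rewrite normrM ler_wpM2l// -lee_fin.
rewrite hoelder_conjugate_gt1// unlock; set q := p / (p - 1).
have q0 : 0 < q by rewrite divr_gt0 ?subr_gt0//; lra.
move=> /(lty_poweRy (invr_neq0 (lt0r_neq0 q0))) woo; apply: poweR_lty.
have mwq : measurable_fun setT (fun z => `|w z| `^ q).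
  by apply: (measurableT_comp (measurable_powR q)); exact: measurableT_comp.
apply: (@le_lt_trans _ _ (\int[mu]_z ((`|M| `^ q)%:E * (`|w z| `^ q)%:E))%E).
  apply: ge0_le_integral => //.
  - by move=> z _; rewrite lee_fin powR_ge0.
  - apply/measurable_EFinP; apply: (measurableT_comp (measurable_powR q)).
    by apply: measurableT_comp => //; exact: measurable_funM.
  - by apply: emeasurable_funM => //; exact/measurable_EFinP.
  move=> z _; rewrite -EFinM lee_fin -powRM// -normrM.
  by rewrite ge0_ler_powR ?nnegrE ?(ltW q0).
rewrite ge0_integralZl; last 4 first.
- exact: measurableT.
- exact/measurable_EFinP.
- by move=> z _; rewrite lee_fin powR_ge0.
- by rewrite lee_fin powR_ge0.
by rewrite lte_mul_pinfty// lee_fin powR_ge0.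
Qed.

Variables (p : R) (v : Z -> R).
Hypotheses (p1 : 1 <= p) (mv : measurable_fun setT v) (v0 : forall z, 0 < v z).

Let mvp a : measurable_fun setT (fun z => v z `^ a).
Proof. exact: (measurableT_comp (measurable_powR a)). Qed.

Let vN z : v z `^ (- p^-1) * v z `^ p^-1 = 1.
Proof. by rewrite powRN mulVf// gt_eqF// powR_gt0. Qed.

Lemma ge0_integrable_lower (g k : Z -> R) (a : R) : measurable_fun setT g ->
  measurable_fun setT k -> (forall z, 0 <= g z) -> 0 < a -> (forall z, a <= k z) ->
  (\int[mu]_z (k z * g z)%:E < +oo)%E -> (\int[mu]_z (g z)%:E < +oo)%E.
Proof.
move=> mg mk g0 a0 ak kg.
apply: (@le_lt_trans _ _ (\int[mu]_z ((a^-1)%:E * (k z * g z)%:E))%E).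
  apply: ge0_le_integral => //.
  - by move=> z _; rewrite lee_fin.
  - exact/measurable_EFinP.
  - apply: emeasurable_funM => //; apply/measurable_EFinP; exact: measurable_funM.
  move=> z _; rewrite -EFinM lee_fin mulrA ler_peMl//.
  by rewrite mulrC ler_pdivlMr// mul1r.
rewrite ge0_integralZl; last 4 first.
- exact: measurableT.
- by apply/measurable_EFinP; exact: measurable_funM.
- by move=> z _; rewrite lee_fin mulr_ge0// (le_trans (ltW a0)).
- by rewrite lee_fin invr_ge0 ltW.
by rewrite lte_mul_pinfty// lee_fin invr_ge0 ltW.
Qed.

(** Hoelder applied to g k = (g v^(1/p)) (v^(-1/p) k) makes g k integrable; the lower bound [a] on
    [k] then gives [g]. *)
Lemma dual_weight_integrable (g k : Z -> R) (a : R) : measurable_fun setT g ->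
  measurable_fun setT k -> (forall z, 0 <= g z) -> 0 < a -> (forall z, a <= k z) ->
  (Lnorm mu p%:E (fun z => (g z * v z `^ p^-1)%:E) < +oo)%E ->
  (Lnorm mu (hoelder_conjugate p%:E) (fun z => (v z `^ (- p^-1) * k z)%:E) < +oo)%E ->
  mu.-integrable setT (EFin \o g).
Proof.
move=> mg mk g0 a0 ak Lg Lk; apply/integrableP; split; first exact/measurable_EFinP.
rewrite (_ : (\int[mu]_z _)%E = (\int[mu]_z (g z)%:E)%E); last first.
  by apply: eq_integral => z _; rewrite /= ger0_norm.
apply: (ge0_integrable_lower mg mk g0 a0 ak).
have H := Lnorm_mul_lty mu_gt0 p1 (measurable_funM mg (mvp p^-1))
  (measurable_funM (mvp (- p^-1)) mk) Lg Lk.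
apply: le_lt_trans H; apply: ge0_le_integral => //.
- by move=> z _; rewrite lee_fin mulr_ge0// (le_trans (ltW a0)).
- by apply/measurable_EFinP; exact: measurable_funM.
- apply/measurable_EFinP; apply: measurableT_comp => //.
  by apply: measurable_funM; exact: measurable_funM.
move=> z _; rewrite lee_fin mulrA -(mulrA (g z)) [X in _ * X * _]mulrC vN mulr1.
by rewrite (mulrC (g z)) ler_norm.
Qed.

Lemma dual_weight_Lnorm (k : Z -> R) (M : R) : measurable_fun setT k ->
  (forall z, `|k z| <= M) ->
  (forall F : R -> R, measurable_fun setT F -> (forall r, 0 <= F r) ->
    (Lnorm mu p%:E (fun z => (F (v z) * v z `^ p^-1)%:E) < +oo)%E ->
    (\int[mu]_z (F (v z))%:E < +oo)%E) ->
  (Lnorm mu (hoelder_conjugate p%:E) (fun z => (v z `^ (- p^-1) * k z)%:E) < +oo)%E.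
Proof.
move=> mk kM H; pose w z := v z `^ (- p^-1).
have w0 z : 0 < w z by rewrite powR_gt0.
apply: (Lnorm_mul_bounded p1 (mvp (- p^-1)) mk kM).
rewrite ltNge leye_eq; apply/negP => /eqP woo.
have [F [mF F0 Fp Foo]] := not_dual_integrable mu1 (mvp (- p^-1)) w0 p1 woo.
(* With w = v^(-1/p), this makes F'(v) = F(w) w, of infinite integral, while F'(v) v^(1/p) = F(w)
   has a finite p-norm. *)
pose F' r := F (r `^ (- p^-1)) * r `^ (- p^-1).
have mF' : measurable_fun setT F'.
  apply: measurable_funM; last exact: measurable_powR.
  by apply: (measurableT_comp mF); exact: measurable_powR.
have F'0 r : 0 <= F' r by rewrite mulr_ge0// powR_ge0.
suff : (\int[mu]_z (F' (v z))%:E < +oo)%E by rewrite Foo ltxx.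
apply: H => //; rewrite unlock; apply: poweR_lty.
suff -> : (\int[mu]_z `|(F' (v z) * v z `^ p^-1)%:E| `^ p =
    \int[mu]_z (F (w z) `^ p)%:E)%E by exact: Fp.
by apply: eq_integral => z _; rewrite /F' -mulrA vN mulr1 /= ger0_norm.
Qed.

End duality.

(** * The theorem *)

Section heat_kernel_bounds.
Variables (R : realType) (n : nat).

Lemma heat_kernel_lower (t : R) : 0 < t ->
  exists2 a : R, 0 < a & forall x : Rn R n, a <= heat_kernel t x.
Proof.
move=> t0; exists (gauss t 1 ^+ n); first by rewrite exprn_gt0// gauss_gt0.
move=> x; rewrite heat_kernelE//.
rewrite -[in leLHS](card_ord n) -prodr_const; apply: ler_prod => i _.
by rewrite theta_lower// ltW// gauss_gt0.
Qed.

Lemma heat_kernel_upper (t : R) : 0 < t ->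
  exists M : R, forall x : Rn R n, `|heat_kernel t x| <= M.
Proof.
move=> t0; have [M M0 HM] := theta_bound t0 (lexx t).
exists (M ^+ n) => x; rewrite heat_kernelE// normr_prod.
rewrite -[in leRHS](card_ord n) -prodr_const; apply: ler_prod => i _.
by rewrite normr_ge0; have [] := HM t (tnth x i) ltac:(lra).
Qed.

Lemma measurable_heat_kernel (t : R) : 0 < t ->
  measurable_fun setT (@heat_kernel R n t).
Proof.
move=> t0; rewrite (_ : heat_kernel t = fun x => \prod_(i < n) theta t (tnth x i)).
  apply: measurable_prod => i _.
  apply: (measurableT_comp (measurable_theta t0)); exact: measurable_coord.
by apply/funext => x; rewrite heat_kernelE.
Qed.

End heat_kernel_bounds.

Section normc.
Variable R : realType.

Lemma normcR (a : R) : normc (a%:C : R[i]) = `|a|.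
Proof. by rewrite /normc /= expr0n addr0 sqrtr_sqr. Qed.

Lemma ler_normc_Re (z : R[i]) : `|complex.Re z| <= normc z.
Proof. by case: z => a b; rewrite -sqrtr_sqr ler_wsqrtr// lerDl sqr_ge0. Qed.

Lemma ler_normc_Im (z : R[i]) : `|complex.Im z| <= normc z.
Proof. by case: z => a b; rewrite -sqrtr_sqr ler_wsqrtr// lerDr sqr_ge0. Qed.

Lemma measurable_normc d (Z : measurableType d) (f : Z -> R[i]) :
  measurable_fun setT (fun z => complex.Re (f z)) ->
  measurable_fun setT (fun z => complex.Im (f z)) ->
  measurable_fun setT (fun z => normc (f z)).
Proof.
move=> mRe mIm.
rewrite (_ : (fun z => _) =
    (fun z => Num.sqrt (complex.Re (f z) ^+ 2 + complex.Im (f z) ^+ 2))); last first.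
  by apply/funext => z; case: (f z).
have msqrt : measurable_fun setT (Num.sqrt : R -> R).
  by apply: continuous_measurable_fun; exact: sqrt_continuous.
apply: (measurableT_comp msqrt).
by apply: measurable_funD; exact: measurable_funX.
Qed.

End normc.

Section forward.
Variables (R : realType) (n : nat) (p : R) (v : Rn R n -> R).
Hypotheses (p1 : 1 <= p) (hv : weight v).

Lemma DpT_solution (T : R) (f : Rn R n -> R[i]) : DpT p v -> Lpv p v f ->
  heat_conv_solution f T /\ ae_initial_limit f.
Proof.
move: hv => [mv _ v0] [t0 t00 Lk] [[mRe mIm] _ Lf].
have mN := measurable_normc mRe mIm.
have [a a0 ak] := @heat_kernel_lower R n _ t00.
have intN : (torus n).-integrable setT (EFin \o (fun y => normc (f y))).
  apply: (dual_weight_integrable (@torus_setT R n) p1 mv v0 mN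
    (measurable_heat_kernel t00) _ a0 ak Lf Lk).
  by move=> z; exact: le_trans (normr_ge0 _) (ler_normc_Re _).
have intRe := integrable_dominated mRe (fun z => ler_normc_Re (f z)) intN.
have intIm := integrable_dominated mIm (fun z => ler_normc_Im (f z)) intN.
split; first exact: integrable_heat_conv_solution.
exact: integrable_ae_initial_limit.
Qed.

(** Only absolute convergence at one point and one time is exploited: the kernel is bounded away
    from 0 there, so it forces F(v) to be integrable. *)
Lemma solution_DpT (T : R) : 0 < T ->
  (forall f : Rn R n -> R[i], Lpv p v f -> heat_conv_solution f T) -> DpT p v.
Proof.
(* Any positive time would serve as witness, the kernel being bounded at each of them. *)
move: hv => [mv pv v0] T0 H; exists 1 => //.
have [M HM] := @heat_kernel_upper R n 1 ltr01.
apply: (dual_weight_Lnorm (@torus_setT R n) p1 mv v0 (measurable_heat_kernel ltr01) HM).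
move=> F mF F0 LF; have mFv : measurable_fun setT (fun z => F (v z)) by exact: (measurableT_comp mF).
pose f z : R[i] := (F (v z))%:C.
have fN z : normc (f z) = F (v z) by rewrite normcR ger0_norm.
have Lf : Lpv p v f.
  split.
  - by split => //; exact: measurable_cst.
  - by move=> x i; rewrite /f pv.
  - by under eq_fun do rewrite fN.
pose x0 : Rn R n := [tuple 0 | i < n].
have T0T : 0 < T <= T by rewrite T0 lexx.
have [+ _] := H f Lf x0 T T0T; rewrite /heat_conv_abs_cvg.
under eq_fun do rewrite fN; move=> intF.
have [a a0 ak] := @heat_kernel_lower R n _ T0.
have mk : measurable_fun setT (fun y : Rn R n => heat_kernel T (Rn_sub x0 y)).
  rewrite (_ : (fun y => _) = kern (fun i y => tnth y i) T x0).
    exact: (measurable_kern (fun i => measurable_coord i) x0 T0).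
  by apply/funext => y; exact: heat_kernel_kern.
apply: (ge0_integrable_lower mFv mk (fun z => F0 (v z)) a0 (fun y => ak (Rn_sub x0 y))).
apply: (ge0_integrable_integral_lty intF) => y.
by rewrite mulr_ge0// (le_trans (ltW a0)).
Qed.

End forward.

Theorem theorem1p2 (R : realType) (n : nat) (p T : R) (v : Rn R n -> R)
    (hn : (0 < n)%N) (hp : 1 <= p) (hT0 : 0 < T) (hT : T < 1 / 2)
    (hv : weight v) :
  DpT p v <->
  (forall f : Rn R n -> R[i], Lpv p v f ->
     heat_conv_solution f T /\ ae_initial_limit f).
Proof.
split; first by move=> hD f hf; exact: DpT_solution hf.
by move=> H; apply: (solution_DpT hp hv hT0) => f /H[].
Qed.
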